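(* Let $D=D_{\varepsilon_1}^1\times D_{\varepsilon_2}^2$, where $$D_{\varepsilon_1}^1=\Big\{f:\tfrac1{2\pi}\int_{-\infty}^\infty|f(\lambda)-f_1(\lambda)|d\lambda\le\varepsilon_1\Big\},\qquad D_{\varepsilon_2}^2=\Big\{g:\tfrac1{2\pi}\int_{-\infty}^\infty|g(\lambda)-g_1(\lambda)|^2d\lambda\le\varepsilon_2\Big\}$$ are sets of spectral densities and $f_1,g_1$ are given bounded spectral densities. Let $f_0\in D_{\varepsilon_1}^1$, $g_0\in D_{\varepsilon_2}^2$ satisfy the minimality condition $\int_{-\infty}^\infty\frac{|\gamma(\lambda)|^2}{f_0(\lambda)+g_0(\lambda)}d\lambda<\infty$ for some nontrivial function of exponential type $\gamma(\lambda)=\int_0^\infty\alpha(t)e^{it\lambda}dt$, and let the functions $$h_f(f_0,g_0)=\frac{|A(e^{i\lambda})g_0(\lambda)+C^0(e^{i\lambda})|^2}{(f_0(\lambda)+g_0(\lambda))^2},\qquad h_g(f_0,g_0)=\frac{|A(e^{i\lambda})f_0(\lambda)-C^0(e^{i\lambda})|^2}{(f_0(\lambda)+g_0(\lambda))^2}$$ be bounded. Suppose that there are constants $\alpha_1\ge0$, $\alpha_2\ge0$ and a function $\Psi$ with $|\Psi(\lambda)|\le1$ and $\Psi(\lambda)=\operatorname{sign}(f_0(\lambda)-f_1(\lambda))$ whenever $f_0(\lambda)\ne f_1(\lambda)$, such that $$|A(e^{i\lambda})g_0(\lambda)+C^0(e^{i\lambda})|=(f_0(\lambda)+g_0(\lambda))\Psi(\lambda)\alpha_1,$$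 $$|A(e^{i\lambda})f_0(\lambda)-C^0(e^{i\lambda})|^2=(f_0(\lambda)+g_0(\lambda))^2(g_0(\lambda)-g_1(\lambda))\alpha_2,$$ $$\frac1{2\pi}\int_{-\infty}^\infty|f_0(\lambda)-f_1(\lambda)|d\lambda=\varepsilon_1,\qquad\frac1{2\pi}\int_{-\infty}^\infty|g_0(\lambda)-g_1(\lambda)|^2d\lambda=\varepsilon_2,$$ and that $(f_0,g_0)$ determines a solution of the optimization problem $$\max_{(f,g)\in D}\Big(\langle\mathbf R\mathbf a,\mathbf B^{-1}\mathbf R\mathbf a\rangle+\langle\mathbf Q\mathbf a,\mathbf a\rangle\Big)=\langle\mathbf R^0\mathbf a,(\mathbf B^0)^{-1}\mathbf R^0\mathbf a\rangle+\langle\mathbf Q^0\mathbf a,\mathbf a\rangle .$$ Then $f_0,g_0$ are the least favorable spectral densities in the class $D_{\varepsilon_1}^1\times D_{\varepsilon_2}^2$ for the optimal linear filtering of the functional $A\xi$, and the minimax-robust spectral characteristic of the optimal estimate of $A\xi$ is $$h(f_0,g_0)=\frac{A(e^{i\lambda})f_0(\lambda)-C^0(e^{i\lambda})}{f_0(\lambda)+g_0(\lambda)}.$$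
   Context: Index sets. Let $s\ge1$, $N_0=K_0=0$, let $N_1,\dots,N_s,K_1,\dots,K_s$ be nonnegative reals and $M_l=\sum_{k=0}^l(N_k+K_k)$. Put $\mathbb R^-=(-\infty,0)$, $S=\bigcup_{l=1}^s[-M_l-N_l,-M_l]$, $S^+=\bigcup_{l=1}^s[M_l,M_l+N_l]$, $R^s=[0,\infty)\setminus S^+$, $T=S\cup[0,\infty)$. Processes and functional. $\xi,\eta$ are zero-mean, mutually uncorrelated stationary processes on $\mathbb R$ with spectral densities $f,g$ (nonnegative integrable functions, $E\xi(t)\overline{\xi(u)}=\frac1{2\pi}\int e^{i(t-u)\lambda}f(\lambda)d\lambda$, similarly for $\eta,g$). The functional is $A\xi=\int_{R^s}a(t)\xi(-t)dt$, estimated from observations of $\xi(t)+\eta(t)$, $t\in\mathbb R^-\setminus S$, where $\int_{R^s}|a|dt<\infty$, $\int_{R^s}t|a(t)|^2dt<\infty$. $\mathbf a$ is the function on $T$ equal to $a$ on $R^s$ and $0$ on $S\cup S^+$, regarded as an element of $L_2(T)$. $A(e^{i\lambda})=\int_{R^s}a(t)e^{-it\lambda}dt$. Estimates. $L_2^s(f+g)$ is the closed linear span of $\{e^{it\lambda}:t\in\mathbb R^-\setminus S\}$ in $L_2(\mathbb R,(f+g)d\lambda)$. For a linear estimate with spectral characteristic $h\in L_2^s(f+g)$ the mean-square error is $\Delta(h;f,g)=\frac1{2\pi}\int|A(e^{i\lambda})-h(e^{i\lambda})|^2f(\lambda)d\lambda+\frac1{2\pi}\int|h(e^{i\lambda})|^2g(\lambda)d\lambda$.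 $h(f,g)$ denotes the spectral characteristic of the optimal estimate, i.e. the minimizer of $\Delta(\cdot;f,g)$ over $L_2^s(f+g)$, and $\Delta(f,g)=\Delta(h(f,g);f,g)$. Operators in $L_2(T)$ for a pair $(f,g)$, $t\in T$: $(\mathbf B\mathbf x)(t)=\frac1{2\pi}\int_{-\infty}^\infty\frac{e^{-it\lambda}}{f+g}\big(\int_T\mathbf x(u)e^{iu\lambda}du\big)d\lambda$ (on those $\mathbf x$ for which $\frac1{f+g}\int_T\mathbf x(u)e^{iu\lambda}du\in L_2(\mathbb R)$), $(\mathbf R\mathbf x)(t)=\frac1{2\pi}\int_{-\infty}^\infty\frac{fe^{-it\lambda}}{f+g}\big(\int_T\mathbf x(u)e^{-iu\lambda}du\big)d\lambda$, $(\mathbf Q\mathbf x)(t)=\frac1{2\pi}\int_{-\infty}^\infty\frac{fg\,e^{it\lambda}}{f+g}\big(\int_T\mathbf x(u)e^{-iu\lambda}du\big)d\lambda$, as Fourier integrals in the $L_2$ sense or absolutely convergent. $\mathbf B$ is assumed invertible (with $\mathbf B^{-1}$ on $L_2(T)$) for the densities considered. $\langle x,y\rangle=\int_Tx\overline y\,dt$. $\mathbf B^0,\mathbf R^0,\mathbf Q^0$ are these operators for $(f,g)=(f_0,g_0)$, and $C^0(e^{i\lambda})=\int_T((\mathbf B^0)^{-1}\mathbf R^0\mathbf a)(t)e^{it\lambda}dt$. Minimax notions. For $D=D_f\times D_g$: $(f_0,g_0)\in D$ is least favorable in $D$ for the optimal linear filtering of $A\xi$ if $\Delta(f_0,g_0)=\max_{(f,g)\in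 D}\Delta(f,g)$. With $H_D=\bigcap_{(f,g)\in D}L_2^s(f+g)$, a spectral characteristic $h^0$ is minimax-robust if $h^0\in H_D$ and $\min_{h\in H_D}\max_{(f,g)\in D}\Delta(h;f,g)=\max_{(f,g)\in D}\Delta(h^0;f,g)$. *)

(* Defs.v *)
From HB Require Import structures.
From mathcomp Require Import all_boot all_order all_algebra.
From mathcomp Require Import complex.
From mathcomp Require Import all_classical all_reals all_analysis.
Set Implicit Arguments.
Unset Strict Implicit.
Unset Printing Implicit Defensive.
Import Order.TTheory GRing.Theory Num.Theory numFieldNormedType.Exports.
Import Normc.
Local Open Scope classical_set_scope.
Local Open Scope ring_scope.
Local Open Scope complex_scope.

(* Complex-valued functions of a real variable have type [R -> R[i]], where   *)
(* [normc : R[i] -> R] is the real-valued modulus. Measurability and          *)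
(* integrals are taken componentwise. Elements of L_2 spaces are represented  *)
(* by functions, equality in L_2 being equality almost everywhere.            *)

Section Complex_functions.
Context {R : realType}.
Local Notation mu := (@lebesgue_measure R).
Implicit Types (E : set R) (x y F : R -> R[i]).

Definition expi (t : R) : R[i] := cos t +i* sin t.

Definition cmeasurable E F :=
  measurable_fun E (fun t => complex.Re (F t)) /\
  measurable_fun E (fun t => complex.Im (F t)).

Definition cint E F : R[i] :=
  (\int[mu]_(t in E) complex.Re (F t)) +i* (\int[mu]_(t in E) complex.Im (F t)).

Definition in_L1 E F :=
  cmeasurable E F /\ (\int[mu]_(t in E) (normc (F t))%:E < +oo)%E.

Definition in_L2 E F :=
  cmeasurable E F /\ (\int[mu]_(t in E) (normc (F t) ^+ 2)%:E < +oo)%E.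

Definition inner E x y : R[i] := cint E (fun t => x t * (y t)^*).

Definition fourier_L2 (sgn : R) E x F :=
  in_L2 setT F /\
  (fun n : nat => \int[mu]_l (normc (F l -
     cint (E `&` `[- n%:R, n%:R]%classic) (fun u => x u * expi (sgn * u * l))) ^+ 2)%:E)%E
    @ \oo --> 0%E.

(* The Fourier integral [int_E x(u) e^(i sgn u l) du], with [sgn] being 1 or  *)
(* -1: absolutely convergent if [x] is in L_1(E), otherwise in the L_2 sense. *)
Definition fourier (sgn : R) E x : R -> R[i] :=
  if `[< in_L1 E x >] then fun l => cint E (fun u => x u * expi (sgn * u * l))
  else xget (fun=> 0) [set F | fourier_L2 sgn E x F].

(* An entire function (everywhere convergent power series) of exponential     *)
(* type.                                                                      *)
Definition exponential_type (G : R[i] -> R[i]) :=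
  (exists c : nat -> R[i], forall z,
     (fun n : nat => normc (\sum_(k < n) c k * z ^+ k - G z)) @ \oo --> (0 : R)) /\
  (exists C tau : R, forall z, normc (G z) <= C * expR (tau * normc z)).

End Complex_functions.

Section Observation_pattern.
Context {R : realType}.
Context (s : nat) (N K : nat -> R).

Definition Msum (l : nat) : R := \sum_(0 <= k < l.+1) (N k + K k).

Definition Sset : set R :=
  \bigcup_(l in [set l | (1 <= l <= s)%N]) `[- Msum l - N l, - Msum l]%classic.

Definition Splus : set R :=
  \bigcup_(l in [set l | (1 <= l <= s)%N]) `[Msum l, Msum l + N l]%classic.

Definition Rset : set R := `[0, +oo[%classic `\` Splus.

Definition Tset : set R := Sset `|` `[0, +oo[%classic.

Definition Oset : set R := `]-oo, 0[%classic `\` Sset.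

End Observation_pattern.

Section Filtering.
Context {R : realType}.
Local Notation mu := (@lebesgue_measure R).
Implicit Types (T O Rs : set R) (a h x y : R -> R[i]) (f g : R -> R).

Definition spectral_density f :=
  [/\ measurable_fun setT f, forall l, 0 <= f l &
      (\int[mu]_l (f l)%:E < +oo)%E].

Definition Achar Rs a (l : R) : R[i] :=
  cint Rs (fun t => a t * expi (- t * l)).

Definition abold Rs a (t : R) : R[i] := if t \in Rs then a t else 0.

Definition trig_poly O (p : R -> R[i]) :=
  exists (n : nat) (c : 'I_n -> R[i]) (t : 'I_n -> R),
    (forall k, O (t k)) /\ (forall l, p l = \sum_(k < n) c k * expi (t k * l)).

(* L_2^s(f + g), with [O] the set of observation times. *)
Definition L2s O f g : set (R -> R[i]) := [set h |
  [/\ cmeasurable setT h,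
      (\int[mu]_l (normc (h l) ^+ 2 * (f l + g l))%:E < +oo)%E &
      forall e : R, 0 < e -> exists2 p, trig_poly O p &
        (\int[mu]_l (normc (h l - p l) ^+ 2 * (f l + g l))%:E < e%:E)%E]].

Definition Delta Rs a h f g : \bar R :=
  (((2 * pi)^-1)%:E *
     \int[mu]_l (normc (Achar Rs a l - h l) ^+ 2 * f l)%:E +
   ((2 * pi)^-1)%:E * \int[mu]_l (normc (h l) ^+ 2 * g l)%:E)%E.

Definition optimal_char O Rs a f g h :=
  L2s O f g h /\
  forall h', L2s O f g h' -> (Delta Rs a h f g <= Delta Rs a h' f g)%E.

(* Delta(f, g) = Delta(h(f, g); f, g); the minimizer exists (projection in a  *)
(* Hilbert space) and is unique in L_2(f + g).                                *)
Definition mse O Rs a f g : \bar R :=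
  Delta Rs a (xget (fun=> 0) [set h | optimal_char O Rs a f g h]) f g.

Definition domB T f g x :=
  in_L2 T x /\
  (* the extended quotient makes [1 / (f + g)] infinite where [f + g] is 0 *)
  (\int[mu]_l ((normc (fourier 1 T x l) ^+ 2)%:E / ((f l + g l) ^+ 2)%:E)
     < +oo)%E.

Definition opB T f g x (t : R) : R[i] :=
  ((2 * pi)^-1)%:C *
  fourier (-1) setT (fun l => ((f l + g l)^-1)%:C * fourier 1 T x l) t.

Definition opR T f g x (t : R) : R[i] :=
  ((2 * pi)^-1)%:C *
  fourier (-1) setT (fun l => (f l / (f l + g l))%:C * fourier (-1) T x l) t.

Definition opQ T f g x (t : R) : R[i] :=
  ((2 * pi)^-1)%:C *
  fourier 1 setT (fun l => (f l * g l / (f l + g l))%:C * fourier (-1) T x l) t.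

Definition ae_eq_on T x y := {ae mu, forall t, T t -> x t = y t}.

(* B is an unbounded operator, whose inverse is an operator in L_2(T) with    *)
(* domain the range of B: it is defined at [y] when B is injective and [y] is *)
(* a value of B. Asking B to be onto L_2(T) would be too much: with [T] the   *)
(* half-line it would make [f + g] a Muckenhoupt A_2 weight, and such a       *)
(* weight is not integrable.                                                  *)
Definition B_invertible_at T f g y :=
  (forall x1 x2, domB T f g x1 -> domB T f g x2 ->
     ae_eq_on T (opB T f g x1) (opB T f g x2) -> ae_eq_on T x1 x2) /\
  (exists2 x, domB T f g x & ae_eq_on T (opB T f g x) y).

Definition invB T f g y : R -> R[i] :=
  xget (fun=> 0) [set x | domB T f g x /\ ae_eq_on T (opB T f g x) y].

Definition objective T f g x : R[i] :=
  inner T (opR T f g x) (invB T f g (opR T f g x)) + inner T (opQ T f g x) x.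

Definition Cchar T f g x : R -> R[i] := fourier 1 T (invB T f g (opR T f g x)).

Definition minimality f g :=
  exists (alpha : R -> R[i]) (gam : R[i] -> R[i]),
    [/\ in_L1 `[0, +oo[ alpha \/ in_L2 `[0, +oo[ alpha,
        {ae mu, forall l, gam l%:C = fourier 1 `[0, +oo[ alpha l},
        exponential_type gam,
        exists z, gam z <> 0 &
        (\int[mu]_l ((normc (gam l%:C) ^+ 2)%:E / (f l + g l)%:E) < +oo)%E].

Definition ae_bounded (u : R -> R) :=
  exists C : R, {ae mu, forall l, `|u l| <= C}.

Definition D1 (f1 : R -> R) (eps : R) : set (R -> R) := [set f |
  spectral_density f /\
  (((2 * pi)^-1)%:E * \int[mu]_l `|f l - f1 l|%:E <= eps%:E)%E].

Definition D2 (g1 : R -> R) (eps : R) : set (R -> R) := [set g |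
  spectral_density g /\
  (((2 * pi)^-1)%:E * \int[mu]_l (`|g l - g1 l| ^+ 2)%:E <= eps%:E)%E].

Definition least_favorable O Rs a (D : set ((R -> R) * (R -> R))) f0 g0 :=
  D (f0, g0) /\
  forall f g, D (f, g) -> (mse O Rs a f g <= mse O Rs a f0 g0)%E.

Definition HD O (D : set ((R -> R) * (R -> R))) : set (R -> R[i]) :=
  [set h | forall f g, D (f, g) -> L2s O f g h].

Definition worst_error Rs a (D : set ((R -> R) * (R -> R))) h : \bar R :=
  ereal_sup [set Delta Rs a h fg.1 fg.2 | fg in D].

(* The maximum is attained at [h0]; at the other elements of [HD O D] it is   *)
(* read as a supremum.                                                        *)
Definition minimax_robust O Rs a (D : set ((R -> R) * (R -> R))) h0 :=
  [/\ HD O D h0,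
      exists2 fg, D fg & Delta Rs a h0 fg.1 fg.2 = worst_error Rs a D h0 &
      forall h, HD O D h ->
        (worst_error Rs a D h0 <= worst_error Rs a D h)%E].

End Filtering.

(* Main.v *)
(* The error Delta(h; f, g) is affine in (f, g), so it suffices that h0 is    *)
(* optimal for (f0, g0), that it belongs to L_2^s(f + g) for every (f, g) in  *)
(* D, and that (f0, g0) maximizes Delta(h0; f, g) on D.                       *)
(* Optimality: put b = A f0 / (f0 + g0). Then (b - h0)(f0 + g0) = C0 is the   *)
(* Fourier transform of a function carried by the closed set T, and as it is  *)
(* integrable it is orthogonal to e^(it.) for t outside T.                    *)
(* Membership: by the equation B x = R a the two terms of h0 = G2 - G1 have   *)
(* the same transform on T, so the spectrum of the bounded function h0 avoids *)
(* T. If u is the component of h0 orthogonal to L_2^s(f + g), then v =        *)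
(* conj(u) (f + g) is integrable and its transform vanishes off T.            *)
(* Regularizing v by Poisson kernels shows that the integral of h0 v          *)
(* vanishes, and it is the squared norm of u.                                 *)
(* Maximality: the equations for |A g0 + C0| and |A f0 - C0| say that |A -    *)
(* h0| = Psi alpha1 and |h0|^2 = (g0 - g1) alpha2, the Lagrange conditions    *)
(* for the two balls, and the inequality Delta(h0; f, g) <= Delta(h0; f0, g0) *)
(* follows pointwise.                                                         *)

Require Import Defs.
From HB Require Import structures.
From mathcomp Require Import all_boot all_order all_algebra.
From mathcomp Require Import complex ring lra.
From mathcomp Require Import all_classical all_reals all_analysis.
From mathcomp Require Import measurable_realfun.
Import Order.TTheory GRing.Theory Num.Theory numFieldNormedType.Exports.
Import Normc.
Set Implicit Arguments.
Unset Strict Implicit.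
Unset Printing Implicit Defensive.
Local Open Scope classical_set_scope.
Local Open Scope ring_scope.
Local Open Scope complex_scope.

(** * Complex numbers and complex-valued functions *)

(** The pair formed by [h0] and [(f0, g0)] is a saddle point of the error: Delta(h0; f, g) <=
    Delta(h0; f0, g0) <= Delta(h; f0, g0) for every (f, g) in [D] and every [h] in L_2^s(f0 + g0).
    Once [h0] is known to be admissible for every pair of [D], Delta(f, g) <= Delta(h0; f, g)
    ([mse_le]), and this chain yields the three conclusions.

    Right inequality. Completing the square, 2 pi Delta(h; f, g) is the squared distance from [h] to
    b = A f / (f + g) in L_2(f + g), plus a term free of [h] ([Delta_wnorm2]). The optimal
    characteristic is therefore the orthogonal projection of b on L_2^s(f + g), which exists by
    completeness ([L2w_complete], [L2s_projection]). For (f0, g0) the residual times the weight is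
    [C0], the transform of a function carried by [T]. Since [T] is closed, a point outside it is at
    positive distance from it, and [fourier_vanish] gives the orthogonality to the exponentials of
    the observations.

    Admissibility is the heart of the matter, because [h0] is built from (f0, g0) and has to lie in
    L_2^s(f + g) for every other pair. Write [h0] as G2 - G1 with G1 = C0 / (f0 + g0) and G2 = A f0
    / (f0 + g0): two bounded square-integrable functions whose L_2 transforms agree on [T], by the
    equation B x = R a ([opB_opR_fourier]). A duality between spectrum and support follows: an
    integrable v whose exponential moments vanish off [T] is annihilated by G2 - G1
    ([spectral_orthogonal]). Taking v = conj(h0 - p)(f + g), with p the projection of [h0], forces
    h0 = p ([L2s_fourier]).

    Left inequality. It splits into a linear problem over an L_1 ball and one over an L_2 ball, and
    the equations on [h0] are their Lagrange conditions ([int_le_L1_ball], [int_le_L2_ball]).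

    Analytic tools. The L_2 transform is built from a Plancherel inequality proved with Poisson
    kernels ([plancherel_le]); Poisson means converge in L_1 ([pconv_cvg]); and f0 + g0 is positive
    almost everywhere, since the entire function of the minimality condition has countably many real
    zeros ([entire_zeros_null], [minimality_gt0]). *)

Section Modulus.
Context {R : rcfType}.
Implicit Types z w : R[i].

Lemma cReD z w : complex.Re (z + w) = complex.Re z + complex.Re w.
Proof. by case: z w => [a b] [c d]. Qed.

Lemma cImD z w : complex.Im (z + w) = complex.Im z + complex.Im w.
Proof. by case: z w => [a b] [c d]. Qed.

Lemma cReN z : complex.Re (- z) = - complex.Re z.
Proof. by case: z. Qed.

Lemma cImN z : complex.Im (- z) = - complex.Im z.
Proof. by case: z. Qed.

Lemma cReM z w : complex.Re (z * w) =
  complex.Re z * complex.Re w - complex.Im z * complex.Im w.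
Proof. by case: z w => [a b] [c d]. Qed.

Lemma cImM z w : complex.Im (z * w) =
  complex.Re z * complex.Im w + complex.Im z * complex.Re w.
Proof. by case: z w => [a b] [c d]. Qed.

Lemma cReJ z : complex.Re z^* = complex.Re z.
Proof. by case: z. Qed.

Lemma cImJ z : complex.Im z^* = - complex.Im z.
Proof. by case: z. Qed.

Definition ReImE := (cReD, cImD, cReN, cImN, cReM, cImM, cReJ, cImJ).

Lemma eqcP z w : complex.Re z = complex.Re w -> complex.Im z = complex.Im w ->
  z = w.
Proof. by case: z w => [a b] [c d] /= -> ->. Qed.

Lemma normc2E z : normc z ^+ 2 = complex.Re z ^+ 2 + complex.Im z ^+ 2.
Proof. by case: z => a b /=; rewrite sqr_sqrtr// addr_ge0 ?sqr_ge0. Qed.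

Lemma normc_ge0 z : 0 <= normc z.
Proof. by case: z => a b /=; exact: sqrtr_ge0. Qed.

Lemma normc_conj z : normc z^* = normc z.
Proof. by case: z => a b /=; rewrite sqrrN. Qed.

Lemma normc_real (x : R) : normc x%:C = `|x|.
Proof. by rewrite /= expr0n addr0 sqrtr_sqr. Qed.

Lemma normc_Re z : `|complex.Re z| <= normc z.
Proof.
case: z => a b /=; rewrite -[leLHS]sqrtr_sqr ler_wsqrtr// lerDl.
exact: sqr_ge0.
Qed.

Lemma normc_Im z : `|complex.Im z| <= normc z.
Proof.
case: z => a b /=; rewrite -[leLHS]sqrtr_sqr ler_wsqrtr// lerDr.
exact: sqr_ge0.
Qed.

Lemma normc_le_ReIm z : normc z <= `|complex.Re z| + `|complex.Im z|.
Proof.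
rewrite -(@ler_pXn2r _ 2) ?nnegrE ?normc_ge0 ?addr_ge0//.
rewrite normc2E -[X in X + _ <= _]real_normK ?num_real//.
rewrite -[X in _ + X <= _]real_normK ?num_real//.
have := normr_ge0 (complex.Re z); have := normr_ge0 (complex.Im z).
by move: `|_| `|_| => a b; nra.
Qed.

Lemma normc_le2 z (c : R) : `|complex.Re z| <= c -> `|complex.Im z| <= c ->
  normc z <= 2 * c.
Proof. by move=> h1 h2; have := normc_le_ReIm z; lra. Qed.

Lemma normc_triangle z w : normc (z + w) <= normc z + normc w.
Proof. exact: le_normcD. Qed.

Lemma normcB z w : normc (z - w) = normc (w - z).
Proof. by rewrite -normcN opprB. Qed.

Lemma normc2_addle z w : normc (z + w) ^+ 2 <= 2 * (normc z ^+ 2 + normc w ^+ 2).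
Proof.
rewrite !normc2E !ReImE; move: (complex.Re z) (complex.Im z) => a b.
move: (complex.Re w) (complex.Im w) => c d.
have := sqr_ge0 (a - c); have := sqr_ge0 (b - d); rewrite !sqrrB !sqrrD; lra.
Qed.

Lemma RealM_C (x y : R) : x%:C * y%:C = (x * y)%:C.
Proof. by rewrite -rmorphM. Qed.

Lemma RealV_C (x : R) : (x%:C)^-1 = (x^-1)%:C.
Proof. by rewrite fmorphV. Qed.

Lemma real_complex_eq0 (x : R) : (x%:C == 0) = (x == 0).
Proof. by rewrite eq_complex /= eqxx andbT. Qed.

End Modulus.

Section Expi.
Context {R : realType}.
Implicit Types t u : R.

Lemma expiD t u : expi (t + u) = expi t * expi u.
Proof.
by apply/eqcP; rewrite !ReImE /= ?cosD ?sinD//; ring.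
Qed.

Lemma expiN t : expi (- t) = (expi t)^*.
Proof. by rewrite /expi cosN sinN. Qed.

Lemma normc_expi t : normc (expi t) = 1.
Proof. by rewrite /expi /= cos2Dsin2 sqrtr1. Qed.

End Expi.

(** * Measurability of complex-valued functions *)

Section ComplexMeasurable.
Context {R : realType} {d} {X : measurableType d}.
Implicit Types F G : X -> R[i].

(** On the real line this unfolds to [cmeasurable setT]; the general domain is there for kernels on
    the plane. *)
Definition cmeas F := measurable_fun setT (@complex.Re R \o F) /\
                      measurable_fun setT (@complex.Im R \o F).

Lemma cmeasD F G : cmeas F -> cmeas G -> cmeas (fun x => F x + G x).
Proof.
move=> [rF iF] [rG iG]; split.
  rewrite (_ : _ \o _ = (@complex.Re R \o F) \+ (@complex.Re R \o G)).
    exact: measurable_funD.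
  by apply/funext => x /=; rewrite cReD.
rewrite (_ : _ \o _ = (@complex.Im R \o F) \+ (@complex.Im R \o G)).
  exact: measurable_funD.
by apply/funext => x /=; rewrite cImD.
Qed.

Lemma cmeasN F : cmeas F -> cmeas (fun x => - F x).
Proof.
move=> [rF iF]; split.
  rewrite (_ : _ \o _ = \- (@complex.Re R \o F)); first exact: measurableT_comp.
  by apply/funext => x /=; rewrite cReN.
rewrite (_ : _ \o _ = \- (@complex.Im R \o F)); first exact: measurableT_comp.
by apply/funext => x /=; rewrite cImN.
Qed.

Lemma cmeasB F G : cmeas F -> cmeas G -> cmeas (fun x => F x - G x).
Proof. by move=> mF mG; apply: cmeasD => //; exact: cmeasN. Qed.

Lemma cmeasM F G : cmeas F -> cmeas G -> cmeas (fun x => F x * G x).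
Proof.
move=> [rF iF] [rG iG]; split.
  rewrite (_ : _ \o _ = ((@complex.Re R \o F) \* (@complex.Re R \o G)) \-
    ((@complex.Im R \o F) \* (@complex.Im R \o G))).
    by apply: measurable_funB; exact: measurable_funM.
  by apply/funext => x /=; rewrite cReM.
rewrite (_ : _ \o _ = ((@complex.Re R \o F) \* (@complex.Im R \o G)) \+
    ((@complex.Im R \o F) \* (@complex.Re R \o G))).
  by apply: measurable_funD; exact: measurable_funM.
by apply/funext => x /=; rewrite cImM.
Qed.

Lemma cmeasJ F : cmeas F -> cmeas (fun x => (F x)^*).
Proof.
move=> [rF iF]; split.
  rewrite (_ : _ \o _ = (@complex.Re R \o F)) => //.
  by apply/funext => x /=; rewrite cReJ.
rewrite (_ : _ \o _ = \- (@complex.Im R \o F)); first exact: measurableT_comp.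
by apply/funext => x /=; rewrite cImJ.
Qed.

Lemma cmeas_cst (c : R[i]) : cmeas (fun=> c).
Proof. by split; exact: measurable_cst. Qed.

Lemma cmeas_real (f : X -> R) : measurable_fun setT f ->
  cmeas (fun x => (f x)%:C).
Proof. by move=> mf; split => //; exact: measurable_cst. Qed.

Lemma cmeas_expi (f : X -> R) : measurable_fun setT f ->
  cmeas (fun x => expi (f x)).
Proof.
move=> mf; split.
  apply: (measurableT_comp (f := cos)) => //.
  by apply: continuous_measurable_fun; exact: continuous_cos.
apply: (measurableT_comp (f := sin)) => //.
by apply: continuous_measurable_fun; exact: continuous_sin.
Qed.

Lemma cmeas_sum n (c : 'I_n -> X -> R[i]) :
  (forall k, cmeas (c k)) -> cmeas (fun x => \sum_(k < n) c k x).
Proof.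
elim: n c => [|n IH] c mc.
  rewrite (_ : (fun _ => _) = fun=> 0); first exact: cmeas_cst.
  by apply/funext => x; rewrite big_ord0.
rewrite (_ : (fun _ => _) = fun x =>
  \sum_(k < n) c (widen_ord (leqnSn n) k) x + c ord_max x); last first.
  by apply/funext => x; rewrite big_ord_recr.
by apply: cmeasD => //; apply: IH.
Qed.

Lemma measurable_normc2 F : cmeas F -> measurable_fun setT (fun x => normc (F x) ^+ 2).
Proof.
move=> [rF iF].
rewrite (_ : (fun _ => _) =
  fun x => complex.Re (F x) ^+ 2 + complex.Im (F x) ^+ 2); last first.
  by apply/funext => x; rewrite normc2E.
apply: (measurable_funD (f := fun x => complex.Re (F x) ^+ 2)
  (g := fun x => complex.Im (F x) ^+ 2)).
  exact: (measurable_funX (f := @complex.Re R \o F)).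
exact: (measurable_funX (f := @complex.Im R \o F)).
Qed.

Lemma measurable_normc F : cmeas F -> measurable_fun setT (fun x => normc (F x)).
Proof.
move=> mF.
rewrite (_ : (fun _ => _) = Num.sqrt \o (fun x => normc (F x) ^+ 2)); last first.
  by apply/funext => x /=; rewrite sqrtr_sqr ger0_norm// normc_ge0.
apply: measurableT_comp; last exact: measurable_normc2.
by apply: continuous_measurable_fun; exact: sqrt_continuous.
Qed.

End ComplexMeasurable.

Lemma cmeas_comp {R : realType} {d d'} {X : measurableType d}
    {Y : measurableType d'} (F : Y -> R[i]) (p : X -> Y) :
  cmeas F -> measurable_fun setT p -> cmeas (F \o p).
Proof. by move=> [rF iF] mp; split; [exact: (measurableT_comp rF mp)|
exact: (measurableT_comp iF mp)]. Qed.

(** * Integrals and dominated convergence for complex-valued functions *)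

Section ComplexIntegral.
Context {R : realType}.
Local Notation mu := (@lebesgue_measure R).
Local Notation L1 := (@in_L1 R setT).
Local Notation L2 := (@in_L2 R setT).
Local Notation CI := (@cint R setT).
Implicit Types (F G : R -> R[i]) (f g : R -> R).

Lemma ae_imp (P Q : R -> Prop) : {ae mu, forall x, P x} ->
  (forall x, P x -> Q x) -> {ae mu, forall x, Q x}.
Proof.
by move=> aP PQ; exact: (@filterS _ _ (ae_filter_ringOfSetsType mu) P Q).
Qed.

Lemma ae_imp2 (P Q S : R -> Prop) : {ae mu, forall x, P x} ->
  {ae mu, forall x, Q x} -> (forall x, P x -> Q x -> S x) ->
  {ae mu, forall x, S x}.
Proof.
by move=> aP aQ PQ; exact: (@filterS2 _ _ (ae_filter_ringOfSetsType mu) P Q S).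
Qed.

Lemma ae_all (P : R -> Prop) : (forall x, P x) -> {ae mu, forall x, P x}.
Proof. exact: (aeW mu). Qed.

Lemma integrable_ge0 f : measurable_fun setT f -> (forall x, 0 <= f x) ->
  (\int[mu]_x (f x)%:E < +oo)%E -> mu.-integrable setT (EFin \o f).
Proof.
move=> mf f0 fi; apply/integrableP; split; first exact/measurable_EFinP.
by under eq_integral do rewrite /= ger0_norm//.
Qed.

Lemma integrable_ltoo f : mu.-integrable setT (EFin \o f) -> (forall x, 0 <= f x) ->
  (\int[mu]_x (f x)%:E < +oo)%E.
Proof.
by move=> /integrableP[_ +] f0; under eq_integral do rewrite /= ger0_norm//.
Qed.

Lemma ge0_le_int f g : measurable_fun setT f -> measurable_fun setT g ->
  (forall x, 0 <= f x) -> (forall x, f x <= g x) ->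
  (\int[mu]_x (f x)%:E <= \int[mu]_x (g x)%:E)%E.
Proof.
move=> mf mg f0 fg; apply: ge0_le_integral => //.
- by move=> x _; rewrite lee_fin.
- exact/measurable_EFinP.
- exact/measurable_EFinP.
- by move=> x _; rewrite lee_fin.
Qed.

Lemma ae_ge0_le_int f g : measurable_fun setT f -> measurable_fun setT g ->
  (forall x, 0 <= f x) -> (forall x, 0 <= g x) ->
  {ae mu, forall x, f x <= g x} ->
  (\int[mu]_x (f x)%:E <= \int[mu]_x (g x)%:E)%E.
Proof.
move=> mf mg f0 g0 fg; apply: ae_ge0_le_integral => //.
- by move=> x _; rewrite lee_fin.
- exact/measurable_EFinP.
- by move=> x _; rewrite lee_fin.
- exact/measurable_EFinP.
- by apply: (ae_imp fg) => x ? _; rewrite lee_fin.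
Qed.

Lemma ge0_intD f g : measurable_fun setT f -> measurable_fun setT g ->
  (forall x, 0 <= f x) -> (forall x, 0 <= g x) ->
  (\int[mu]_x (f x + g x)%:E = \int[mu]_x (f x)%:E + \int[mu]_x (g x)%:E)%E.
Proof.
move=> mf mg f0 g0; under eq_integral do rewrite EFinD.
rewrite ge0_integralD//.
- by move=> x _; rewrite lee_fin.
- exact/measurable_EFinP.
- by move=> x _; rewrite lee_fin.
- exact/measurable_EFinP.
Qed.

Lemma ge0_intZ f (c : R) : measurable_fun setT f -> 0 <= c ->
  (forall x, 0 <= f x) ->
  (\int[mu]_x (c * f x)%:E = c%:E * \int[mu]_x (f x)%:E)%E.
Proof.
move=> mf c0 f0; under eq_integral do rewrite EFinM.
by rewrite ge0_integralZl_EFin//; [move=> x _; rewrite lee_fin|exact/measurable_EFinP].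
Qed.

Lemma int_ge0 f : (forall x, 0 <= f x) -> (0 <= \int[mu]_x (f x)%:E)%E.
Proof. by move=> f0; apply: integral_ge0 => x _; rewrite lee_fin. Qed.

Lemma ae_eq_int f g : measurable_fun setT f -> measurable_fun setT g ->
  {ae mu, forall x, f x = g x} ->
  (\int[mu]_x (f x)%:E = \int[mu]_x (g x)%:E)%E.
Proof.
move=> mf mg fg; apply: ae_eq_integral => //; try exact/measurable_EFinP.
by apply: (ae_imp fg) => x + _ => ->.
Qed.

Lemma L1_normc F : L1 F -> mu.-integrable setT (EFin \o (fun x => normc (F x))).
Proof.
move=> [mF iF]; apply: integrable_ge0 => //; first exact: measurable_normc.
by move=> x; exact: normc_ge0.
Qed.

Lemma L1_Re F : L1 F -> mu.-integrable setT (EFin \o (fun x => complex.Re (F x))).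
Proof.
move=> iF; apply: le_integrable (L1_normc iF) => //.
  by case: iF => -[rF _] _; exact/measurable_EFinP.
move=> x _ /=; rewrite lee_fin (ger0_norm (normc_ge0 _)); exact: normc_Re.
Qed.

Lemma L1_Im F : L1 F -> mu.-integrable setT (EFin \o (fun x => complex.Im (F x))).
Proof.
move=> iF; apply: le_integrable (L1_normc iF) => //.
  by case: iF => -[_ rF] _; exact/measurable_EFinP.
move=> x _ /=; rewrite lee_fin (ger0_norm (normc_ge0 _)); exact: normc_Im.
Qed.

Lemma L1_le F g : cmeas F -> mu.-integrable setT (EFin \o g) ->
  {ae mu, forall x, normc (F x) <= g x} -> L1 F.
Proof.
move=> mF ig Fg; split => //.
have mg : measurable_fun setT g by apply/measurable_EFinP; exact: measurable_int ig.
have: (\int[mu]_x (`|g x|)%:E < +oo)%E by have /integrableP[] := ig.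
apply: le_lt_trans; apply: ae_ge0_le_int => //.
- exact: measurable_normc.
- exact: measurableT_comp.
- by move=> x; exact: normc_ge0.
- by apply: (ae_imp Fg) => x /le_trans; apply; exact: ler_norm.
Qed.

Lemma L1D F G : L1 F -> L1 G -> L1 (fun x => F x + G x).
Proof.
move=> iF iG; apply: (@L1_le _ (fun x => normc (F x) + normc (G x))).
- by case: iF iG => ? _ [? _]; exact: cmeasD.
- rewrite (_ : _ \o _ = (EFin \o (fun x => normc (F x))) \+
    (EFin \o (fun x => normc (G x))))%E //.
  by apply: integrableD => //; exact: L1_normc.
- by apply: ae_all => x; exact: normc_triangle.
Qed.

Lemma L1_bounded F G (C : R) : L1 F -> cmeas G ->
  {ae mu, forall x, normc (G x) <= C} -> L1 (fun x => F x * G x).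
Proof.
move=> iF mG GC; apply: (@L1_le _ (fun x => C * normc (F x))).
- by case: iF => ? _; exact: cmeasM.
- rewrite (_ : _ \o _ = (fun x => C%:E * (EFin \o (fun x => normc (F x))) x)%E) //.
  by apply: integrableZl => //; exact: L1_normc.
- apply: (ae_imp GC) => x GCx; rewrite normcM mulrC ler_wpM2r//; exact: normc_ge0.
Qed.

Lemma L1Z F (c : R[i]) : L1 F -> L1 (fun x => c * F x).
Proof.
move=> iF; rewrite (_ : (fun _ => _) = (fun x => F x * c)); last first.
  by apply/funext => x; rewrite mulrC.
by apply: (@L1_bounded _ (fun=> c) (normc c)) => //;
  [exact: cmeas_cst|exact: ae_all].
Qed.

Lemma L1N F : L1 F -> L1 (fun x => - F x).
Proof.
move=> /(@L1Z _ (-1)); congr L1; apply/funext => x; by rewrite mulN1r.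
Qed.

Lemma L1B F G : L1 F -> L1 G -> L1 (fun x => F x - G x).
Proof. by move=> iF iG; apply: L1D => //; exact: L1N. Qed.

Lemma L1_real f : mu.-integrable setT (EFin \o f) -> L1 (fun x => (f x)%:C).
Proof.
move=> fi; apply: (@L1_le _ (fun x => `|f x|)).
- by apply: cmeas_real; apply/measurable_EFinP; exact: measurable_int fi.
- exact: integrable_abse fi.
- by apply: ae_all => x; rewrite normc_real.
Qed.

Lemma CID F G : L1 F -> L1 G -> CI (fun x => F x + G x) = CI F + CI G.
Proof.
move=> iF iG; apply: eqcP; rewrite !ReImE /=.
  under eq_Rintegral do rewrite cReD.
  by rewrite RintegralD//; exact: L1_Re.
under eq_Rintegral do rewrite cImD.
by rewrite RintegralD//; exact: L1_Im.
Qed.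

Lemma CIZ F (c : R[i]) : L1 F -> CI (fun x => c * F x) = c * CI F.
Proof.
move=> iF; have [rF jF] := (L1_Re iF, L1_Im iF).
have sc (a : R) h : mu.-integrable setT (EFin \o h) ->
    mu.-integrable setT (EFin \o (fun x => a * h x)).
  move=> ih; rewrite (_ : _ \o _ = (fun x => a%:E * (EFin \o h) x)%E) //.
  exact: integrableZl.
apply: eqcP; rewrite !ReImE /=.
  under eq_Rintegral do rewrite cReM.
  by rewrite RintegralB ?RintegralZl//; apply: sc.
under eq_Rintegral do rewrite cImM.
by rewrite RintegralD ?RintegralZl//; apply: sc.
Qed.

Lemma CIN F : L1 F -> CI (fun x => - F x) = - CI F.
Proof.
move=> iF; rewrite -mulN1r -CIZ//; congr CI; apply/funext => x.
by rewrite mulN1r.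
Qed.

Lemma CIB F G : L1 F -> L1 G -> CI (fun x => F x - G x) = CI F - CI G.
Proof. by move=> iF iG; rewrite CID ?CIN//; exact: L1N. Qed.

Lemma CI_ae F G : cmeas F -> cmeas G -> {ae mu, forall x, F x = G x} ->
  CI F = CI G.
Proof.
move=> [rF iF] [rG iG] FG; apply: eqcP => /=; rewrite /Rintegral; congr fine;
  apply: ae_eq_int => //; by apply: (ae_imp FG) => x ->.
Qed.

(** The factor 2 comes from bounding the real and imaginary parts separately. Later arguments only
    use finiteness and limits, so constants need not be sharp. *)
Lemma CI_norm F : L1 F -> ((normc (CI F))%:E <= 2%:E * \int[mu]_x (normc (F x))%:E)%E.
Proof.
move=> iF; have iN := L1_normc iF.
rewrite -[X in (_ <= _ * X)%E]fineK; last exact: integrable_fin_num.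
rewrite -EFinM lee_fin; apply: normc_le2 => /=.
  apply: le_trans (le_normr_Rintegral _ (L1_Re iF)) _ => //.
  apply: le_Rintegral => //; first exact: (integrable_abse (L1_Re iF)).
  by move=> x _; exact: normc_Re.
apply: le_trans (le_normr_Rintegral _ (L1_Im iF)) _ => //.
apply: le_Rintegral => //; first exact: (integrable_abse (L1_Im iF)).
by move=> x _; exact: normc_Im.
Qed.

Lemma CI_le_cvg (F_ : nat -> R -> R[i]) F :
  L1 F -> (forall n, L1 (F_ n)) ->
  (fun n => \int[mu]_x (normc (F_ n x - F x))%:E)%E @ \oo --> 0%E ->
  (fun n => normc (CI (F_ n) - CI F)) @ \oo --> (0 : R).
Proof.
move=> iF iFn; have i n : L1 (fun x => F_ n x - F x) by exact: L1B.
move=> /fine_cvgP[_ cv].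
apply: (@squeeze_cvgr _ _ _ _ (fun=> 0)
  (fun n => 2 * fine (\int[mu]_x (normc (F_ n x - F x))%:E)%E)).
- apply: nearW => n; apply/andP; split; first exact: normc_ge0.
  rewrite -CIB// -lee_fin EFinM fineK; first exact: CI_norm.
  exact: (integrable_fin_num measurableT (L1_normc (i n))).
- exact: cvg_cst.
- by rewrite -[X in _ --> X](mulr0 2); apply: cvgM => //; exact: cvg_cst.
Qed.

Lemma L1_dct (F_ : nat -> R -> R[i]) F g :
  (forall n, cmeas (F_ n)) -> cmeas F -> mu.-integrable setT (EFin \o g) ->
  {ae mu, forall x n, normc (F_ n x) <= g x} ->
  {ae mu, forall x, (fun n => normc (F_ n x - F x)) @ \oo --> (0 : R)} ->
  [/\ forall n, L1 (F_ n), L1 F &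
    (fun n => \int[mu]_x (normc (F_ n x - F x))%:E)%E @ \oo --> 0%E].
Proof.
move=> mFn mF ig Fng FnF.
have iFn n : L1 (F_ n).
  by apply: (L1_le (mFn n) ig); apply: (ae_imp Fng) => x Fx; exact: Fx.
(* The bound passes to the limit: at each such point some term is within [e] of [F x]. *)
have Fg : {ae mu, forall x, normc (F x) <= g x}.
  apply: (ae_imp2 Fng FnF) => x le cv.
  apply/ler_addgt0Pl => e e0.
  move/cvgrPdist_lt : cv => /(_ e e0)[n _ /(_ n)/=].
  rewrite leqnn sub0r normrN ger0_norm ?normc_ge0// => /(_ isT) lt.
  rewrite -[F x](subrK (F_ n x)); apply: le_trans (normc_triangle _ _) _.
  by rewrite lerD// normcB ltW.
have iF : L1 F by apply: (L1_le mF ig).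
split => //.
have [] := @dominated_convergence _ _ R mu setT measurableT
  (fun n x => (normc (F_ n x - F x))%:E) (cst 0%E) (fun x => (2 * g x)%:E).
- by move=> n; apply/measurable_EFinP; exact: (measurable_normc (cmeasB (mFn n) mF)).
- exact: measurable_cst.
- by apply: (ae_imp FnF) => x cv _ /=; apply: cvg_EFin => //; exact: nearW.
- rewrite (_ : (fun _ => _) = (fun x => 2%:E * (EFin \o g) x)%E) //.
  exact: integrableZl.
- apply: (ae_imp2 Fng Fg) => x l1 l2 n _.
  rewrite /= lee_fin ger0_norm ?normc_ge0//.
  apply: le_trans (normc_triangle _ _) _; rewrite normcN mulr_natl mulr2n.
  exact: lerD.
- by move=> _ _; rewrite integral0.
Qed.

Lemma CI_dct (F_ : nat -> R -> R[i]) F g :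
  (forall n, cmeas (F_ n)) -> cmeas F -> mu.-integrable setT (EFin \o g) ->
  {ae mu, forall x n, normc (F_ n x) <= g x} ->
  {ae mu, forall x, (fun n => normc (F_ n x - F x)) @ \oo --> (0 : R)} ->
  (fun n => normc (CI (F_ n) - CI F)) @ \oo --> (0 : R).
Proof.
move=> mFn mF ig Fng FnF; have [iFn iF cv] := L1_dct mFn mF ig Fng FnF.
exact: (CI_le_cvg iF iFn cv).
Qed.

(** Convergence of complex numbers is expressed throughout by real moduli tending to 0; limits in
    this sense are unique by the triangle inequality. *)
Lemma CI_unique (z_ : nat -> R[i]) (z w : R[i]) :
  (fun n => normc (z_ n - z)) @ \oo --> (0 : R) ->
  (fun n => normc (z_ n - w)) @ \oo --> (0 : R) -> z = w.
Proof.
move=> cz cw; apply/eqP; rewrite -subr_eq0; apply/eqP/eq0_normc.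
have : (fun n => normc (z_ n - z) + normc (z_ n - w)) @ \oo --> (0 : R).
  by rewrite -[X in _ --> X](addr0 0); exact: cvgD.
move=> cv; apply/eqP; rewrite eq_le normc_ge0 andbT.
rewrite -(cvg_lim _ cv)//; apply: limr_ge; first by apply/cvg_ex; exists 0.
apply: nearW => n; rewrite (_ : z - w = (z_ n - w) - (z_ n - z)); last by ring.
by apply: le_trans (normc_triangle _ _) _; rewrite normcN addrC.
Qed.

Lemma L2_normc2 F : L2 F -> mu.-integrable setT (EFin \o (fun x => normc (F x) ^+ 2)).
Proof.
move=> [mF iF]; apply: integrable_ge0 => //; first exact: measurable_normc2.
by move=> x; exact: sqr_ge0.
Qed.

Lemma L2_le F g : cmeas F -> mu.-integrable setT (EFin \o g) ->
  {ae mu, forall x, normc (F x) ^+ 2 <= g x} -> L2 F.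
Proof.
move=> mF ig Fg; split => //.
have mg : measurable_fun setT g by apply/measurable_EFinP; exact: measurable_int ig.
have: (\int[mu]_x (`|g x|)%:E < +oo)%E by have /integrableP[] := ig.
apply: le_lt_trans; apply: ae_ge0_le_int => //.
- exact: measurable_normc2.
- exact: measurableT_comp.
- by move=> x; exact: sqr_ge0.
- by apply: (ae_imp Fg) => x /le_trans; apply; exact: ler_norm.
Qed.

Lemma integrableD_fun f g : mu.-integrable setT (EFin \o f) ->
  mu.-integrable setT (EFin \o g) ->
  mu.-integrable setT (EFin \o (fun x => f x + g x)).
Proof. by move=> fi gi; have := integrableD measurableT fi gi. Qed.

Lemma integrableZ_fun (c : R) f : mu.-integrable setT (EFin \o f) ->
  mu.-integrable setT (EFin \o (fun x => c * f x)).
Proof. by move=> fi; have := integrableZl measurableT c fi. Qed.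

Lemma L2D F G : L2 F -> L2 G -> L2 (fun x => F x + G x).
Proof.
move=> iF iG; apply: (@L2_le _ (fun x => 2 * (normc (F x) ^+ 2 + normc (G x) ^+ 2))).
- by case: iF iG => ? _ [? _]; exact: cmeasD.
- by apply: integrableZ_fun; apply: integrableD_fun; exact: L2_normc2.
- by apply: ae_all => x; exact: normc2_addle.
Qed.

Lemma L2N F : L2 F -> L2 (fun x => - F x).
Proof.
move=> iF; apply: L2_le (L2_normc2 iF) _; first by apply: cmeasN; case: iF.
by apply: ae_all => x; rewrite normcN.
Qed.

Lemma L2B F G : L2 F -> L2 G -> L2 (fun x => F x - G x).
Proof. by move=> iF iG; apply: L2D => //; exact: L2N. Qed.

Lemma L2_bounded F G (C : R) : L2 F -> cmeas G ->
  {ae mu, forall x, normc (G x) <= C} -> L2 (fun x => G x * F x).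
Proof.
move=> iF mG GC; apply: (@L2_le _ (fun x => C ^+ 2 * normc (F x) ^+ 2)).
- by case: iF => ? _; exact: cmeasM.
- by apply: integrableZ_fun; exact: L2_normc2.
- apply: (ae_imp GC) => x GCx; rewrite normcM exprMn ler_wpM2r ?sqr_ge0//.
  by rewrite ler_pXn2r ?nnegrE ?normc_ge0// (le_trans (normc_ge0 _) GCx).
Qed.

Lemma L2M F G : L2 F -> L2 G -> L1 (fun x => F x * G x).
Proof.
move=> iF iG; apply: (@L1_le _ (fun x => normc (F x) ^+ 2 + normc (G x) ^+ 2)).
- by case: iF iG => ? _ [? _]; exact: cmeasM.
- by apply: integrableD_fun; exact: L2_normc2.
- apply: ae_all => x; rewrite normcM; have := normc_ge0 (F x); have := normc_ge0 (G x).
  by move: (normc _) (normc _) => a b; nra.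
Qed.

(* AM-GM with an arbitrary weight [e] replaces the Cauchy-Schwarz inequality. *)
Lemma L2_cvg_mul (F_ : nat -> R -> R[i]) F G :
  (forall n, L2 (F_ n)) -> L2 F -> L2 G ->
  (fun n => \int[mu]_x (normc (F_ n x - F x) ^+ 2)%:E)%E @ \oo --> 0%E ->
  (fun n => \int[mu]_x (normc (F_ n x * G x - F x * G x))%:E)%E @ \oo --> 0%E.
Proof.
move=> iFn iF iG cv.
have iB n : L2 (fun x => F_ n x - F x) by exact: L2B.
pose S := fine (\int[mu]_x (normc (G x) ^+ 2)%:E)%E.
have S0 : 0 <= S by apply/fine_ge0/int_ge0 => x; exact: sqr_ge0.
have bnd n (e : R) : 0 < e ->
    (\int[mu]_x (normc (F_ n x * G x - F x * G x))%:E <=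
     (e^-1)%:E * \int[mu]_x (normc (F_ n x - F x) ^+ 2)%:E + (e * S)%:E)%E.
  move=> e0; rewrite (EFinM e) fineK; last exact: (integrable_fin_num measurableT (L2_normc2 iG)).
  have mB := measurable_normc2 (iB n).1; have mG := measurable_normc2 iG.1.
  rewrite -ge0_intZ ?invr_ge0 ?(ltW e0)//; last by move=> x; exact: sqr_ge0.
  rewrite -ge0_intZ ?(ltW e0)//; last by move=> x; exact: sqr_ge0.
  rewrite -ge0_intD//; first last.
  - by move=> x; rewrite mulr_ge0 ?sqr_ge0// ltW.
  - by move=> x; rewrite mulr_ge0 ?sqr_ge0// invr_ge0 ltW.
  - exact: measurable_funM.
  - exact: measurable_funM.
  apply: ge0_le_int.
  - apply: measurable_normc; apply: cmeasB; apply: cmeasM;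
      by [case: (iFn n)|case: iF|case: iG].
  - by apply: measurable_funD; apply: measurable_funM.
  - by move=> x; exact: normc_ge0.
  - move=> x; rewrite -mulrBl normcM.
    move: (normc_ge0 (F_ n x - F x)) (normc_ge0 (G x)).
    move: (normc _) (normc _) => a b a0 b0.
    rewrite -(ler_pM2l e0).
    have -> : e * (e^-1 * b ^+ 2 + e * a ^+ 2) = b ^+ 2 + (e * a) ^+ 2.
      by field; rewrite gt_eqF.
    have := sqr_ge0 (b - e * a); nra.
apply/fine_cvgP; split.
  apply: nearW => n; apply: (integrable_fin_num measurableT (L1_normc _)).
  by apply: L1B; apply: L2M.
apply/cvgrPdist_le => d d0.
have eP : 0 < d / (2 * (S + 1)) by apply: divr_gt0 => //; lra.
set e := d / _ in eP.
(* The weight [e] gives [e * S <= d / 2], and closeness [d * e / 2] in squared norm bounds the other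
   term by [d / 2]. The [+ 1] in [e] covers [S = 0]. *)
have /fine_cvgP[_ /cvgrPdist_le/(_ (d * e / 2))] := cv.
have de : 0 < d * e / 2 by nra.
move=> /(_ de); apply: filterS => n /=; rewrite !sub0r !normrN.
have fB := integrable_fin_num measurableT (L2_normc2 (iB n)).
rewrite !ger0_norm ?fine_ge0 ?int_ge0// => [le||]; first last.
- by move=> x; exact: sqr_ge0.
- by move=> x; exact: normc_ge0.
have := bnd n e eP; rewrite -[X in (_ <= _ * X + _)%E]fineK// -EFinM -EFinD.
rewrite -[X in (X <= _)%E]fineK ?lee_fin; last first.
  apply: (integrable_fin_num measurableT (L1_normc _)).
  by apply: L1B; apply: L2M.
move=> h; apply: le_trans h _.
have h1 : e * S <= d / 2.
  rewrite /e mulrAC ler_pdivrMr; last lra.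
  by rewrite mulrA -mulrA mulrC; nra.
have h2 : e^-1 * fine (\int[mu]_x (normc (F_ n x - F x) ^+ 2)%:E)%E <= d / 2.
  by rewrite mulrC ler_pdivrMr//; lra.
lra.
Qed.

End ComplexIntegral.

(** * Fourier transforms of integrable functions *)

Section FourierL1.
Context {R : realType}.
Local Notation mu := (@lebesgue_measure R).
Local Notation L1 := (@in_L1 R setT).
Local Notation CI := (@cint R setT).
Implicit Types (F G : R -> R[i]) (f g : R -> R).

Definition meas2 (k : R -> R -> R) :=
  measurable_fun setT (fun p : R * R => k p.1 p.2).

Definition cmeas2 (K : R -> R -> R[i]) := cmeas (fun p : R * R => K p.1 p.2).

Lemma meas2_swap (k : R -> R -> R) : meas2 k -> meas2 (fun a b => k b a).
Proof. by move=> mk; have := measurableT_comp mk (@measurable_swap _ _ R R). Qed.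

Lemma cmeas2_swap (K : R -> R -> R[i]) : cmeas2 K -> cmeas2 (fun a b => K b a).
Proof.
by move=> mK; have := cmeas_comp mK (@measurable_swap _ _ R R).
Qed.

Lemma cmeas2_fst F : cmeas F -> cmeas2 (fun a _ => F a).
Proof. by move=> mF; have := cmeas_comp mF (@measurable_fst _ _ R R). Qed.

Lemma cmeas2_snd F : cmeas F -> cmeas2 (fun _ b => F b).
Proof. by move=> mF; have := cmeas_comp mF (@measurable_snd _ _ R R). Qed.

Lemma meas2_fst f : measurable_fun setT f -> meas2 (fun a _ => f a).
Proof. by move=> mF; have := measurableT_comp mF (@measurable_fst _ _ R R). Qed.

Lemma meas2_snd f : measurable_fun setT f -> meas2 (fun _ b => f b).
Proof. by move=> mF; have := measurableT_comp mF (@measurable_snd _ _ R R). Qed.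

Lemma cmeas2_expi (s : R) : cmeas2 (fun a b => expi (s * a * b)).
Proof.
apply: cmeas_expi; apply: measurable_funM; last exact: measurable_snd.
by apply: measurable_funM; [exact: measurable_cst|exact: measurable_fst].
Qed.

Lemma cmeas2_slice (K : R -> R -> R[i]) a : cmeas2 K -> cmeas (K a).
Proof.
by move=> mK; have := cmeas_comp mK (@pair1_measurable _ _ R R a).
Qed.

(** The slices may fail to be integrable: the real integral is [fine] of a difference of integrals
    of the positive and negative parts, each measurable in [a] by Tonelli. *)
Lemma meas2_int (k : R -> R -> R) : meas2 k -> measurable_fun setT (fun a => \int[mu]_b (k a b))%R.
Proof.
move=> mk; apply: (measurableT_comp (f := fine)) => //.
have mE : measurable_fun setT (fun p : R * R => (k p.1 p.2)%:E).
  exact/measurable_EFinP.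
rewrite (_ : (fun a => _) = fun a =>
    ((\int[mu]_b (fun p : R * R => (k p.1 p.2)%:E)^\+ (a, b)) -
     (\int[mu]_b (fun p : R * R => (k p.1 p.2)%:E)^\- (a, b)))%E); last first.
  apply/funext => a; rewrite [LHS]integralE; congr (_ - _)%E;
    by apply: eq_integral => b _; rewrite ?funeposE ?funenegE.
apply: emeasurable_funB.
  apply: (measurable_fun_fubini_tonelli_F (m2 := mu)
    (fun p : R * R => (k p.1 p.2)%:E)^\+%E) => //.
  exact: measurable_funepos.
apply: (measurable_fun_fubini_tonelli_F (m2 := mu)
  (fun p : R * R => (k p.1 p.2)%:E)^\-%E) => //.
exact: measurable_funeneg.
Qed.

Lemma cmeas_CI (K : R -> R -> R[i]) : cmeas2 K -> cmeas (fun a => CI (K a)).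
Proof.
by move=> [rK iK]; split; [exact: (meas2_int rK)|exact: (meas2_int iK)].
Qed.

Lemma tonelli (k : R -> R -> R) : meas2 k -> (forall a b, 0 <= k a b) ->
  (\int[mu]_a \int[mu]_b (k a b)%:E = \int[mu]_b \int[mu]_a (k a b)%:E)%E.
Proof.
move=> mk k0; apply: (fubini_tonelli (m1 := mu) (m2 := mu) (fun p => (k p.1 p.2)%:E)); first exact/measurable_EFinP.
by move=> p; rewrite lee_fin.
Qed.

Lemma measurable_int2 (k : R -> R -> R) : meas2 k -> (forall a b, 0 <= k a b) ->
  measurable_fun setT (fun a => \int[mu]_b (k a b)%:E)%E.
Proof.
move=> mk k0; apply: (measurable_fun_fubini_tonelli_F (m2 := mu)
  (fun p : R * R => (k p.1 p.2)%:E)) => //.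
  exact/measurable_EFinP.
by move=> p; rewrite lee_fin.
Qed.

(** The inner integral is finite for almost every [a] only; [fine] alters it on a null set, which
    the outer integral ignores. *)
Lemma real_fubini_int (k : R -> R -> R) : meas2 k ->
  (\int[mu]_a \int[mu]_b (`|k a b|)%:E < +oo)%E ->
  mu.-integrable setT (EFin \o (fun a => \int[mu]_b k a b)) /\
  (\int[mu]_a (\int[mu]_b k a b))%R =
    fine (\int[mu]_a \int[mu]_b (k a b)%:E)%E.
Proof.
move=> mk ki.
have ik : (mu \x mu)%E.-integrable setT (fun p : R * R => (k p.1 p.2)%:E).
  by apply/(integrable12ltyP mu mu) => //; exact/measurable_EFinP.
have iF := integrable_fubini_F ik; rewrite /fubini_F/= in iF.
have mI := meas2_int mk.
split.
  apply: le_integrable iF => //; first exact/measurable_EFinP.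
  move=> a _ /=; rewrite /Rintegral.
  by case: (\int[mu]_b (k a b)%:E)%E => [r||] /=; rewrite ?leey.
rewrite {1}/Rintegral; congr fine; apply: ae_eq_integral => //.
- exact/measurable_EFinP.
- exact: measurable_int iF.
- have := integrable_ae measurableT iF.
  by move=> /ae_imp; apply => a /(_ I) h _; rewrite fineK.
Qed.

Lemma real_fubini (k : R -> R -> R) : meas2 k ->
  (\int[mu]_a \int[mu]_b (`|k a b|)%:E < +oo)%E ->
  (\int[mu]_a (\int[mu]_b k a b))%R = (\int[mu]_b (\int[mu]_a k a b))%R.
Proof.
move=> mk ki; have [_ ->] := real_fubini_int mk ki.
have ki' : (\int[mu]_b \int[mu]_a (`|k a b|)%:E < +oo)%E.
  rewrite (@tonelli (fun b a => `|k a b|))//.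
  exact: (measurableT_comp _ (meas2_swap mk)).
have [_ ->] := real_fubini_int (meas2_swap mk) ki'.
have ik : (mu \x mu)%E.-integrable setT (fun p : R * R => (k p.1 p.2)%:E).
  by apply/(integrable12ltyP mu mu) => //; exact/measurable_EFinP.
by congr fine; exact: (Fubini ik).
Qed.

Lemma le_int2 (K : R -> R -> R[i]) (p : R[i] -> R) : meas2 (fun a b => p (K a b)) -> cmeas2 K ->
  (forall z, `|p z| <= normc z) ->
  (\int[mu]_a \int[mu]_b (normc (K a b))%:E < +oo)%E ->
  (\int[mu]_a \int[mu]_b (`|p (K a b)|)%:E < +oo)%E.
Proof.
move=> mp mK pn; apply: le_lt_trans; apply: ge0_le_integral => //.
- by move=> a _; apply: int_ge0.
- by apply: (@measurable_int2 (fun a b => `|p (K a b)|)) => //; apply: measurableT_comp.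
- apply: (@measurable_int2 (fun a b => normc (K a b))) => //.
    exact: (measurable_normc mK).
  by move=> *; exact: normc_ge0.
- move=> a _; apply: ge0_le_int => //.
    apply: measurableT_comp => //.
    by have := measurableT_comp mp (@pair1_measurable _ _ R R a).
  by apply: measurable_normc; exact: cmeas2_slice.
Qed.

Lemma cfubini (K : R -> R -> R[i]) : cmeas2 K ->
  (\int[mu]_a \int[mu]_b (normc (K a b))%:E < +oo)%E ->
  L1 (fun a => CI (K a)) /\
  CI (fun a => CI (K a)) = CI (fun b => CI (fun a => K a b)).
Proof.
move=> mK iK; have [rK jK] := mK.
have ri := le_int2 (p := @complex.Re R) rK mK (@normc_Re R) iK.
have ji := le_int2 (p := @complex.Im R) jK mK (@normc_Im R) iK.
split; last first.
  by apply: eqcP => /=; exact: real_fubini.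
have [ir _] := real_fubini_int rK ri.
have [ij _] := real_fubini_int jK ji.
apply: (L1_le (g := fun a => `|\int[mu]_b complex.Re (K a b)| +
    `|\int[mu]_b complex.Im (K a b)|)).
- exact: cmeas_CI.
- by apply: integrableD_fun; [exact: (integrable_abse ir)|exact: (integrable_abse ij)].
- by apply: ae_all => a; exact: normc_le_ReIm.
Qed.

(** Fourier transform on the whole line for integrable [x], the sign being [s]. A function on a set
    [E] enters through its extension by zero [abold E x]. *)
Definition FT (s : R) (x : R -> R[i]) (l : R) : R[i] := CI (fun u => x u * expi (s * u * l)).

Lemma L1_expi (x : R -> R[i]) (t : R -> R) : L1 x -> measurable_fun setT t ->
  L1 (fun u => x u * expi (t u)).
Proof.
move=> ix mt; apply: (@L1_bounded _ _ _ 1) => //; first exact: cmeas_expi.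
by apply: ae_all => u; rewrite normc_expi.
Qed.

Lemma L1_FT (s l : R) (x : R -> R[i]) : L1 x -> L1 (fun u => x u * expi (s * u * l)).
Proof.
move=> ix; apply: L1_expi => //.
by apply: measurable_funM => //; exact: measurable_funM.
Qed.

Lemma FT_le (s l : R) (x : R -> R[i]) : L1 x ->
  normc (FT s x l) <= 2 * fine (\int[mu]_u (normc (x u))%:E)%E.
Proof.
move=> ix; rewrite -lee_fin EFinM fineK; last first.
  exact: (integrable_fin_num measurableT (L1_normc ix)).
apply: le_trans (CI_norm (L1_FT s l ix)) _.
by under eq_integral do rewrite normcM normc_expi mulr1.
Qed.

Lemma cmeas_FT (s : R) (x : R -> R[i]) : cmeas x -> cmeas (FT s x).
Proof.
move=> mx; apply: (@cmeas_CI (fun l u => x u * expi (s * u * l))).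
apply: cmeasM; first exact: cmeas2_snd.
exact: (cmeas2_swap (cmeas2_expi s)).
Qed.

Lemma int_normc_prod (x k : R -> R[i]) : L1 x -> L1 k ->
  (\int[mu]_l \int[mu]_u (normc (k l) * normc (x u))%:E < +oo)%E.
Proof.
move=> ix ik; have fx := integrable_fin_num measurableT (L1_normc ix).
have E l : (\int[mu]_u (normc (k l) * normc (x u))%:E =
    (fine (\int[mu]_u (normc (x u))%:E) * normc (k l))%:E)%E.
  rewrite ge0_intZ ?normc_ge0//.
  - by rewrite mulrC EFinM fineK.
  - by apply: measurable_normc; case: ix.
  - by move=> u; exact: normc_ge0.
under eq_integral do rewrite E.
have i0 : 0 <= fine (\int[mu]_u (normc (x u))%:E)%E.
  by apply/fine_ge0/int_ge0 => u; exact: normc_ge0.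
rewrite ge0_intZ//; first last.
- by move=> l; exact: normc_ge0.
- by apply: measurable_normc; case: ik.
by apply: lte_mul_pinfty => //; case: ik.
Qed.

(** The multiplication formula: [x u * k l] is integrable on the plane, and the exponential is
    symmetric in [u] and [l], so Fubini's theorem applies. *)
Lemma FT_mult (s : R) (x k : R -> R[i]) : L1 x -> L1 k ->
  CI (fun l => FT s x l * k l) = CI (fun u => x u * FT s k u).
Proof.
move=> ix ik; pose K l u := x u * expi (s * u * l) * k l.
have mK : cmeas2 K.
  apply: cmeasM; last by apply: cmeas2_fst; case: ik.
  apply: cmeasM; first by apply: cmeas2_snd; case: ix.
  exact: (cmeas2_swap (cmeas2_expi s)).
have iK : (\int[mu]_a \int[mu]_b (normc (K a b))%:E < +oo)%E.
  rewrite (_ : (\int[mu]_a _)%E =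
    (\int[mu]_l \int[mu]_u (normc (k l) * normc (x u))%:E)%E).
    exact: int_normc_prod.
  apply: eq_integral => l _; apply: eq_integral => u _.
  by rewrite /K !normcM normc_expi mulr1 mulrC.
have [_ e] := cfubini mK iK; transitivity (CI (fun a => CI (K a))).
  congr CI; apply/funext => l; rewrite mulrC -CIZ; last exact: L1_FT.
  by congr CI; apply/funext => u; rewrite /K mulrC.
rewrite [LHS]e; congr CI; apply/funext => u; rewrite -CIZ; last exact: L1_FT.
congr CI; apply/funext => l; rewrite /K (_ : s * l * u = s * u * l); last by ring.
by ring.
Qed.

End FourierL1.

(** * Abel's damping factor and the Poisson kernel *)

Section PoissonKernel.
Context {R : realType}.
Local Notation mu := (@lebesgue_measure R).
Local Notation L1 := (@in_L1 R setT).
Local Notation CI := (@cint R setT).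
Implicit Types (e s v x : R).

Definition abel e x : R := expR (- (e * `|x|)).

(** The Fourier transform of [abel e]. It is 2 pi times the normalized Poisson kernel, hence the
    factors [2 * pi] in the limits below. *)
Definition poisson e x : R := 2 * e / (e ^+ 2 + x ^+ 2).

(** Folding onto the half-line removes the absolute value in [abel], so that explicit
    antiderivatives can be used. *)
Lemma ge0_int_fold (G : R -> R) : continuous G -> (forall x, 0 <= G x) ->
  (\int[mu]_x (G x)%:E = \int[mu]_(x in `[0%R, +oo[) (G x + G (- x))%:E)%E.
Proof.
move=> cG G0; have mG : measurable_fun setT G by exact: continuous_measurable_fun.
have mGN : measurable_fun setT (fun x => G (- x)).
  by apply: measurableT_comp => //; exact: oppr_measurable.
have -> : [set: R] = `]-oo, 0%R[%classic `|` `[0%R, +oo[%classic.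
  by apply/seteqP; split => // x _ /=; rewrite !in_itv /= andbT; case: ltP => ?; [left|right].
rewrite ge0_integral_setU//; first last.
- rewrite disj_set2E; apply/eqP/seteqP; split => // x [] /=.
  by rewrite !in_itv/= andbT => /lt_geF ->.
- by move=> x _; rewrite lee_fin.
- by apply/measurable_EFinP; exact: measurable_funS mG.
rewrite integral_itv_bndo_bndc; last first.
  by apply/measurable_EFinP; exact: measurable_funS mG.
have := @ge0_integration_by_substitutionNy R G 0.
rewrite oppr0 => ->; first last.
- by move=> x _.
- exact: continuous_subspaceT.
rewrite addrC -ge0_integralD//.
- by move=> x _; rewrite lee_fin; exact: G0.
- by apply/measurable_EFinP; exact: measurable_funS mG.
- by move=> x _; rewrite lee_fin; exact: G0.
- by apply/measurable_EFinP; exact: measurable_funS mGN.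
Qed.

Lemma der_cont (f df : R -> R) : (forall x, is_derive x 1 f (df x)) -> continuous f.
Proof.
move=> fd x; apply: differentiable_continuous; apply/derivable1_diffP.
by have [] := fd x.
Qed.

Lemma is_derive_expM e x : is_derive x 1 (fun x => expR (- (e * x))) (- e * expR (- (e * x))).
Proof.
have h : is_derive x (1 : R) (fun x => - (e * x)) (- e).
  rewrite (_ : (fun x => _) = (- e) *: (id : R -> R)); last first.
    by apply/funext => y; exact/esym/mulNr.
  by apply: is_derive_eq; rewrite /GRing.scale /= mulr1.
rewrite (_ : (fun x => _) = expR \o (fun x => - (e * x))) //.
by apply: is_derive_eq; rewrite mulrC.
Qed.

Lemma is_derive_scale s x : is_derive x (1 : R) (fun x => s * x) s.
Proof.
rewrite (_ : (fun x => _) = s *: (id : R -> R)) //.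
by apply: is_derive_eq; rewrite /GRing.scale /= mulr1.
Qed.

Lemma is_derive_cosM s x : is_derive x 1 (fun x => cos (s * x)) (- (s * sin (s * x))).
Proof.
have h := is_derive_scale s x.
rewrite (_ : (fun x => _) = cos \o (fun x => s * x)) //.
by apply: is_derive_eq; rewrite mulNr mulrC.
Qed.

Lemma is_derive_sinM s x : is_derive x 1 (fun x => sin (s * x)) (s * cos (s * x)).
Proof.
have h := is_derive_scale s x.
rewrite (_ : (fun x => _) = sin \o (fun x => s * x)) //.
by apply: is_derive_eq; rewrite mulrC.
Qed.

(** Antiderivative of [expR (- (e * x)) * (p + q * cos (s * x))], the one vanishing at infinity when
    [e] is positive. *)
Let primi e s (p q : R) x := expR (- (e * x)) *
   (q / (e ^+ 2 + s ^+ 2) * (s * sin (s * x) - e * cos (s * x)) - p / e).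

Lemma is_derive_primi e s (p q : R) x : 0 < e ->
  is_derive x 1 (primi e s p q) (expR (- (e * x)) * (p + q * cos (s * x))).
Proof.
move=> e0; have hE := is_derive_expM e x.
have hC := is_derive_cosM s x; have hS := is_derive_sinM s x.
have -> : primi e s p q = (fun x => expR (- (e * x))) *
   ((q / (e ^+ 2 + s ^+ 2)) *: (s *: (fun x => sin (s * x)) -
     e *: (fun x => cos (s * x))) - cst (p / e)) by apply/funext.
apply: is_derive_eq; rewrite /GRing.scale /=.
rewrite [X in _ + X * _](_ : _ = q / (e ^+ 2 + s ^+ 2) *
  (s * sin (s * x) - e * cos (s * x)) - p / e); last by [].
have d0 : e ^+ 2 + s ^+ 2 != 0 by rewrite gt_eqF// ltr_pwDl ?sqr_ge0// exprn_gt0.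
move: (expR _) (sin _) (cos _) => E S C.
by field; rewrite d0 gt_eqF.
Qed.

Lemma cvg_expM0 e : 0 < e -> expR (- (e * x)) @[x --> +oo] --> 0.
Proof.
move=> e0.
rewrite (_ : (fun x => _) = (fun z => expR (- z)) \o (fun z => e * z)) //.
apply: (@cvg_comp _ _ _ _ _ _ (pinfty_nbhs R)); last exact: cvgr_expR.
by apply: gt0_cvgMry => //; exact: cvg_id.
Qed.

Lemma cvg_primi e s (p q : R) : 0 < e -> primi e s p q x @[x --> +oo] --> 0.
Proof.
move=> e0; pose M := `|q / (e ^+ 2 + s ^+ 2)| * (`|s| + e) + `|p / e|.
have h : M * expR (- (e * x)) @[x --> +oo] --> (0 : R).
  by rewrite -[X in _ --> X](mulr0 M); apply: cvgM; [exact: cvg_cst|exact: cvg_expM0].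
apply: (@squeeze_cvgr _ _ _ _ (fun x => - (M * expR (- (e * x))))
  (fun x => M * expR (- (e * x)))) => //; last first.
  by rewrite -[X in _ --> X]oppr0; exact: cvgN.
apply: nearW => x; rewrite -ler_norml /primi normrM ger0_norm ?expR_ge0// mulrC.
rewrite ler_wpM2r ?expR_ge0//.
apply: le_trans (ler_normB _ _) _; rewrite lerD2r normrM ler_wpM2l//.
apply: le_trans (ler_normB _ _) _; rewrite !normrM (gtr0_norm e0).
have := sin_max (s * x); have := cos_max (s * x).
move: (`|sin _|) (`|cos _|) (normr_ge0 s) => a b; nra.
Qed.

Lemma int_exp_cos e s (p q : R) : 0 < e -> (forall x, 0 <= p + q * cos (s * x)) ->
  (\int[mu]_(x in `[0%R, +oo[) (expR (- (e * x)) * (p + q * cos (s * x)))%:E =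
    (p / e + q * e / (e ^+ 2 + s ^+ 2))%:E)%E.
Proof.
move=> e0 pq0.
have cont : continuous (fun x => expR (- (e * x)) * (p + q * cos (s * x))).
  move=> x; apply: cvgM; first exact: (der_cont (is_derive_expM e)).
  apply: cvgD; first exact: cvg_cst.
  apply: cvgM; first exact: cvg_cst.
  exact: (der_cont (is_derive_cosM s)).
rewrite (@ge0_continuous_FTC2y R _ (primi e s p q) 0 0).
- rewrite -EFinB /primi mulr0 oppr0 expR0 mulr0 sin0 cos0; congr (_%:E).
  have d0 : e ^+ 2 + s ^+ 2 != 0 by rewrite gt_eqF// ltr_pwDl ?sqr_ge0// exprn_gt0.
  by field; rewrite d0 gt_eqF.
- by move=> x _; rewrite mulr_ge0 ?expR_ge0.
- exact: continuous_subspaceT.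
- exact: cvg_primi.
- by move=> x _; have [] := is_derive_primi s p q x e0.
- apply: cvg_at_right_filter.
  exact: (der_cont (fun x => is_derive_primi s p q x e0)).
- by move=> x _; rewrite derive1E; have [_ ->] := is_derive_primi s p q x e0.
Qed.

Lemma abel_ge0 e x : 0 <= abel e x. Proof. exact: expR_ge0. Qed.

Lemma abelN e x : abel e (- x) = abel e x.
Proof. by rewrite /abel normrN. Qed.

Lemma abel_le1 e x : 0 < e -> abel e x <= 1.
Proof. by move=> e0; rewrite -expR0 ler_expR oppr_le0 mulr_ge0// ltW. Qed.

Lemma continuous_abel e : continuous (abel e).
Proof.
move=> x; apply: continuous_comp; last exact: continuous_expR.
apply: cvgN; apply: cvgM; first exact: cvg_cst.
exact: norm_continuous.
Qed.

Lemma measurable_abel e : measurable_fun setT (abel e).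
Proof. by apply: continuous_measurable_fun; exact: continuous_abel. Qed.

Lemma continuous_cosM s : continuous (fun x => cos (s * x)).
Proof. exact: (der_cont (is_derive_cosM s)). Qed.

Lemma continuous_sinM s : continuous (fun x => sin (s * x)).
Proof. exact: (der_cont (is_derive_sinM s)). Qed.

Lemma int_abel e : 0 < e -> (\int[mu]_x (abel e x)%:E = (2 / e)%:E)%E.
Proof.
move=> e0; rewrite ge0_int_fold; [|exact: continuous_abel|exact: abel_ge0].
rewrite -[RHS](_ : (2 / e + 0 * e / (e ^+ 2 + 0 ^+ 2))%:E = _)%E; last first.
  by rewrite !mul0r addr0.
have h x : 0 <= 2 + 0 * cos (0 * x) :> R by rewrite mul0r addr0.
rewrite -(int_exp_cos e0 h).
apply: eq_integral => x; rewrite inE /= in_itv /= andbT => x0.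
by rewrite abelN /abel ger0_norm// mul0r addr0 mulr_natr mulr2n.
Qed.

(** The summand 1 keeps the integrand nonnegative, so the integral is computed without proving
    integrability first; subtracting [int_abel] leaves the cosine transform. *)
Lemma int_abel_cos e s : 0 < e ->
  (\int[mu]_x (abel e x * (1 + cos (s * x)))%:E = (2 / e + poisson e s)%:E)%E.
Proof.
move=> e0; have c0 x : 0 <= 1 + cos (s * x).
  by have := cos_geN1 (s * x); lra.
rewrite ge0_int_fold; last 2 first.
- move=> x; apply: cvgM; first exact: continuous_abel.
  by apply: cvgD; [exact: cvg_cst|exact: continuous_cosM].
- by move=> x; rewrite mulr_ge0 ?abel_ge0.
have -> : 2 / e + poisson e s = 2 / e + 2 * e / (e ^+ 2 + s ^+ 2) by [].
have h x : 0 <= 2 + 2 * cos (s * x) by have := c0 x; lra.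
rewrite -(int_exp_cos e0 h).
apply: eq_integral => x; rewrite inE /= in_itv /= andbT => x0.
by rewrite abelN /abel ger0_norm// mulrN cosN; congr (_%:E); ring.
Qed.

Lemma int_abel_sin e s : 0 < e ->
  (\int[mu]_x (abel e x * (1 + sin (s * x)))%:E = (2 / e)%:E)%E.
Proof.
move=> e0; have c0 x : 0 <= 1 + sin (s * x).
  by have := sin_geN1 (s * x); lra.
rewrite ge0_int_fold; last 2 first.
- move=> x; apply: cvgM; first exact: continuous_abel.
  by apply: cvgD; [exact: cvg_cst|exact: continuous_sinM].
- by move=> x; rewrite mulr_ge0 ?abel_ge0.
rewrite -int_abel// ge0_int_fold; [|exact: continuous_abel|exact: abel_ge0].
apply: eq_integral => x; rewrite inE /= in_itv /= andbT => x0.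
by rewrite abelN mulrN sinN; congr (_%:E); ring.
Qed.

Lemma integrable_abel e : 0 < e -> mu.-integrable setT (EFin \o abel e).
Proof.
move=> e0; apply: integrable_ge0; first exact: measurable_abel.
  exact: abel_ge0.
by rewrite int_abel// ltry.
Qed.

Lemma L1_abel e : 0 < e -> L1 (fun x => (abel e x)%:C).
Proof. by move=> e0; apply: L1_real; exact: integrable_abel. Qed.

Lemma CI_abel_expi e s : 0 < e ->
  CI (fun x => (abel e x)%:C * expi (s * x)) = (poisson e s)%:C.
Proof.
move=> e0; have ia := integrable_abel e0.
have ie : L1 (fun x => (abel e x)%:C * expi (s * x)).
  by apply: L1_expi; [exact: L1_abel|exact: measurable_funM].
have ic : mu.-integrable setT (EFin \o (fun x => abel e x * cos (s * x))).
  have := L1_Re ie; congr (mu.-integrable _ (EFin \o _)).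
  by apply/funext => x; rewrite cReM /= mul0r subr0.
have is_ : mu.-integrable setT (EFin \o (fun x => abel e x * sin (s * x))).
  have := L1_Im ie; congr (mu.-integrable _ (EFin \o _)).
  by apply/funext => x; rewrite cImM /= mul0r addr0.
apply: eqcP => /=.
  have /(congr1 fine) := int_abel_cos s e0; rewrite -/(Rintegral _ _ _) => h.
  have : (\int[mu]_x abel e x = 2 / e)%R by rewrite /Rintegral int_abel.
  move: h; under eq_Rintegral do rewrite mulrDr mulr1.
  rewrite RintegralD//= => h1 h2; rewrite h2 in h1; move/addrI: h1 => <-.
  by apply: eq_Rintegral => x _; rewrite mul0r subr0.
have /(congr1 fine) := int_abel_sin s e0; rewrite -/(Rintegral _ _ _) => h.
have : (\int[mu]_x abel e x = 2 / e)%R by rewrite /Rintegral int_abel.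
move: h; under eq_Rintegral do rewrite mulrDr mulr1.
rewrite RintegralD//= => h1 h2; rewrite h2 in h1.
transitivity (\int[mu]_x (abel e x * sin (s * x)))%R; last lra.
by apply: eq_Rintegral => x _; rewrite mul0r addr0.
Qed.

Lemma poisson_ge0 e x : 0 < e -> 0 <= poisson e x.
Proof.
by move=> e0; rewrite divr_ge0 ?addr_ge0 ?sqr_ge0// mulr_ge0// ltW.
Qed.

Lemma continuous_poisson e : 0 < e -> continuous (poisson e).
Proof.
move=> e0 x; apply: cvgM; first exact: cvg_cst.
apply: cvgV.
  by rewrite gt_eqF// ltr_pwDl ?sqr_ge0// exprn_gt0.
by apply: cvgD; [exact: cvg_cst|exact: exprn_continuous].
Qed.

Lemma poissonB e x y : poisson e (x - y) = poisson e (y - x).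
Proof. by rewrite /poisson -(opprB y x) sqrrN. Qed.

Lemma int_poisson1 : (\int[mu]_x (poisson 1 x)%:E = (2 * pi)%:E)%E.
Proof.
rewrite ge0_symfun_integralT.
- rewrite -set_itvcy.
  under eq_integral do rewrite /poisson expr1n mulr1 EFinM -/(oneDsqr _).
  rewrite ge0_integralZl_EFin//.
  + by rewrite integral0y_oneDsqr -!EFinM; congr (_%:E); field.
  + apply/measurable_EFinP; apply: measurable_funTS.
    by apply: continuous_measurable_fun; exact: continuous_oneDsqrV.
- by move=> x; exact: poisson_ge0.
- exact: continuous_poisson.
- by move=> x /=; rewrite /poisson sqrrN.
Qed.

Lemma int_poisson e v : 0 < e ->
  (\int[mu]_x (poisson e (x - v))%:E = (2 * pi)%:E)%E.
Proof.
move=> e0; pose F x : R := (x - v) / e.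
have dF x : is_derive x (1 : R) F e^-1.
  rewrite (_ : F = e^-1 *: (id - cst v)); last first.
    by apply/funext => y; rewrite /F mulrC.
  by apply: is_derive_eq; rewrite /GRing.scale /= subr0 mulr1.
have F'E : (F^`() = cst e^-1)%classic.
  by apply/funext => x; rewrite derive1E; have [_ ->] := dF x.
rewrite -int_poisson1 [RHS](@increasing_ge0_integration_by_substitutionT R F).
- apply: eq_integral => x _; rewrite F'E; congr (_%:E).
  rewrite -[RHS]/(poisson 1 (F x) * e^-1) /poisson /F.
  have d0 : e ^+ 2 + (x - v) ^+ 2 != 0 by rewrite gt_eqF// ltr_pwDl ?sqr_ge0// exprn_gt0.
  by field; rewrite d0 gt_eqF.
- by move=> x y xy; rewrite /F ltr_pM2r ?invr_gt0// ltrD2r.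
- by rewrite F'E => x; exact: cvg_cst.
- by rewrite F'E; apply/cvg_ex; exists e^-1; exact: cvg_cst.
- by rewrite F'E; apply/cvg_ex; exists e^-1; exact: cvg_cst.
- by move=> x; have [] := dF x.
- apply: gt0_cvgMlNy; first by rewrite invr_gt0.
  apply/cvgrNyPle => A; exists (A + v); split; first exact: num_real.
  by move=> x /= xA; lra.
- apply: gt0_cvgMly; first by rewrite invr_gt0.
  exact: cvg_addrr.
- exact: continuous_poisson.
- by move=> x; exact: poisson_ge0.
Qed.

(** Away from the origin the kernel is of order [e], with the integrable majorant [poisson 1]. This
    expresses the concentration of the kernel at 0. *)
Lemma poisson_tail e d x : 0 < e -> 0 < d -> d <= `|x| ->
  poisson e x <= e * (1 + (d ^+ 2)^-1) * poisson 1 x.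
Proof.
move=> e0 d0 dx; rewrite /poisson expr1n mulr1.
have x2 : d ^+ 2 <= x ^+ 2 by rewrite -(real_normK (num_real x)) lerXn2r ?nnegrE// ltW.
have d2 : 0 < d ^+ 2 by rewrite exprn_gt0.
have xx : 0 < x ^+ 2 by exact: lt_le_trans x2.
have i0 : (x ^+ 2)^-1 <= (d ^+ 2)^-1 by rewrite lef_pV2.
apply: (@le_trans _ _ (2 * e / x ^+ 2)).
  have exx : x ^+ 2 <= e ^+ 2 + x ^+ 2 by rewrite lerDr sqr_ge0.
  by rewrite ler_pM2l ?mulr_gt0// lef_pV2 ?posrE//; exact: lt_le_trans exx.
rewrite (_ : 2 * e / x ^+ 2 = e * ((1 + (x ^+ 2)^-1) * (2 / (1 + x ^+ 2)))); last first.
  field; apply/andP; split; first by rewrite gt_eqF// ltr_pDl.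
  by rewrite -sqrf_eq0 gt_eqF.
rewrite -mulrA ler_pM2l// ler_wpM2r ?lerD2l//.
by rewrite divr_ge0// addr_ge0 ?ltW.
Qed.

Lemma integrable_poisson e v : 0 < e ->
  mu.-integrable setT (EFin \o (fun x => poisson e (x - v))).
Proof.
move=> e0; apply: integrable_ge0.
- apply: (measurableT_comp (f := poisson e)).
    by apply: continuous_measurable_fun; exact: continuous_poisson.
  exact: measurable_funB.
- by move=> x; exact: poisson_ge0.
- by rewrite int_poisson// ltry.
Qed.

Lemma measurable_poisson e : 0 < e -> measurable_fun setT (poisson e).
Proof. by move=> e0; apply: continuous_measurable_fun; exact: continuous_poisson. Qed.

Lemma poisson_le e x : 0 < e -> poisson e x <= 2 / e.
Proof.
move=> e0; rewrite /poisson ler_pdivlMr// mulrAC ler_pdivrMr; last first.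
  by rewrite ltr_pwDl ?sqr_ge0// exprn_gt0.
rewrite -mulrA ler_pM2l// -expr2 lerDl; exact: sqr_ge0.
Qed.

Lemma meas2_poisson e : 0 < e -> meas2 (fun a b => poisson e (a - b)).
Proof.
move=> e0; apply: (measurableT_comp (f := poisson e)).
  exact: measurable_poisson.
by apply: measurable_funB; [exact: measurable_fst|exact: measurable_snd].
Qed.

End PoissonKernel.

(** * Completeness of weighted L_2 spaces *)

Section Completeness.
Context {R : realType}.
Local Notation mu := (@lebesgue_measure R).

Lemma fatou_le (f_ : nat -> R -> R) (f : R -> R) (C : \bar R) :
  (forall n, measurable_fun setT (f_ n)) -> measurable_fun setT f ->
  (forall n x, 0 <= f_ n x) -> (forall x, 0 <= f x) ->
  {ae mu, forall x, f_ n x @[n --> \oo] --> f x} ->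
  (forall n, (\int[mu]_x (f_ n x)%:E <= C)%E) ->
  (\int[mu]_x (f x)%:E <= C)%E.
Proof.
move=> mf_ mf f_0 f0 cf bf.
have mE n : measurable_fun setT (fun x => (f_ n x)%:E) by exact/measurable_EFinP.
have -> : (\int[mu]_x (f x)%:E = \int[mu]_x limn_einf (fun n => (f_ n x)%:E))%E.
  apply: ae_eq_integral => //; first exact/measurable_EFinP.
    under eq_fun => x do rewrite -[limn_einf _]oppeK -limn_esupN.
    apply: measurableT_comp => //; apply: measurable_fun_limn_esup => n.
    have mN : measurable_fun setT (fun x => (- f_ n x)%:E).
      by apply/measurable_EFinP; exact: measurable_funN (mf_ n).
    exact: mN.
  apply: (ae_imp cf) => x fx _.
  have : (f_ n x)%:E @[n --> \oo] --> (f x)%:E.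
    by apply: cvg_EFin => //; exact: nearW.
  by move=> /cvg_limn_einf_sup[->].
apply: le_trans (@fatou _ _ _ mu setT measurableT _ mE _) _.
  by move=> n x _; rewrite lee_fin.
rewrite limn_einf_lim; apply: lime_le; first exact: is_cvg_einfs.
apply: nearW => n; apply: le_trans (bf n).
by apply: ereal_inf_lbound; exists n => //=.
Qed.

Lemma fast_cvg (u : nat -> R) (B : R) :
  (forall k, `|u k.+1 - u k| <= B / 2 ^+ k) -> cvgn u.
Proof.
move=> uB.
have -> : u = cst (u 0%N) \+ series (telescope u).
  by apply/funext => n /=; rewrite [LHS]eq_sum_telescope.
apply: is_cvgD; first exact: is_cvg_cst.
apply: normed_cvg; apply: (@series_le_cvg _ _ (fun k => B / 2 ^+ k)).
- by move=> k; exact: normr_ge0.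
- by move=> k; apply: le_trans (uB k); exact: normr_ge0.
- by move=> k; rewrite /telescope /=; exact: uB.
- rewrite (_ : (fun k => _) = geometric B (2^-1)).
    by apply: is_cvg_geometric_series; rewrite ger0_norm// invf_lt1// ltr1n.
  by apply/funext => k; rewrite /geometric /= exprVn.
Qed.

(** The sum of the series has integral at most 1, so it is finite almost everywhere and bounds each
    of its terms. *)
Lemma ae_summable (f_ : nat -> R -> R) :
  (forall k, measurable_fun setT (f_ k)) -> (forall k x, 0 <= f_ k x) ->
  (forall k, (\int[mu]_x (f_ k x)%:E <= (1 / (2 ^ k.+1)%:R)%:E)%E) ->
  {ae mu, forall x, exists M : R, forall k, f_ k x <= M}.
Proof.
move=> mf f0 fk.
have mE n : measurable_fun setT (fun x => (f_ n x)%:E) by exact/measurable_EFinP.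
pose S x := (\sum_(k <oo) (f_ k x)%:E)%E.
have S0 x : (0 <= S x)%E by apply: nneseries_ge0 => k _ _; rewrite lee_fin.
have iS : mu.-integrable setT S.
  apply/integrableP; split.
    apply: (ge0_emeasurable_sum (P := xpredT)) => [k x _ _|k _]; last exact: mE.
    by rewrite lee_fin.
  under eq_integral do rewrite gee0_abs//.
  rewrite integral_nneseries//; last by move=> k x _; rewrite lee_fin.
  apply: (@le_lt_trans _ _ (\sum_(k <oo) (1 / (2 ^ (k + 1))%:R)%:E)%E).
    apply: lee_nneseries => [k _ _|k _]; first exact: int_ge0.
    by rewrite addn1.
  have /cvg_lim := @cvg_geometric_eseries_half R 1 0.
  by rewrite /eseries /= => ->//; rewrite ltry.
have := integrable_ae measurableT iS.
move=> /ae_imp; apply => x /(_ I) Sx.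
exists (fine (S x)) => k; rewrite -lee_fin fineK//.
have : (\sum_(0 <= i < k.+1) (f_ i x)%:E <= S x)%E.
  by apply: nneseries_lim_ge => i _ _; rewrite lee_fin.
apply: le_trans; rewrite big_nat_recr//= leeDr//.
by apply: sume_ge0 => i _; rewrite lee_fin.
Qed.

Lemma subseq_fast (c : nat -> R) (al : nat -> R) :
  c @ \oo --> (0 : R) -> (forall k, 0 < al k) ->
  exists phi : nat -> nat, [/\ forall k, (k <= phi k)%N,
    forall k, (phi k <= phi k.+1)%N & forall k, c (phi k) <= al k].
Proof.
move=> c0 al0.
have /choice[N HN] k : exists N, forall n, (N <= n)%N -> c n <= al k.
  move/cvgrPdist_le : c0 => /(_ _ (al0 k))[N _ HN]; exists N => n Nn.
  by have := HN n Nn; rewrite /= sub0r normrN => /(le_trans (ler_norm _)).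
(* Summing the thresholds makes [phi] monotone and at least [N k]; the successors give
   [k <= phi k]. *)
pose phi k := (\sum_(i < k.+1) (N i).+1)%N.
have phiS k : phi k.+1 = (phi k + (N k.+1).+1)%N by rewrite /phi big_ord_recr.
exists phi; split.
- elim=> [//|k IH]; rewrite phiS addnS ltnS; exact: leq_trans IH (leq_addr _ _).
- by move=> k; rewrite phiS leq_addr.
- move=> k; apply: HN; rewrite /phi big_ord_recr /=.
  exact: leq_trans (leqnSn _) (leq_addl _ _).
Qed.

Lemma ReB_le (z y : R[i]) : `|complex.Re z - complex.Re y| <= normc (z - y).
Proof. by have := normc_Re (z - y); rewrite cReD cReN. Qed.

Lemma ImB_le (z y : R[i]) : `|complex.Im z - complex.Im y| <= normc (z - y).
Proof. by have := normc_Im (z - y); rewrite cImD cImN. Qed.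

Lemma normc_cvg (z_ : nat -> R[i]) (z y : R[i]) :
  complex.Re (z_ n) @[n --> \oo] --> complex.Re z ->
  complex.Im (z_ n) @[n --> \oo] --> complex.Im z ->
  normc (y - z_ n) ^+ 2 @[n --> \oo] --> normc (y - z) ^+ 2.
Proof.
move=> cr ci; under eq_fun do rewrite normc2E !ReImE.
rewrite normc2E !ReImE.
apply: cvgD.
  apply: (@cvgM _ _ _ _ (fun n => complex.Re y - complex.Re (z_ n))
     (fun n => complex.Re y - complex.Re (z_ n)));
  by apply: cvgB => //; exact: cvg_cst.
apply: (@cvgM _ _ _ _ (fun n => complex.Im y - complex.Im (z_ n))
     (fun n => complex.Im y - complex.Im (z_ n)));
by apply: cvgB => //; exact: cvg_cst.
Qed.

(** The Riesz-Fischer argument. Along a fast subsequence the increments decay geometrically at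
    almost every point where [w] is positive; where [w] vanishes nothing contributes to the norm.
    Fatou's lemma carries the Cauchy bound over to the limit. *)
Lemma L2w_complete (w : R -> R) (h_ : nat -> R -> R[i]) (c : nat -> R) :
  measurable_fun setT w -> (forall x, 0 <= w x) -> (forall n, cmeas (h_ n)) ->
  (forall n m, (n <= m)%N ->
    (\int[mu]_x (normc (h_ n x - h_ m x) ^+ 2 * w x)%:E <= (c n)%:E)%E) ->
  c @ \oo --> (0 : R) ->
  exists2 h, cmeas h & forall n,
    (\int[mu]_x (normc (h_ n x - h x) ^+ 2 * w x)%:E <= (c n)%:E)%E.
Proof.
move=> mw w0 mh hc c0.
(* With this rate, [4 ^+ k] times the k-th weighted squared increment has integral at most 1 /
   2^(k+1), as [ae_summable] asks. *)
pose al k : R := (4 ^+ k * (2 ^ k.+1)%:R)^-1.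
have al0 k : 0 < al k by rewrite invr_gt0 mulr_gt0 ?exprn_gt0// ltr0n expn_gt0.
have [phi [phi1 phi2 phi3]] := subseq_fast c0 al0.
pose g k := h_ (phi k).
have mB n m : measurable_fun setT (fun x => normc (h_ n x - h_ m x) ^+ 2 * w x).
  by apply: measurable_funM => //; exact: measurable_normc2 (cmeasB (mh n) (mh m)).
have aeM : {ae mu, forall x, exists M : R, forall k,
    4 ^+ k * (normc (g k x - g k.+1 x) ^+ 2 * w x) <= M}.
  apply: (@ae_summable (fun k x =>
    4 ^+ k * (normc (g k x - g k.+1 x) ^+ 2 * w x))).
  - by move=> k; exact: (measurable_funM (measurable_cst _) (mB _ _)).
  - by move=> k x; rewrite mulr_ge0 ?exprn_ge0// mulr_ge0 ?sqr_ge0.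
  - move=> k; rewrite ge0_intZ ?exprn_ge0//; last first.
      by move=> x; rewrite mulr_ge0 ?sqr_ge0.
      exact: mB.
    apply: (@le_trans _ _ ((4 ^+ k)%:E * (al k)%:E)%E).
      rewrite lee_pmul2l ?lte_fin ?exprn_gt0//.
      by apply: le_trans (hc _ _ (phi2 k)) _; rewrite lee_fin.
    by rewrite -EFinM lee_fin /al invfM mulrA mulfV ?expf_neq0// mul1r div1r.
(* Upper limits give a measurable candidate defined at every point, including those without
   convergence. *)
pose h x := fine (limn_esup (fun k => (complex.Re (g k x))%:E)) +i*
            fine (limn_esup (fun k => (complex.Im (g k x))%:E)).
have mh' : cmeas h.
  split; apply: (measurableT_comp (f := fine)) => //;
    apply: measurable_fun_limn_esup => k; apply/measurable_EFinP;
    by have [] := mh (phi k).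
have cvh : {ae mu, forall x, w x = 0 \/
    (complex.Re (g k x) @[k --> \oo] --> complex.Re (h x) /\
     complex.Im (g k x) @[k --> \oo] --> complex.Im (h x))}.
  apply: (ae_imp aeM) => x [M HM].
  have [->|wx] := eqVneq (w x) 0; [by left|right].
  have {wx}wx : 0 < w x by rewrite lt_neqAle eq_sym wx w0.
  (* From [4 ^+ k * (|increment| ^+ 2 * w x) <= M] the k-th increment is at most [B / 2 ^+ k]. *)
  pose B := Num.sqrt (M / w x).
  have M0 : 0 <= M.
    by apply: le_trans (HM 0%N); rewrite mulr_ge0 ?exprn_ge0// mulr_ge0 ?sqr_ge0.
  have DB k : normc (g k.+1 x - g k x) <= B / 2 ^+ k.
    rewrite normcB -(@ler_pXn2r _ 2) ?nnegrE ?normc_ge0//; last first.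
      by rewrite divr_ge0 ?sqrtr_ge0// exprn_ge0.
    rewrite expr_div_n sqr_sqrtr ?divr_ge0 ?(ltW wx)//.
    rewrite -exprM mulnC exprM ler_pdivlMr ?exprn_gt0// ?ler_pdivlMr//.
      have := HM k; rewrite (_ : (2 : R) ^+ 2 = 4) ?expr2//; last by ring.
      by rewrite mulrA [4 ^+ k * _]mulrC.
  have cvf (p : R[i] -> R) : (forall z y, `|p z - p y| <= normc (z - y)) ->
      p (g k x) @[k --> \oo] --> fine (limn_esup (fun k => (p (g k x))%:E)).
    move=> pB; have : cvgn (fun k => p (g k x)).
      by apply: (@fast_cvg _ B) => k; exact: le_trans (pB _ _) (DB k).
    move=> /cvg_ex[l cl]; suff -> : limn_esup (fun k => (p (g k x))%:E) = l%:E by [].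
    have : (p (g n x))%:E @[n --> \oo] --> l%:E.
      by apply: cvg_EFin => //; exact: nearW.
    by move=> /cvg_limn_einf_sup[_ ->].
  by split; [exact: (cvf (@complex.Re R) ReB_le)|exact: (cvf (@complex.Im R) ImB_le)].
exists h => // n.
(* The shift by [n] gives [n <= phi (k + n)] for all [k], so the Cauchy bound [c n] holds for every
   term. *)
apply: (@fatou_le (fun k x => normc (h_ n x - g (k + n)%N x) ^+ 2 * w x)).
- by move=> k; exact: mB.
- by apply: measurable_funM => //; exact: measurable_normc2 (cmeasB (mh n) mh').
- by move=> k x; rewrite mulr_ge0 ?sqr_ge0.
- by move=> x; rewrite mulr_ge0 ?sqr_ge0.
- apply: (ae_imp cvh) => x [->|[cr ci]].
    by under eq_fun do rewrite mulr0; rewrite mulr0; exact: cvg_cst.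
  apply: cvgM; last exact: cvg_cst.
  have := @normc_cvg (g ^~ x) (h x) (h_ n x) cr ci.
  by rewrite -(cvg_shiftn n).
- move=> k; apply: hc; exact: leq_trans (leq_addl _ _) (phi1 _).
Qed.

End Completeness.

(** * Fourier transforms of square-integrable functions *)

Section Plancherel.
Context {R : realType}.
Local Notation mu := (@lebesgue_measure R).
Local Notation L1 := (@in_L1 R setT).
Local Notation L2 := (@in_L2 R setT).
Local Notation CI := (@cint R setT).
Implicit Types (x k : R -> R[i]) (s e : R) (E : set R).

Lemma cmeas_abold E x : measurable E -> cmeasurable E x -> cmeas (abold E x).
Proof.
move=> mE [rx ix]; split.
  rewrite (_ : _ \o _ = (@complex.Re R \o x) \_ E).
    by apply/(measurable_restrictT _ mE).
  by apply/funext => u; rewrite /abold /patch /=; case: ifP.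
rewrite (_ : _ \o _ = (@complex.Im R \o x) \_ E).
  by apply/(measurable_restrictT _ mE).
by apply/funext => u; rewrite /abold /patch /=; case: ifP.
Qed.

Lemma cmeas_aboldP E x : measurable E -> cmeasurable E x <-> cmeas (abold E x).
Proof.
move=> mE; split; first exact: cmeas_abold.
move=> [rx ix]; split.
  apply/(measurable_restrictT _ mE); move: rx; congr (measurable_fun _ _).
  by apply/funext => u; rewrite /abold /patch /=; case: ifP.
apply/(measurable_restrictT _ mE); move: ix; congr (measurable_fun _ _).
by apply/funext => u; rewrite /abold /patch /=; case: ifP.
Qed.

Lemma int_abold E x (p : R[i] -> R) : p 0 = 0 ->
  (\int[mu]_(t in E) (p (x t))%:E = \int[mu]_t (p (abold E x t))%:E)%E.
Proof.
move=> p0; rewrite integral_mkcond; apply: eq_integral => t _.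
by rewrite /abold /patch; case: ifP => // _; rewrite p0.
Qed.

Lemma cint_abold E x : cint E x = CI (abold E x).
Proof. by apply: eqcP; rewrite /= /Rintegral;
  [rewrite (int_abold _ _ (p := @complex.Re R) erefl)|
   rewrite (int_abold _ _ (p := @complex.Im R) erefl)].
Qed.

Lemma in_L1_abold E x : measurable E -> in_L1 E x <-> L1 (abold E x).
Proof.
move=> mE; rewrite /in_L1 int_abold ?normc0//.
by split=> -[/(cmeas_aboldP _ mE)].
Qed.

Lemma in_L2_abold E x : measurable E -> in_L2 E x <-> L2 (abold E x).
Proof.
move=> mE; rewrite /in_L2.
rewrite (@int_abold _ _ (fun z => normc z ^+ 2)) ?normc0 ?expr0n//.
by split=> -[/(cmeas_aboldP _ mE)].
Qed.

Lemma abold_mul E x (y : R -> R[i]) :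
  abold E (fun u => x u * y u) = fun u => abold E x u * y u.
Proof. by apply/funext => u; rewrite /abold; case: ifP; rewrite ?mul0r. Qed.

Lemma abold_abold E E' x : abold E (abold E' x) = abold (E `&` E') x.
Proof. by apply/funext => u; rewrite /abold in_setI; case: (u \in E). Qed.

Lemma aboldT x : abold setT x = x.
Proof. by apply/funext => u; rewrite /abold in_setT. Qed.

Definition trunc (n : nat) x := abold `[- n%:R, n%:R]%classic x.

Lemma fourier_L1 E s x : measurable E -> in_L1 E x ->
  fourier s E x = FT s (abold E x).
Proof.
move=> mE ix; rewrite /fourier asboolT//; apply/funext => l.
by rewrite cint_abold abold_mul.
Qed.

Lemma cint_trunc E s x n l :
  cint (E `&` `[- n%:R, n%:R]) (fun u => x u * expi (s * u * l)) =
  FT s (trunc n (abold E x)) l.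
Proof. by rewrite cint_abold abold_mul /FT /trunc abold_abold setIC. Qed.

Lemma fourier_L2E E s x F : fourier_L2 s E x F <-> L2 F /\
  (fun n => \int[mu]_l (normc (F l - FT s (trunc n (abold E x)) l) ^+ 2)%:E)%E
    @ \oo --> 0%E.
Proof.
split=> -[iF cv]; (split; first exact: iF); move=> U hU;
  have [k kT kU] := cv U hU; (exists k; first exact: kT); move=> n kn;
  refine (@eq_ind _ _ U (kU n kn) _ _); apply: eq_integral => l _;
  by rewrite cint_trunc.
Qed.

Lemma normc_abold_le E x u : normc (abold E x u) <= normc (x u).
Proof. by rewrite /abold; case: ifP => // _; rewrite normc0 normc_ge0. Qed.

Lemma L2_abold E x : measurable E -> L2 x -> L2 (abold E x).
Proof.
move=> mE ix; apply: L2_le (L2_normc2 ix) _.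
  by apply: cmeas_abold => //; case: ix => -[r i] _; split;
    exact: measurable_funTS.
by apply: ae_all => u; rewrite ler_pXn2r ?nnegrE ?normc_ge0// normc_abold_le.
Qed.

Lemma L1_abold E x : measurable E -> L1 x -> L1 (abold E x).
Proof.
move=> mE ix; apply: L1_le (L1_normc ix) _.
  by apply: cmeas_abold => //; case: ix => -[r i] _; split;
    exact: measurable_funTS.
by apply: ae_all => u; rewrite normc_abold_le.
Qed.

Lemma L1_trunc n x : L2 x -> L1 (trunc n x).
Proof.
move=> ix; have it := L2_abold (measurable_itv `[- n%:R, n%:R]) ix.
(* On the interval, [|x| <= |x| ^+ 2 + 1]; outside it the truncation is 0. *)
apply: (@L1_le _ _ (fun u => normc (x u) ^+ 2 + \1_`[- n%:R, n%:R] u)).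
- by case: it.
- apply: integrableD_fun; first exact: L2_normc2.
  apply: integrable_ge0 => //.
  rewrite integral_indic// setIT -[X in (X < _)%E]/(lebesgue_measure `[- n%:R, n%:R]%classic).
  by rewrite lebesgue_measure_itv /=; case: ifP => _; rewrite -?EFinB ltry.
- apply: ae_all => u; rewrite /trunc /abold indicE; case: ifP => _.
    rewrite -[true%:R]/(1 : R).
    by have := sqr_ge0 (normc (x u) - 1); have := normc_ge0 (x u); nra.
  by rewrite normc0 addr0 sqr_ge0.
Qed.

Lemma L1J x : L1 x -> L1 (fun u => (x u)^*).
Proof.
move=> ix; apply: L1_le (L1_normc ix) _; first by apply: cmeasJ; case: ix.
by apply: ae_all => u; rewrite normc_conj.
Qed.

Lemma CIJ x : L1 x -> (CI x)^* = CI (fun u => (x u)^*).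
Proof.
move=> ix; apply: eqcP => /=; first by apply: eq_Rintegral => u _; rewrite cReJ.
under [in RHS]eq_Rintegral do rewrite cImJ -mulN1r.
by rewrite RintegralZl ?mulN1r//; exact: L1_Im.
Qed.

Lemma FTJ s x l : L1 x -> (FT s x l)^* = FT (- s) (fun u => (x u)^*) l.
Proof.
move=> ix; rewrite /FT CIJ; last exact: L1_FT.
by congr CI; apply/funext => u; rewrite rmorphM !mulNr expiN.
Qed.

Lemma poisson_sign e s v : s ^+ 2 = 1 -> poisson e (s * v) = poisson e v.
Proof. by move=> s1; rewrite /poisson exprMn s1 mul1r. Qed.

(** Abel summation of the inversion integral yields the Poisson mean: move the transform onto the
    damped exponential by [FT_mult], where [CI_abel_expi] evaluates it. The condition on [s] says
    that it is a sign. *)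
Lemma FT_abel e s x u : 0 < e -> s ^+ 2 = 1 -> L1 x ->
  FT s (fun l => FT (- s) x l * (abel e l)%:C) u =
  CI (fun v => x v * (poisson e (u - v))%:C).
Proof.
move=> e0 s1 ix; rewrite {1}/FT.
have ia : L1 (fun l => (abel e l)%:C * expi (s * u * l)).
  by apply: L1_expi; [exact: L1_abel|exact: measurable_funM].
transitivity (CI (fun l => FT (- s) x l * ((abel e l)%:C * expi (s * u * l)))).
  congr CI; apply/funext => l; rewrite mulrA; congr (_ * expi _); ring.
rewrite FT_mult//; congr CI; apply/funext => v; congr (_ * _).
transitivity (CI (fun l => (abel e l)%:C * expi (s * (u - v) * l))).
  congr CI; apply/funext => l; rewrite -mulrA -expiD; congr (_ * expi _); ring.
by rewrite CI_abel_expi// poisson_sign.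
Qed.

Lemma int_poisson_mul e (f : R -> R) : 0 < e -> measurable_fun setT f ->
  (forall u, 0 <= f u) ->
  (\int[mu]_u \int[mu]_v (f v * poisson e (u - v))%:E =
   (2 * pi)%:E * \int[mu]_v (f v)%:E)%E.
Proof.
move=> e0 mf f0; rewrite (@tonelli R (fun u v => f v * poisson e (u - v))).
- rewrite -ge0_intZ ?mulr_ge0 ?pi_ge0//.
  apply: eq_integral => v _; rewrite ge0_intZ//; last by move=> u; exact: poisson_ge0.
    by rewrite int_poisson// -EFinM mulrC.
  by apply/measurable_EFinP; exact: measurable_int (integrable_poisson v e0).
- apply: measurable_funM; first exact: (meas2_snd mf).
  exact: meas2_poisson.
- by move=> u v; rewrite mulr_ge0// poisson_ge0.
Qed.

Lemma meas2M (f g : R -> R -> R) : meas2 f -> meas2 g ->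
  meas2 (fun a b => f a b * g a b).
Proof. by move=> mf mg; exact: (measurable_funM mf mg). Qed.

Lemma poisson_form_ge0 e x u v : 0 < e ->
  0 <= normc (x u) * (normc (x v) * poisson e (u - v)).
Proof.
move=> e0; apply: mulr_ge0; first exact: normc_ge0.
by apply: mulr_ge0; [exact: normc_ge0|exact: poisson_ge0].
Qed.

(** Schur's test: [|x u| * |x v|] is at most half the sum of the squares, and the symmetric kernel
    has integral 2 pi in either variable. *)
Lemma poisson_form_le e x : 0 < e -> L2 x ->
  (\int[mu]_u \int[mu]_v (normc (x u) * (normc (x v) * poisson e (u - v)))%:E
    <= (2 * pi)%:E * \int[mu]_u (normc (x u) ^+ 2)%:E)%E.
Proof.
move=> e0 ix; have mx : cmeas x by case: ix.
have mn := measurable_normc mx; have mn2 := measurable_normc2 mx.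
have mp := meas2_poisson e0.
have p0 a b : 0 <= poisson e (a - b) by exact: poisson_ge0.
pose f1 u v := 2^-1 * (normc (x v) ^+ 2 * poisson e (u - v)).
pose f2 u v := 2^-1 * (normc (x u) ^+ 2 * poisson e (v - u)).
have f10 u v : 0 <= f1 u v by rewrite mulr_ge0// mulr_ge0// sqr_ge0.
have f20 u v : 0 <= f2 u v by rewrite mulr_ge0// mulr_ge0// sqr_ge0.
have mf1 : meas2 f1.
  apply: measurable_funM; first exact: measurable_cst.
  exact: (meas2M (meas2_snd mn2) mp).
have mf2 : meas2 f2.
  by have := meas2_swap mf1.
have I1 : (\int[mu]_u \int[mu]_v (f1 u v)%:E =
    (2^-1)%:E * ((2 * pi)%:E * \int[mu]_u (normc (x u) ^+ 2)%:E))%E.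
  rewrite -(int_poisson_mul e0 mn2); last by move=> u; exact: sqr_ge0.
  under eq_integral do under eq_integral do rewrite /f1 EFinM.
  have mm : meas2 (fun u v => normc (x v) ^+ 2 * poisson e (u - v)).
    exact: (meas2M (meas2_snd mn2) mp).
  rewrite -ge0_integralZl_EFin//; last 2 first.
  - by move=> u _; apply: int_ge0 => v; rewrite mulr_ge0// sqr_ge0.
  - by apply: measurable_int2 => // a b; rewrite mulr_ge0// sqr_ge0.
  apply: eq_integral => u _; rewrite ge0_integralZl_EFin//.
  - by move=> v _; rewrite lee_fin mulr_ge0// sqr_ge0.
  - by apply/measurable_EFinP; have := measurableT_comp mm (@pair1_measurable _ _ R R u).
have I2 : (\int[mu]_u \int[mu]_v (f2 u v)%:E = \int[mu]_u \int[mu]_v (f1 u v)%:E)%E.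
  by rewrite (@tonelli R f2).
apply: (@le_trans _ _ (\int[mu]_u (\int[mu]_v (f1 u v)%:E + \int[mu]_v (f2 u v)%:E))%E).
  apply: (ge0_le_integral _ measurableT).
  - by move=> u _; apply: int_ge0 => v; exact: poisson_form_ge0.
  - apply: (@measurable_int2 R (fun u v => normc (x u) * (normc (x v) * poisson e (u - v)))).
      apply: measurable_funM; first exact: (meas2_fst mn).
      exact: (meas2M (meas2_snd mn) mp).
    by move=> u v; exact: poisson_form_ge0.
  - by apply: emeasurable_funD; exact: measurable_int2.
  - move=> u _.
    have s1 : measurable_fun setT (f1 u).
      by have := measurableT_comp mf1 (@pair1_measurable _ _ R R u).
    have s2 : measurable_fun setT (f2 u).
      by have := measurableT_comp mf2 (@pair1_measurable _ _ R R u).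
    rewrite -(ge0_intD s1 s2 (f10 u) (f20 u)).
    apply: ge0_le_int.
    + have mpu : measurable_fun setT (fun v : R => poisson e ((u : R) - v)).
        by have := measurableT_comp mp (@pair1_measurable _ _ R R u).
      exact: (measurable_funM (measurable_cst _) (measurable_funM mn mpu)).
    + exact: (measurable_funD s1 s2).
    + by move=> v; exact: poisson_form_ge0.
    + move=> v; rewrite /f1 /f2 (poissonB e v u) mulrA.
      have := p0 u v; have := sqr_ge0 (normc (x u) - normc (x v)).
      move: (poisson _ _) (normc _) (normc _) => p a b; nra.
rewrite [X in (X <= _)%E](_ : _ = (\int[mu]_u \int[mu]_v (f1 u v)%:E) +
    (\int[mu]_u \int[mu]_v (f2 u v)%:E))%E; last first.
  exact: (ge0_integralD mu measurableT (fun u _ => int_ge0 (f10 u))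
    (measurable_int2 mf1 f10) (fun u _ => int_ge0 (f20 u)) (measurable_int2 mf2 f20)).
have h0 : (0 <= (2^-1)%:E :> \bar R)%E by rewrite lee_fin.
rewrite I2 I1 -(ge0_muleDl _ h0 h0) -EFinD (_ : 2^-1 + 2^-1 = 1 :> R).
  by rewrite mul1e.
by field.
Qed.

(** The damped squared norm pairs the transform with its damped conjugate; [FT_mult] and [FT_abel]
    turn it into the Poisson quadratic form of [x]. The constant is 2 * 2 * (2 pi), two factors 2
    coming from [CI_norm]. *)
Lemma plancherel_damped e s x : 0 < e -> s ^+ 2 = 1 -> L1 x -> L2 x ->
  (\int[mu]_l (normc (FT s x l) ^+ 2 * abel e l)%:E <=
   (8 * pi)%:E * \int[mu]_u (normc (x u) ^+ 2)%:E)%E.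
Proof.
move=> e0 s1 ix ix2; have mx : cmeas x by case: ix.
have mp := meas2_poisson e0.
have mF := cmeas_FT s mx.
pose k l := FT (- s) (fun u => (x u)^*) l * (abel e l)%:C.
have ik : L1 k.
  have ab := L1_abel e0.
  have h := @L1_bounded _ _ _ _ ab (cmeas_FT (- s) (cmeasJ mx)) (ae_all (fun l => FT_le (- s) l (L1J ix))).
  by move: h; congr L1; apply/funext => l; rewrite mulrC.
have iFk : L1 (fun l => FT s x l * k l).
  have h := @L1_bounded _ _ _ _ ik mF (ae_all (fun l => FT_le s l ix)).
  by move: h; congr L1; apply/funext => l; rewrite mulrC.
have E l : normc (FT s x l) ^+ 2 * abel e l = complex.Re (FT s x l * k l).
  rewrite /k -FTJ//; move: (FT s x l) => z.
  by rewrite normc2E !ReImE /=; ring.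
have -> : (\int[mu]_l (normc (FT s x l) ^+ 2 * abel e l)%:E =
    (complex.Re (CI (fun l => FT s x l * k l)))%:E)%E.
  rewrite /= /Rintegral fineK; last exact: (integrable_fin_num measurableT (L1_Re iFk)).
  by apply: eq_integral => l _; rewrite E.
have iconv : L1 (fun u => x u * FT s k u).
  have h := @L1_bounded _ _ _ _ ix (cmeas_FT s ik.1) (ae_all (fun l => FT_le s l ik)).
  exact: h.
apply: (@le_trans _ _ (normc (CI (fun l => FT s x l * k l)))%:E).
  by rewrite lee_fin; exact: le_trans (ler_norm _) (normc_Re _).
rewrite FT_mult//; apply: le_trans (CI_norm iconv) _.
have H u : FT s k u = CI (fun v => (x v)^* * (poisson e (u - v))%:C).
  by rewrite /k FT_abel//; exact: L1J.
apply: (@le_trans _ _ (2%:E * \int[mu]_u (2%:E * \int[mu]_v (normc (x u) *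
    (normc (x v) * poisson e (u - v)))%:E))%E).
  rewrite lee_pmul2l//; apply: (ge0_le_integral _ measurableT).
  - by move=> u _; rewrite lee_fin normc_ge0.
  - by apply/measurable_EFinP; exact: measurable_normc iconv.1.
  - apply: measurable_funeM; apply: (@measurable_int2 R (fun u v => normc (x u) * (normc (x v) * poisson e (u - v)))).
      apply: measurable_funM; first exact: (meas2_fst (measurable_normc mx)).
      exact: (meas2M (meas2_snd (measurable_normc mx)) mp).
    by move=> u v; exact: poisson_form_ge0.
  - move=> u _; rewrite normcM H EFinM.
    have ip : L1 (fun v => (x v)^* * (poisson e (u - v))%:C).
      apply: (@L1_bounded _ _ _ (2 / e)); first exact: L1J.
        by apply: cmeas_real; have := measurableT_comp mp (@pair1_measurable _ _ R R u).
      apply: ae_all => v; rewrite normc_real ger0_norm ?poisson_ge0//.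
      exact: poisson_le.
    apply: (@le_trans _ _ ((normc (x u))%:E * (2%:E * \int[mu]_v (normc (x v) * poisson e (u - v))%:E))%E).
      rewrite lee_wpmul2l ?lee_fin ?normc_ge0//.
      apply: le_trans (CI_norm ip) _; rewrite lee_pmul2l//.
      rewrite le_eqVlt; apply/orP; left; apply/eqP; apply: eq_integral => v _.
      by rewrite normcM normc_conj normc_real ger0_norm// poisson_ge0.
    rewrite muleCA lee_pmul2l// -ge0_intZ ?normc_ge0//.
      apply: measurable_funM; first exact: measurable_normc.
      by have := measurableT_comp mp (@pair1_measurable _ _ R R u).
    by move=> v; apply: mulr_ge0; [exact: normc_ge0|exact: poisson_ge0].
rewrite ge0_integralZl_EFin//; last 2 first.
- by move=> u _; apply: int_ge0 => v; exact: poisson_form_ge0.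
- apply: (@measurable_int2 R (fun u v => normc (x u) * (normc (x v) * poisson e (u - v)))).
    apply: measurable_funM; first exact: (meas2_fst (measurable_normc mx)).
    exact: (meas2M (meas2_snd (measurable_normc mx)) mp).
  by move=> u v; exact: poisson_form_ge0.
rewrite (_ : (8 * pi)%:E * _ = 2%:E * (2%:E * ((2 * pi)%:E *
  \int[mu]_u (normc (x u) ^+ 2)%:E)))%E; last first.
  by rewrite !muleA -!EFinM; congr (_%:E * _)%E; ring.
by rewrite !lee_pmul2l//; exact: poisson_form_le.
Qed.

Lemma cvg_abel (l : R) : abel n.+1%:R^-1 l @[n --> \oo] --> (1 : R).
Proof.
rewrite -[X in _ --> X](@expR0 R) -oppr0 -(mul0r `|l|).
apply: continuous_cvg; first exact: continuous_expR.
apply: cvgN; apply: cvgM; last exact: cvg_cst.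
exact: cvg_harmonic.
Qed.

(** The damping tends to 1 and is removed by Fatou's lemma. An inequality is enough: it serves to
    make transforms of truncations a Cauchy sequence. *)
Lemma plancherel_le s x : s ^+ 2 = 1 -> L1 x -> L2 x ->
  (\int[mu]_l (normc (FT s x l) ^+ 2)%:E <=
   (8 * pi)%:E * \int[mu]_u (normc (x u) ^+ 2)%:E)%E.
Proof.
move=> s1 ix ix2; have mn := measurable_normc2 (cmeas_FT s ix.1).
apply: (@fatou_le R (fun n l => normc (FT s x l) ^+ 2 * abel n.+1%:R^-1 l)) => //.
- by move=> n; apply: measurable_funM => //; exact: measurable_abel.
- by move=> n l; rewrite mulr_ge0 ?sqr_ge0// abel_ge0.
- by move=> l; exact: sqr_ge0.
- apply: ae_all => l; rewrite -[X in _ --> X]mulr1; apply: cvgM; first exact: cvg_cst.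
  exact: cvg_abel.
- by move=> n; apply: plancherel_damped.
Qed.

Lemma L2_FT s x : s ^+ 2 = 1 -> L1 x -> L2 x -> L2 (FT s x).
Proof.
move=> s1 ix ix2; split; first exact: cmeas_FT ix.1.
apply: le_lt_trans (plancherel_le s1 ix ix2) _.
by apply: lte_mul_pinfty; [rewrite lee_fin mulr_ge0 ?pi_ge0| |case: ix2].
Qed.

End Plancherel.

(** * The L_2 transform as a limit of transforms of truncations *)

Section FourierL2.
Context {R : realType}.
Local Notation mu := (@lebesgue_measure R).
Local Notation L1 := (@in_L1 R setT).
Local Notation L2 := (@in_L2 R setT).
Local Notation CI := (@cint R setT).
Implicit Types (x k : R -> R[i]) (s e : R) (E : set R).

Lemma L2_trunc n x : L2 x -> L2 (trunc n x).
Proof. by move=> ix; exact: (L2_abold (measurable_itv `[- n%:R, n%:R])). Qed.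

Lemma FTB s x y l : L1 x -> L1 y -> FT s (fun u => x u - y u) l = FT s x l - FT s y l.
Proof.
move=> ix iy; rewrite /FT -CIB; [|exact: L1_FT|exact: L1_FT].
by congr CI; apply/funext => u; rewrite mulrBl.
Qed.

Lemma cvg_trunc x u : (fun n => normc (trunc n x u - x u)) @ \oo --> (0 : R).
Proof.
apply: cvg_near_cst; exists (Num.bound `|u|) => // n /= nu.
rewrite /trunc /abold ifT ?subrr ?normc0//.
rewrite inE /= in_itv /= -ler_norml.
apply: (@le_trans _ _ (Num.bound `|u|)%:R); last by rewrite ler_nat.
by apply: ltW; exact: archi_boundP.
Qed.

Lemma trunc_diff_le n m x u : (n <= m)%N ->
  normc (trunc n x u - trunc m x u) <= normc (trunc n x u - x u).
Proof.
move=> nm; rewrite /trunc /abold.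
case: ifPn => [nu|_].
  rewrite ifT//; move: nu; rewrite !inE /= !in_itv /= -!ler_norml.
  by move/le_trans; apply; rewrite ler_nat.
by case: ifP => _ //; rewrite subr0 normc0 normc_ge0.
Qed.

Lemma int_trunc_cvg x : L2 x ->
  (fun n => \int[mu]_u (normc (trunc n x u - x u) ^+ 2)%:E)%E @ \oo --> 0%E.
Proof.
move=> ix.
have [] := @dominated_convergence _ _ R mu setT measurableT
  (fun n u => (normc (trunc n x u - x u) ^+ 2)%:E) (cst 0%E)
  (fun u => (normc (x u) ^+ 2)%:E).
- move=> n; apply/measurable_EFinP.
  exact: (measurable_normc2 (cmeasB (L2_trunc n ix).1 ix.1)).
- exact: measurable_cst.
- apply: ae_all => u _; rewrite /=.
  rewrite -[X in _ --> X]/((0 : R)%:E) -[X in _ --> X%:E](mulr0 0).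
  by apply: cvg_EFin; [exact: nearW|apply: cvgM; exact: cvg_trunc].
- exact: L2_normc2.
- apply: ae_all => u n _ /=; rewrite lee_fin ger0_norm ?sqr_ge0//.
  rewrite ler_pXn2r ?nnegrE ?normc_ge0// /trunc /abold.
  by case: ifP => _; rewrite ?subrr ?sub0r ?normcN ?normc0 ?normc_ge0.
move=> _ _; rewrite integral0; apply: cvg_trans.
have -> : (fun n => \int[mu]_u (normc (trunc n x u - x u) ^+ 2)%:E)%E =
  (fun n => \int[mu]_u ((fun n u => (normc (trunc n x u - x u) ^+ 2)%:E) n u))%E by [].
by [].
Qed.

(** By [plancherel_le] the transforms of the truncations are Cauchy in L_2; the limit comes from
    [L2w_complete] with weight 1. *)
Lemma fourier_L2_exists s x : s ^+ 2 = 1 -> L2 x ->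
  exists F, fourier_L2 s setT x F.
Proof.
move=> s1 ix.
have i1 n := L1_trunc n ix; have i2 n := L2_trunc n ix.
pose c n := fine ((8 * pi)%:E * \int[mu]_u (normc (trunc n x u - x u) ^+ 2)%:E)%E.
have fin n : (\int[mu]_u (normc (trunc n x u - x u) ^+ 2)%:E \is a fin_num)%E.
  exact: (integrable_fin_num measurableT (L2_normc2 (L2B (i2 n) ix))).
have c0 : c @ \oo --> (0 : R).
  have /fine_cvgP[_ cv] := int_trunc_cvg ix.
  rewrite (_ : c = fun n => 8 * pi * fine (\int[mu]_u (normc (trunc n x u - x u) ^+ 2)%:E)%E).
    by rewrite -[X in _ --> X](mulr0 (8 * pi)); apply: cvgM => //; exact: cvg_cst.
  by apply/funext => n; rewrite /c fineM.
have mF n : cmeas (FT s (trunc n x)) by exact: (cmeas_FT s (i1 n).1).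
have [|h mh hc] := @L2w_complete R (fun=> 1) (fun n => FT s (trunc n x)) c
    (measurable_cst _) (fun=> ler01) mF _ c0.
  move=> n m nm.
  under eq_integral do rewrite mulr1 -FTB//.
  apply: le_trans (plancherel_le s1 (L1B (i1 n) (i1 m)) (L2B (i2 n) (i2 m))) _.
  rewrite /c fineK; last by rewrite fin_numM.
  rewrite lee_wpmul2l ?lee_fin ?mulr_ge0 ?pi_ge0//.
  apply: ge0_le_int.
  - exact: (measurable_normc2 (L2B (i2 n) (i2 m)).1).
  - exact: (measurable_normc2 (L2B (i2 n) ix).1).
  - by move=> u; exact: sqr_ge0.
  - by move=> u; rewrite ler_pXn2r ?nnegrE ?normc_ge0//; exact: trunc_diff_le.
have hc' n : (\int[mu]_l (normc (h l - FT s (trunc n x) l) ^+ 2)%:E <= (c n)%:E)%E.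
  apply: le_trans (hc n); rewrite le_eqVlt; apply/orP; left; apply/eqP.
  by apply: eq_integral => l _; rewrite mulr1 normcB.
exists h; apply/fourier_L2E; rewrite aboldT; split.
  have iF := L2_FT s1 (i1 0%N) (i2 0%N).
  have iD : L2 (fun l => h l - FT s (trunc 0 x) l).
    split; first exact: (cmeasB mh (mF 0%N)).
    by apply: le_lt_trans (hc' 0%N) _; rewrite ltry.
  have := L2D iD iF; congr L2; apply/funext => l; by rewrite subrK.
apply: (@squeeze_cvge _ _ _ _ (fun=> 0%E) _ (fun n => (c n)%:E)).
- apply: nearW => n; apply/andP; split; first by apply: int_ge0 => l; exact: sqr_ge0.
  exact: hc'.
- exact: cvg_cst.
- by apply: cvg_EFin => //; exact: nearW.
Qed.

(** As a limit exists, the choice made in [fourier] is a genuine L_2 transform and not the default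
    0. *)
Lemma fourier_spec s E x : measurable E -> s ^+ 2 = 1 -> in_L2 E x ->
  ~ in_L1 E x -> fourier_L2 s E x (fourier s E x).
Proof.
move=> mE s1 /(in_L2_abold _ mE) ix n1; rewrite /fourier asboolF//.
have [F HF] := fourier_L2_exists s1 ix.
have : fourier_L2 s E x F by apply/fourier_L2E; move/fourier_L2E: HF; rewrite aboldT.
by move=> HF'; exact: (xgetPex (fun=> 0) (ex_intro _ F HF')).
Qed.

Lemma L2_fourier s E x : measurable E -> s ^+ 2 = 1 -> in_L2 E x ->
  L2 (fourier s E x).
Proof.
move=> mE s1 ix; have [i1|n1] := pselect (in_L1 E x).
  rewrite fourier_L1//; apply: L2_FT => //; [exact/(in_L1_abold _ mE)|exact/(in_L2_abold _ mE)].
by have /fourier_L2E[] := fourier_spec mE s1 ix n1.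
Qed.

(** Extends [FT_mult] to square-integrable [x] by truncation: the left sides converge since
    transforms converge in L_2, the right sides by dominated convergence. *)
Lemma fourier_mult s E x k : measurable E -> s ^+ 2 = 1 -> in_L2 E x ->
  L1 k -> L2 k -> L1 (fun u => abold E x u * FT s k u) ->
  CI (fun l => fourier s E x l * k l) = CI (fun u => abold E x u * FT s k u).
Proof.
move=> mE s1 ix ik ik2 ixk; have [i1|n1] := pselect (in_L1 E x).
  by rewrite fourier_L1// FT_mult//; exact/(in_L1_abold _ mE).
have /fourier_L2E[iF cv] := fourier_spec mE s1 ix n1.
set F := fourier s E x in iF cv *; set y := abold E x in cv ixk *.
have iy : L2 y by exact/(in_L2_abold _ mE).
have i1 n := L1_trunc n iy; have i2 n := L2_trunc n iy.
have iFn n : L2 (FT s (trunc n y)) by exact: (L2_FT s1 (i1 n) (i2 n)).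
have cv' : (fun n => \int[mu]_l (normc (FT s (trunc n y) l - F l) ^+ 2)%:E)%E @ \oo --> 0%E.
  rewrite (_ : (fun n => _) =
    (fun n => \int[mu]_l (normc (F l - FT s (trunc n y) l) ^+ 2)%:E)%E)//.
  by apply/funext => n; apply: eq_integral => l _; rewrite normcB.
have cm := L2_cvg_mul iFn iF ik2 cv'.
have l1 := CI_le_cvg (L2M iF ik2) (fun n => L2M (iFn n) ik2) cm.
apply: (CI_unique l1).
rewrite (_ : (fun n => _) = (fun n => normc (CI (fun u => trunc n y u * FT s k u) -
   CI (fun u => y u * FT s k u)))); last first.
  by apply/funext => n; rewrite FT_mult.
have mFk := cmeas_FT s ik.1.
apply: (CI_dct (g := fun u => normc (y u * FT s k u))).
- by move=> n; exact: (cmeasM (i1 n).1 mFk).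
- exact: ixk.1.
- exact: L1_normc.
- apply: ae_all => u n; rewrite !normcM ler_wpM2r ?normc_ge0//.
  exact: normc_abold_le.
- apply: ae_all => u.
  rewrite (_ : (fun n => _) =
    (fun n => normc (trunc n y u - y u) * normc (FT s k u))); last first.
    by apply/funext => n; rewrite -mulrBl normcM.
  rewrite -(mul0r (normc (FT s k u))).
  by apply: cvgM; [exact: cvg_trunc|exact: cvg_cst].
Qed.

End FourierL2.

(** * Approximate identities *)

Section ApproximateIdentity.
Context {R : realType}.
Local Notation mu := (@lebesgue_measure R).
Implicit Types (f g w : R -> R) (e : R).

Definition pconv e f (l : R) : R := (\int[mu]_m (f m * poisson e (l - m)))%R.

Let norm1 f := (\int[mu]_l (`|f l|)%:E)%E.

Let intg f := mu.-integrable setT (EFin \o f).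

Lemma intg_meas f : intg f -> measurable_fun setT f.
Proof. by move=> fi; apply/measurable_EFinP; exact: measurable_int fi. Qed.

Lemma measurable_poissonB e (l : R) : 0 < e ->
  measurable_fun setT (fun m : R => poisson e (l - m)).
Proof.
by move=> e0; have := measurableT_comp (meas2_poisson e0) (@pair1_measurable _ _ R R l).
Qed.

Lemma poisson_bound e (l m : R) : 0 < e -> `|poisson e (l - m)| <= 2 / e.
Proof. by move=> e0; rewrite ger0_norm ?poisson_ge0//; exact: poisson_le. Qed.

Lemma intg_bounded f g (C : R) : intg f -> measurable_fun setT g ->
  (forall x, `|g x| <= C) -> intg (fun x => f x * g x).
Proof.
move=> fi mg gC.
have := L1_bounded (L1_real fi) (cmeas_real mg) (ae_all (fun x => _)).
move=> /(_ C); have h x : normc (g x)%:C <= C by rewrite normc_real.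
move=> /(_ h)/L1_Re; congr (mu.-integrable _ (EFin \o _)).
by apply/funext => x; rewrite cReM /= mulr0 subr0.
Qed.

Lemma intg_pconv_slice e f l : 0 < e -> intg f ->
  intg (fun m => f m * poisson e (l - m)).
Proof.
move=> e0 fi; apply: (intg_bounded fi (measurable_poissonB l e0)) => m.
exact: poisson_bound.
Qed.

Lemma measurable_pconv e f : 0 < e -> measurable_fun setT f ->
  measurable_fun setT (pconv e f).
Proof.
move=> e0 mf; apply: (@meas2_int R (fun l m => f m * poisson e (l - m))).
exact: (meas2M (meas2_snd mf) (meas2_poisson e0)).
Qed.

Lemma abs_pconv_le e f l : 0 < e -> intg f ->
  ((`|pconv e f l|)%:E <= \int[mu]_m (`|f m| * poisson e (l - m))%:E)%E.
Proof.
move=> e0 fi; have ip := intg_pconv_slice l e0 fi.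
have ia : intg (fun m => `|f m| * poisson e (l - m)).
  exact: (intg_pconv_slice l e0 (integrable_abse fi)).
rewrite -[leRHS]fineK; last exact: (integrable_fin_num measurableT ia).
rewrite lee_fin; apply: le_trans (le_normr_Rintegral measurableT ip) _.
rewrite le_eqVlt; apply/orP; left; apply/eqP; apply: eq_Rintegral => m _.
by rewrite normrM [X in _ * X]ger0_norm// poisson_ge0.
Qed.

Lemma norm1_pconv e f : 0 < e -> intg f ->
  (norm1 (pconv e f) <= (2 * pi)%:E * norm1 f)%E.
Proof.
move=> e0 fi; have mf := intg_meas fi.
have mn : measurable_fun setT (fun m => `|f m|) by exact: measurableT_comp.
rewrite -(int_poisson_mul e0 mn); last by move=> m; exact: normr_ge0.
apply: (ge0_le_integral mu measurableT).
- by move=> l _; rewrite lee_fin normr_ge0.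
- apply/measurable_EFinP; apply: measurableT_comp => //; exact: measurable_pconv.
- apply: (@measurable_int2 R (fun l m => `|f m| * poisson e (l - m))).
    exact: (meas2M (meas2_snd mn) (meas2_poisson e0)).
  by move=> l m; rewrite mulr_ge0 ?normr_ge0// poisson_ge0.
- by move=> l _; exact: abs_pconv_le.
Qed.

Lemma intg_pconv e f : 0 < e -> intg f -> intg (pconv e f).
Proof.
move=> e0 fi; apply/integrableP; split.
  by apply/measurable_EFinP; apply: measurable_pconv => //; exact: intg_meas.
apply: le_lt_trans (norm1_pconv e0 fi) _; apply: lte_mul_pinfty => //.
- by rewrite lee_fin mulr_ge0 ?pi_ge0.
- by have /integrableP[] := fi.
Qed.

Lemma pconvB e f g l : 0 < e -> intg f -> intg g ->
  pconv e (fun m => f m - g m) l = pconv e f l - pconv e g l.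
Proof.
move=> e0 fi gi; rewrite /pconv -RintegralB//; try exact: intg_pconv_slice.
by apply: eq_Rintegral => m _; rewrite mulrBl.
Qed.

Lemma Rint_poisson e (l : R) : 0 < e -> (\int[mu]_m poisson e (l - m))%R = 2 * pi.
Proof.
move=> e0; rewrite /Rintegral -[RHS]/(fine (2 * pi)%:E) -(int_poisson l e0).
by congr fine; apply: eq_integral => m _; rewrite poissonB.
Qed.

Lemma intg_poisson e (l : R) : 0 < e -> intg (fun m => poisson e (l - m)).
Proof.
move=> e0; have := integrable_poisson l e0.
by congr (mu.-integrable _ (EFin \o _)); apply/funext => m; rewrite poissonB.
Qed.

(** The usual approximate-identity estimate: near [l] continuity makes [f l - f m] small, and far
    from [l] the kernel is of order [e] by [poisson_tail]. *)
Lemma pconv_cvg_at f (B l : R) : intg f -> (forall m, `|f m| <= B) ->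
  {for l, continuous f} ->
  pconv n.+1%:R^-1 f l @[n --> \oo] --> 2 * pi * f l.
Proof.
move=> fi fB cf.
have p2 : 0 < 2 * pi :> R by rewrite mulr_gt0// pi_gt0.
have B0 : 0 <= B by apply: le_trans (fB l).
apply/cvgrPdist_le => eta eta0.
have eta1 : 0 < eta / (2 * (2 * pi)) by rewrite divr_gt0// mulr_gt0.
move/cvgrPdist_le : cf => /(_ _ eta1)[/= d d0 Hd].
pose K := 2 * B * (1 + (d ^+ 2)^-1) * (2 * pi).
have K0 : 0 <= K.
  by rewrite !mulr_ge0 ?pi_ge0// addr_ge0// invr_ge0 exprn_ge0// ltW.
have : K * n.+1%:R^-1 @[n --> \oo] --> (0 : R).
  by rewrite -[X in _ --> X](mulr0 K); apply: cvgM; [exact: cvg_cst|exact: cvg_harmonic].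
move/cvgrPdist_le => /(_ (eta / 2)); rewrite divr_gt0// => /(_ isT).
apply: filterS => n; rewrite sub0r normrN => Kn.
set e := n.+1%:R^-1 in Kn *.
have e0 : 0 < e by rewrite invr_gt0.
have ip := intg_poisson l e0; have ip1 := intg_poisson l (@ltr01 R).
have -> : 2 * pi * f l - pconv e f l =
    (\int[mu]_m ((f l - f m) * poisson e (l - m)))%R.
  rewrite -(Rint_poisson l e0) mulrC -RintegralZl// /pconv -RintegralB//.
  - by apply: eq_Rintegral => m _; rewrite mulrBl.
  - exact: integrableZ_fun.
  - exact: intg_pconv_slice.
have ii : intg (fun m => (f l - f m) * poisson e (l - m)).
  have := integrableD_fun (integrableZ_fun (f l) ip)
    (integrableZ_fun (-1) (intg_pconv_slice l e0 fi)).
  congr (mu.-integrable _ (EFin \o _)); apply/funext => m; ring.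
(* The first term dominates for [|l - m| < d], the second elsewhere; their integrals are [eta / 2]
   and [K * e]. *)
pose h m := eta / (2 * (2 * pi)) * poisson e (l - m) +
   2 * B * (e * (1 + (d ^+ 2)^-1)) * poisson 1 (l - m).
have ih : intg h by apply: integrableD_fun; exact: integrableZ_fun.
apply: le_trans (le_normr_Rintegral measurableT ii) _.
apply: (@le_trans _ _ (\int[mu]_m h m)%R).
  apply: le_Rintegral => //; first exact: integrable_abse ii.
  move=> m _; have pe := poisson_ge0 (l - m) e0; have p1 := poisson_ge0 (l - m) (@ltr01 R).
  have i0 : 0 <= 1 + (d ^+ 2)^-1 by rewrite addr_ge0// invr_ge0 exprn_ge0// ltW.
  rewrite normrM (ger0_norm pe) /h.
  have [lm|lm] := ltP `|l - m| d.
    rewrite -[leLHS]addr0 lerD//; last first.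
      by rewrite mulr_ge0// mulr_ge0 ?mulr_ge0// ltW.
    by rewrite ler_wpM2r//; apply: Hd.
  rewrite -[leLHS]add0r lerD//; first by rewrite mulr_ge0// ltW.
  rewrite -mulrA; apply: ler_pM => //.
    apply: le_trans (ler_normB _ _) _; have := fB l; have := fB m; lra.
  exact: poisson_tail.
rewrite /h RintegralD//; [|exact: integrableZ_fun|exact: integrableZ_fun].
rewrite (RintegralZl _ measurableT ip) (RintegralZl _ measurableT ip1) !Rint_poisson//.
have -> : eta / (2 * (2 * pi)) * (2 * pi) = eta / 2.
  by have := lt0r_neq0 p2; move: (2 * pi) => P P0; field; exact: P0.
have -> : 2 * B * (e * (1 + (d ^+ 2)^-1)) * (2 * pi) = K * e by rewrite /K; ring.
by have := ler_norm (K * e); lra.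
Qed.

(** A majorant independent of [e], for dominated convergence. For [|l| <= 2 * M] the mean is at most
    [2 * pi * B]; beyond, [l] is far from the support and the mean decays like the kernel itself. *)
Lemma pconv_dominated e f (B M l : R) : 0 < e -> e <= 1 -> 1 <= M -> intg f ->
  (forall m, `|f m| <= B) -> (forall m, M < `|m| -> f m = 0) ->
  `|pconv e f l| <= (2 * pi * B * (1 + 4 * M ^+ 2) + 16 * M * B) * poisson 1 l.
Proof.
move=> e0 e1 M1 fi fB f0.
have B0 : 0 <= B by apply: le_trans (fB l).
have p2 : 0 <= 2 * pi :> R by rewrite mulr_ge0// pi_ge0.
have l2 : 0 <= l ^+ 2 by exact: sqr_ge0.
have M0 : 0 < M by lra.
have MM : 0 <= M ^+ 2 by exact: sqr_ge0.
have pl := poisson_ge0 l (@ltr01 R).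
have ip := intg_poisson l e0.
have is_ := intg_pconv_slice l e0 fi.
apply: le_trans (le_normr_Rintegral measurableT is_) _.
have [lM|Ml] := leP `|l| (2 * M).
  apply: (@le_trans _ _ (\int[mu]_m (B * poisson e (l - m)))%R).
    apply: le_Rintegral => //; first exact: integrable_abse is_.
      exact: integrableZ_fun.
    move=> m _; rewrite normrM [X in _ * X]ger0_norm ?poisson_ge0//.
    by rewrite ler_wpM2r// poisson_ge0.
  rewrite RintegralZl// Rint_poisson//.
  have h1 : 1 <= (1 + 4 * M ^+ 2) * poisson 1 l.
    rewrite /poisson expr1n mulr1 mulrA ler_pdivlMr ?mul1r; last lra.
    have : l ^+ 2 <= (2 * M) ^+ 2.
      by rewrite -(real_normK (num_real l)) lerXn2r ?nnegrE//; lra.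
    rewrite exprMn; lra.
  apply: (@le_trans _ _ (2 * pi * B * ((1 + 4 * M ^+ 2) * poisson 1 l))).
    by rewrite mulrC -[leLHS]mulr1 ler_wpM2l// mulr_ge0.
  have : 0 <= 16 * M * B * poisson 1 l.
    by apply: mulr_ge0 => //; apply: mulr_ge0 => //; lra.
  by rewrite mulrDl; lra.
pose I : set R := `[- M, M]%classic.
have mI : measurable I by exact: measurable_itv.
have iI : intg \1_I.
  apply: integrable_ge0 => //.
  rewrite integral_indic// setIT -[X in (X < _)%E]/(lebesgue_measure `[- M, M]%classic).
  by rewrite lebesgue_measure_itv /=; case: ifP => _; rewrite -?EFinB ltry.
have II : (\int[mu]_m (\1_I m : R))%R = 2 * M.
  rewrite /Rintegral integral_indic// setIT -[X in fine X]/(lebesgue_measure `[- M, M]%classic).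
  rewrite lebesgue_measure_itv /= lte_fin ifT /=; first by ring.
  lra.
(* On the support [|l - m| >= |l| / 2], whence [poisson e (l - m) <= 8 / l ^+ 2 <= 8 * poisson 1 l],
   as [e <= 1] and [l ^+ 2 >= 4]. *)
apply: (@le_trans _ _ (\int[mu]_m (8 * B * poisson 1 l * \1_I m))%R).
  apply: le_Rintegral => //; first exact: integrable_abse is_.
    exact: integrableZ_fun.
  move=> m _; rewrite normrM [X in _ * X]ger0_norm ?poisson_ge0//.
  have [Mm|mM] := ltP M `|m|.
    by rewrite f0// normr0 mul0r mulr_ge0// mulr_ge0// mulr_ge0.
  have mIm : I m by rewrite /I /= in_itv /= -ler_norml.
  rewrite indicE mem_set// mulr1 [8 * B]mulrC -mulrA ler_pM ?poisson_ge0//.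
  have lm : `|l| / 2 <= `|l - m|.
    have := lerB_dist l m; lra.
  have ll : 4 * M ^+ 2 <= l ^+ 2.
    rewrite -(real_normK (num_real l)) -[4 * _](_ : (2 * M) ^+ 2 = _); last first.
      by rewrite exprMn; ring.
    by rewrite lerXn2r ?nnegrE//; lra.
  have lm2 : l ^+ 2 / 4 <= (l - m) ^+ 2.
    rewrite -(real_normK (num_real l)) -(real_normK (num_real (l - m))).
    rewrite (_ : _ / 4 = (`|l| / 2) ^+ 2); last by field.
    by rewrite lerXn2r ?nnegrE//; apply: divr_ge0.
  have M2 : 1 <= M ^+ 2 by rewrite exprn_ege1.
  rewrite /poisson expr1n mulr1 mulrA ler_pdivlMr; last lra.
  rewrite mulrAC ler_pdivrMr; last by have := sqr_ge0 e; lra.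
  by have := sqr_ge0 e; nra.
rewrite RintegralZl// II.
have : 0 <= 2 * pi * B * (1 + 4 * M ^+ 2) * poisson 1 l.
  by apply: mulr_ge0 => //; apply: mulr_ge0; [exact: mulr_ge0|lra].
by rewrite [X in _ -> _ <= X]mulrDl; lra.
Qed.

Lemma ae_neq (a : R) : {ae mu, forall l, l != a}.
Proof.
exists [set a]; split; [exact: measurable_set1|exact: lebesgue_measure_set1|].
by move=> l /= /negP; rewrite negbK => /eqP.
Qed.

(** Pointwise convergence can fail only at the jumps [- M] and [M], a null set; [pconv_dominated]
    supplies the majorant. *)
Lemma pconv_cvg_cont f (g : R -> R) (M : R) : 1 <= M -> continuous g ->
  (forall m, f m = if `|m| <= M then g m else 0) ->
  (fun n => norm1 (fun l => pconv n.+1%:R^-1 f l - 2 * pi * f l)) @ \oo --> 0%E.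
Proof.
move=> M1 cg fE.
have M0 : - M <= M by lra.
have [B fB] : exists B, forall m, `|f m| <= B.
  have [c1 _ H1] := EVT_max M0 (continuous_subspaceT cg).
  have [c2 _ H2] := EVT_min M0 (continuous_subspaceT cg).
  exists (`|g c1| + `|g c2|) => m; rewrite fE; case: ifPn => [mM|_]; last first.
    by rewrite normr0 addr_ge0.
  have mI : m \in `[- M, M] by rewrite in_itv /= -ler_norml.
  have := H1 m mI; have := H2 m mI; have := ler_norm (g c1).
  have := ler_norm (- g c2); rewrite normrN ler_norml.
  have := normr_ge0 (g c1); have := normr_ge0 (g c2) => *; apply/andP; split; lra.
have mf : measurable_fun setT f.
  rewrite (_ : f = g \_ `[- M, M]%classic).
    apply/(measurable_restrictT _ (measurable_itv _)).
    by apply: measurable_funTS; exact: continuous_measurable_fun.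
  by apply/funext => m; rewrite fE /patch mem_setE in_itv /= -ler_norml.
have B0 : 0 <= B by apply: le_trans (fB 0).
have f0 m : M < `|m| -> f m = 0 by move=> mM; rewrite fE leNgt mM.
have fi : intg f.
  have ig : intg (fun m => B * (1 + M ^+ 2) * poisson 1 (m - 0)).
    by apply: integrableZ_fun; exact: integrable_poisson.
  apply: (le_integrable measurableT _ _ ig); first exact/measurable_EFinP.
  move=> m _ /=; rewrite lee_fin; apply: le_trans (ler_norm _); rewrite subr0.
  have p1 := poisson_ge0 m (@ltr01 R).
  have [mM|Mm] := leP `|m| M; last first.
    by rewrite f0// normr0 mulr_ge0// mulr_ge0// addr_ge0// sqr_ge0.
  apply: le_trans (fB m) _; rewrite -mulrA -[leLHS]mulr1 ler_wpM2l//.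
  rewrite /poisson expr1n mulr1 mulrA ler_pdivlMr ?mul1r; last by have := sqr_ge0 m; lra.
  have : m ^+ 2 <= M ^+ 2.
    by rewrite -(real_normK (num_real m)) lerXn2r ?nnegrE//; lra.
  by have := sqr_ge0 m; lra.
have en (n : nat) : 0 < n.+1%:R^-1 :> R by [].
have en1 (n : nat) : n.+1%:R^-1 <= 1 :> R by rewrite invf_le1// ler1n.
pose K := 2 * pi * B * (1 + 4 * M ^+ 2) + 16 * M * B.
have [] := @dominated_convergence _ _ R mu setT measurableT
  (fun n l => (pconv n.+1%:R^-1 f l)%:E) (fun l => (2 * pi * f l)%:E)
  (fun l => (K * poisson 1 (l - 0))%:E).
- by move=> n; apply/measurable_EFinP; exact: measurable_pconv.
- by apply/measurable_EFinP; exact: measurable_funM.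
- apply: (ae_imp2 (ae_neq (- M)) (ae_neq M)) => l l1 l2 _.
  apply: cvg_EFin; first exact: nearW.
  apply: (@pconv_cvg_at f B) => //.
  have lM : `|l| != M by rewrite eqr_norml negb_and negb_or l1 l2.
  have [lt|gt|eq] := ltgtP `|l| M; last by rewrite eq eqxx in lM.
    have nl : \forall m \near l, `|m| < M.
      have /cvgr_lt := @norm_continuous R R^o l; exact.
    change (f x @[x --> l] --> f l); rewrite (fE l) (ltW lt); apply: cvg_trans (cg l).
    by apply: near_eq_cvg; apply: filterS nl => m mM; rewrite fE ltW.
  have nl : \forall m \near l, M < `|m|.
    have /cvgr_gt := @norm_continuous R R^o l; exact.
  change (f x @[x --> l] --> f l); rewrite (f0 l gt).
  have cc : (fun=> 0 : R) x @[x --> l] --> (0 : R) by exact: cvg_cst.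
  apply: cvg_trans cc.
  by apply: near_eq_cvg; apply: filterS nl => m mM; rewrite f0.
- by apply: integrableZ_fun; exact: integrable_poisson.
- apply: ae_all => l n _; rewrite subr0 lee_fin; exact: pconv_dominated.
by move=> _ h _; exact: h.
Qed.

End ApproximateIdentity.

(** * Orthogonality relations between spectra and supports *)

Section Spectral.
Context {R : realType}.
Local Notation mu := (@lebesgue_measure R).
Local Notation L1 := (@in_L1 R setT).
Local Notation L2 := (@in_L2 R setT).
Local Notation CI := (@cint R setT).
Implicit Types (f g : R -> R) (e : R) (v G : R -> R[i]).

Local Notation norm1 f := (\int[mu]_l (`|f l|)%:E)%E.
Local Notation intg f := (mu.-integrable setT (EFin \o f)).

Lemma intgB f g : intg f -> intg g -> intg (fun x => f x - g x).
Proof. by move=> fi gi; have := integrableB measurableT fi gi. Qed.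

Lemma norm1_fine f : `|fine (norm1 f)| = fine (norm1 f).
Proof. by rewrite ger0_norm//; apply/fine_ge0/int_ge0 => x; exact: normr_ge0. Qed.

Lemma norm1_triangle f g h : intg f -> intg g -> intg h ->
  (norm1 (fun x => f x - h x) <=
   norm1 (fun x => f x - g x) + norm1 (fun x => g x - h x))%E.
Proof.
move=> fi gi hi.
have m1 : measurable_fun setT (fun x => `|f x - g x|).
  by apply: measurableT_comp => //; exact: intg_meas (intgB fi gi).
have m2 : measurable_fun setT (fun x => `|g x - h x|).
  by apply: measurableT_comp => //; exact: intg_meas (intgB gi hi).
rewrite -(ge0_intD m1 m2)//; apply: ge0_le_int => //.
- by apply: measurableT_comp => //; exact: intg_meas (intgB fi hi).
- exact: measurable_funD.
- by move=> x; exact: ler_distD.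
Qed.

(** Half of [d] pays for cutting [f] off to a bounded interval, half for replacing it there by a
    continuous function. *)
Lemma L1_approx f (d : R) : intg f -> 0 < d ->
  exists (w g : R -> R) (M : R), [/\ 1 <= M, continuous g,
    forall m, w m = if `|m| <= M then g m else 0, intg w &
    (norm1 (fun x => f x - w x) <= d%:E)%E].
Proof.
move=> fi d0.
have cu (a : R) n := @cvg_trunc R (fun x => (f x)%:C) a.
have mt n : cmeas (trunc n (fun x => (f x)%:C)).
  exact: (L1_abold (measurable_itv `[- n%:R, n%:R]) (L1_real fi)).1.
have [] := L1_dct mt (L1_real fi).1 (integrable_abse fi) _ _.
- apply: ae_all => x n; apply: le_trans (normc_abold_le _ _ _) _.
  by rewrite normc_real.
- by apply: ae_all => x; exact: cvg_trunc.
move=> _ _ /fine_cvgP[_ /cvgrPdist_le/(_ (d / 2))]; rewrite divr_gt0// => /(_ isT)[k _ Hk].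
have {Hk} := Hk k.+1 (leqnSn k); rewrite /= sub0r normrN => Hk.
pose M : R := k.+1%:R; pose E : set R := `[- M, M]%classic.
have mE : measurable E by exact: measurable_itv.
have Efin : (mu E < +oo)%E.
  rewrite -[X in (X < _)%E]/(lebesgue_measure `[- M, M]%classic).
  by rewrite lebesgue_measure_itv /=; case: ifP => _; rewrite -?EFinB ltry.
have fE : mu.-integrable E (EFin \o f) by exact: integrableS fi.
have [g_ [cg ig cvg]] := approximation_continuous_integrable mE Efin fE.
move/fine_cvgP : cvg => [_ /cvgrPdist_le/(_ (d / 2))]; rewrite divr_gt0// => /(_ isT)[j _ Hj].
have {Hj} := Hj j (leqnn j); rewrite /= sub0r normrN => Hj.
pose g := g_ j; pose w m := if `|m| <= M then g m else 0.
have wE : w = g \_ E.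
  by apply/funext => m; rewrite /w /patch mem_setE in_itv /= -ler_norml.
have iw : intg w.
  apply/integrableP; split.
    apply/measurable_EFinP; rewrite wE; apply/(measurable_restrictT _ mE).
    by apply: measurable_funTS; apply: continuous_measurable_fun; exact: cg.
  have /integrableP[_] := ig j; apply: le_lt_trans.
  rewrite [leRHS]integral_mkcond le_eqVlt; apply/orP; left; apply/eqP.
  apply: eq_integral => x _; rewrite wE /= /patch; case: ifP => // _.
  by rewrite normr0.
pose f1 x := complex.Re (trunc k.+1 (fun x => (f x)%:C) x).
have f1E : f1 = f \_ E.
  by apply/funext => x; rewrite /f1 /trunc /abold /patch; case: ifP.
have if1 : intg f1 by exact: L1_Re (L1_abold mE (L1_real fi)).
exists w, g, M; split => //; first by rewrite ler1n.
  exact: cg.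
apply: le_trans (norm1_triangle fi if1 iw) _.
rewrite (_ : d%:E = (d / 2)%:E + (d / 2)%:E)%E; last first.
  by rewrite -EFinD; congr (_%:E); field.
apply: leeD.
  rewrite -lee_fin in Hk; apply: le_trans Hk.
  rewrite ger0_norm ?fine_ge0 ?int_ge0//; last by move=> x; exact: normc_ge0.
  rewrite fineK; last first.
    exact: (integrable_fin_num measurableT (L1_normc (L1B (L1_abold mE (L1_real fi)) (L1_real fi)))).
  apply: ge0_le_int.
  - by apply: measurableT_comp => //; exact: intg_meas (intgB fi if1).
  - exact: (measurable_normc (cmeasB (mt _) (L1_real fi).1)).
  - by move=> x; exact: normr_ge0.
  - move=> x; rewrite normcB /f1 /trunc /abold; case: ifP => _.
      rewrite [complex.Re _]/= subrr normr0; exact: normc_ge0.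
    by rewrite [complex.Re _]/= !subr0 normc_real.
have eqI : (\int[mu]_(z in E) (`|f z - g_ j z|)%:E = norm1 (fun x => f1 x - w x))%E.
  rewrite integral_mkcond; apply: eq_integral => x _.
  by rewrite f1E wE /patch; case: ifP => // _; rewrite subrr normr0.
rewrite -lee_fin in Hj; apply: le_trans Hj.
rewrite ger0_norm ?fine_ge0//; last by apply: integral_ge0 => x _; rewrite lee_fin.
rewrite [X in (_ <= (fine X)%:E)%E]eqI fineK//.
exact: (integrable_fin_num measurableT (integrable_abse (intgB if1 iw))).
Qed.

(** Density argument: by [norm1_pconv] the Poisson means are bounded on L_1 uniformly in [e], and
    convergence is known on the dense class of [L1_approx]. *)
Lemma pconv_cvg f : intg f ->
  (fun n => norm1 (fun l => pconv n.+1%:R^-1 f l - 2 * pi * f l)) @ \oo --> 0%E.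
Proof.
move=> fi.
have en (n : nat) : 0 < n.+1%:R^-1 :> R by [].
have i1 n : intg (pconv n.+1%:R^-1 f) by exact: intg_pconv.
have i2 : intg (fun l => 2 * pi * f l) by exact: integrableZ_fun.
have p2 : 0 < 2 * pi :> R by rewrite mulr_gt0// pi_gt0.
apply/fine_cvgP; split.
  apply: nearW => n; apply: (integrable_fin_num measurableT).
  exact: (integrable_abse (intgB (i1 n) i2)).
apply/cvgrPdist_le => d d0.
(* Multiplied by the operator bound [2 * pi] this is [d / 3], one of three equal contributions. *)
have d1 : 0 < d / (6 * pi) by rewrite divr_gt0// mulr_gt0// pi_gt0.
have [w [g [M [M1 cg wE iw fw]]]] := L1_approx fi d1.
have := pconv_cvg_cont M1 cg wE.
move=> /fine_cvgP[_ /cvgrPdist_le/(_ (d / 3))]; rewrite divr_gt0// => /(_ isT).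
apply: filterS => n; rewrite !sub0r !normrN.
have j1 : intg (pconv n.+1%:R^-1 w) by exact: intg_pconv.
have j2 : intg (fun l => 2 * pi * w l) by exact: integrableZ_fun.
rewrite !norm1_fine -[in X in X -> _]lee_fin fineK; last first.
  apply: (integrable_fin_num measurableT).
  exact: (integrable_abse (intgB j1 j2)).
rewrite -lee_fin fineK; last first.
  apply: (integrable_fin_num measurableT).
  exact: (integrable_abse (intgB (i1 n) i2)).
move=> hw; apply: le_trans (norm1_triangle (i1 n) j1 i2) _.
rewrite (_ : d%:E = (d / 3)%:E + ((d / 3)%:E + (d / 3)%:E))%E; last first.
  by rewrite -!EFinD; congr (_%:E); field.
have e1 : 2 * pi * (d / (6 * pi)) = d / 3.
  by have := lt0r_neq0 (pi_gt0 R); move: (pi : R) => P P0; field; exact: P0.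
apply: leeD.
  rewrite -e1 EFinM; apply: (@le_trans _ _ ((2 * pi)%:E * norm1 (fun x => f x - w x))%E).
    apply: le_trans (norm1_pconv (en n) (intgB fi iw)).
    rewrite le_eqVlt; apply/orP; left; apply/eqP; apply: eq_integral => l _.
    by rewrite pconvB.
  by rewrite lee_wpmul2l// lee_fin ltW.
apply: le_trans (norm1_triangle j1 j2 i2) _; apply: leeD => //.
rewrite -e1 EFinM; apply: (@le_trans _ _ ((2 * pi)%:E * norm1 (fun x => f x - w x))%E); last first.
  by rewrite lee_wpmul2l// lee_fin ltW.
rewrite -ge0_intZ//; [|by apply: measurableT_comp => //; exact: intg_meas (intgB fi iw)|exact: ltW].
rewrite le_eqVlt; apply/orP; left; apply/eqP; apply: eq_integral => l _.
by rewrite -mulrBr normrM (gtr0_norm p2) distrC.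
Qed.

Definition cconv e v (l : R) : R[i] := CI (fun m => v m * (poisson e (l - m))%:C).

Lemma cconvE e v l : cconv e v l =
  pconv e (fun m => complex.Re (v m)) l +i* pconv e (fun m => complex.Im (v m)) l.
Proof.
apply: eqcP; rewrite /= /pconv; apply: eq_Rintegral => m _; rewrite !ReImE /=; ring.
Qed.

Lemma L1_cconv e v : 0 < e -> L1 v -> L1 (cconv e v).
Proof.
move=> e0 iv; have ir := intg_pconv e0 (L1_Re iv); have ii := intg_pconv e0 (L1_Im iv).
apply: (@L1_le _ _ (fun l => `|pconv e (fun m => complex.Re (v m)) l| +
                             `|pconv e (fun m => complex.Im (v m)) l|)).
- rewrite (_ : cconv e v = fun l => pconv e (fun m => complex.Re (v m)) l +i*
    pconv e (fun m => complex.Im (v m)) l); last first.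
    by apply/funext => l; rewrite cconvE.
  by split; [exact: intg_meas ir|exact: intg_meas ii].
- by apply: integrableD_fun; [exact: integrable_abse ir|exact: integrable_abse ii].
- by apply: ae_all => l; rewrite cconvE; exact: normc_le_ReIm.
Qed.

Lemma cconv_cvg v : L1 v ->
  (fun n => \int[mu]_l (normc (cconv n.+1%:R^-1 v l - (2 * pi)%:C * v l))%:E)%E @ \oo --> 0%E.
Proof.
move=> iv; have ir := L1_Re iv; have ii := L1_Im iv.
have en (n : nat) : 0 < n.+1%:R^-1 :> R by [].
have hr := pconv_cvg ir; have hi := pconv_cvg ii.
have h : (fun n => norm1 (fun l => pconv n.+1%:R^-1 (fun m => complex.Re (v m)) l -
     2 * pi * complex.Re (v l)) +
   norm1 (fun l => pconv n.+1%:R^-1 (fun m => complex.Im (v m)) l -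
     2 * pi * complex.Im (v l)))%E @ \oo --> 0%E.
  by rewrite -[X in _ --> X](adde0 0%E); apply: cvgeD.
apply: (squeeze_cvge _ (cvg_cst 0%E) h); apply: nearW => n; apply/andP; split.
  by apply: int_ge0 => l; exact: normc_ge0.
have mr := intg_meas (intgB (intg_pconv (en n) ir) (integrableZ_fun (2 * pi) ir)).
have mi := intg_meas (intgB (intg_pconv (en n) ii) (integrableZ_fun (2 * pi) ii)).
have mr' := measurableT_comp (@normr_measurable R setT) mr.
have mi' := measurableT_comp (@normr_measurable R setT) mi.
rewrite -(ge0_intD mr' mi'); first last.
- by move=> l; exact: normr_ge0.
- by move=> l; exact: normr_ge0.
apply: ge0_le_int.
- exact: (measurable_normc (L1B (L1_cconv (en n) iv) (L1Z _ iv)).1).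
- exact: measurable_funD.
- by move=> l; exact: normc_ge0.
- move=> l; apply: le_trans (normc_le_ReIm _) _.
  rewrite cconvE !ReImE /= !mul0r subr0 addr0; exact: lexx.
Qed.

(* [v] itself has no inverse transform, so the pairing is computed with the   *)
(* Poisson means of [v]: their transforms, damped by Abel's factor, lie in    *)
(* [L_1] and [L_2] and still vanish off [T].                                  *)
Lemma spectral_orthogonal (T : set R) G1 G2 v (C : R) : 0 <= C ->
  L2 G1 -> L2 G2 -> {ae mu, forall l, normc (G1 l) <= C} ->
  {ae mu, forall l, normc (G2 l) <= C} -> ae_eq_on T (fourier (-1) setT G1) (fourier (-1) setT G2) ->
  L1 v -> (forall t, ~ T t -> CI (fun l => v l * expi (t * l)) = 0) ->
  CI (fun l => (G2 l - G1 l) * v l) = 0.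
Proof.
move=> C0 i1 i2 b1 b2 eqT iv v0.
have s1 : (-1) ^+ 2 = 1 :> R by ring.
have en (n : nat) : 0 < n.+1%:R^-1 :> R by [].
have ic n := L1_cconv (en n) iv.
have mul_swap (F G : R -> R[i]) : (fun l => F l * G l) = (fun l => G l * F l).
  by apply/funext => l; rewrite mulrC.
have iG1 n : L1 (fun l => G1 l * cconv n.+1%:R^-1 v l).
  by rewrite mul_swap; exact: L1_bounded (ic n) i1.1 b1.
have iG2 n : L1 (fun l => G2 l * cconv n.+1%:R^-1 v l).
  by rewrite mul_swap; exact: L1_bounded (ic n) i2.1 b2.
have Z n : CI (fun l => (G2 l - G1 l) * cconv n.+1%:R^-1 v l) = 0.
  pose e : R := n.+1%:R^-1; have e0 : 0 < e := en n.
  (* The damped transform of [v], whose transform with sign -1 is the Poisson mean [cconv e v]. *)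
  pose k l := FT 1 v l * (abel e l)%:C.
  have mk : cmeas k.
    by apply: cmeasM; [exact: cmeas_FT iv.1|apply: cmeas_real; exact: measurable_abel].
  pose C1 := 2 * fine (\int[mu]_u (normc (v u))%:E)%E.
  have kle l : normc (k l) <= C1 * abel e l.
    rewrite normcM normc_real (ger0_norm (abel_ge0 _ _)) ler_wpM2r ?abel_ge0//.
    exact: FT_le.
  have ik : L1 k.
    apply: (L1_le mk (integrableZ_fun C1 (integrable_abel e0))).
    by apply: ae_all.
  have ik2 : L2 k.
    apply: (L2_le mk (integrableZ_fun (C1 ^+ 2) (integrable_abel e0))).
    apply: ae_all => l; apply: (@le_trans _ _ ((C1 * abel e l) ^+ 2)).
      rewrite ler_pXn2r ?nnegrE ?normc_ge0//.
      exact: le_trans (normc_ge0 _) (kle l).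
    rewrite exprMn ler_wpM2l ?sqr_ge0// expr2 -[leRHS]mul1r.
    by rewrite ler_wpM2r ?abel_ge0// abel_le1.
  have Fk u : FT (-1) k u = cconv e v u.
    by have := FT_abel u e0 s1 iv; rewrite opprK.
  have M G : L2 G -> L1 (fun l => G l * cconv e v l) ->
      CI (fun l => fourier (-1) setT G l * k l) = CI (fun l => G l * cconv e v l).
    move=> iG iGc; have FkE : FT (-1) k = cconv e v by apply/funext.
    by have := @fourier_mult R (-1) setT G k measurableT s1 iG ik ik2; rewrite aboldT FkE; apply.
  have E : CI (fun l => G1 l * cconv e v l) = CI (fun l => G2 l * cconv e v l).
    rewrite -(M _ i1 (iG1 n)) -(M _ i2 (iG2 n)); apply: CI_ae.
    - exact: cmeasM (L2_fourier measurableT s1 i1).1 mk.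
    - exact: cmeasM (L2_fourier measurableT s1 i2).1 mk.
    (* On [T] the two transforms agree; off [T] the factor [k] vanishes, because [FT 1 v t] is the
       moment of [v] at [t]. *)
    - apply: (ae_imp eqT) => t Tt; have [/Tt ->//|nT] := pselect (T t).
      have Ft0 : FT 1 v t = 0.
        rewrite -(v0 _ nT) /FT; congr CI; apply/funext => u.
        by congr (_ * expi _); rewrite mul1r mulrC.
      have k0 : k t = 0 by rewrite /k Ft0; exact: mul0r.
      have Z0 (z z' : R[i]) : z * 0 = z' * 0 by rewrite !mulr0.
      rewrite k0; exact: Z0.
  transitivity (CI (fun l => G2 l * cconv e v l - G1 l * cconv e v l)).
    by congr CI; apply/funext => l; rewrite mulrBl.
  by rewrite CIB ?E ?subrr//; [exact: (iG2 n)|exact: (iG1 n)].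
(* Passage to the limit: the Poisson means of [v] tend to [2 * pi * v] in L_1 and [H] is bounded. *)
pose H l := G2 l - G1 l.
have mH : cmeas H by exact: cmeasB i2.1 i1.1.
have bH : {ae mu, forall l, normc (H l) <= C + C}.
  apply: (ae_imp2 b1 b2) => l h1 h2; apply: le_trans (normc_triangle _ _) _.
  by rewrite normcN lerD.
have iHv : L1 (fun l => H l * ((2 * pi)%:C * v l)).
  by rewrite mul_swap; exact: L1_bounded (L1Z _ iv) mH bH.
have iHc n : L1 (fun l => H l * cconv n.+1%:R^-1 v l).
  by rewrite mul_swap; exact: L1_bounded (ic n) mH bH.
have cv : (fun n => \int[mu]_l (normc (H l * cconv n.+1%:R^-1 v l -
    H l * ((2 * pi)%:C * v l)))%:E)%E @ \oo --> 0%E.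
  have h : (fun n => (C + C)%:E * \int[mu]_l (normc (cconv n.+1%:R^-1 v l -
      (2 * pi)%:C * v l))%:E)%E @ \oo --> 0%E.
    by rewrite -[X in _ --> X](mule0 (C + C)%:E); apply: cvgeZl => //; exact: cconv_cvg.
  have CC0 : 0 <= C + C by exact: addr_ge0.
  apply: (squeeze_cvge _ (cvg_cst 0%E) h); apply: nearW => n; apply/andP; split.
    by apply: int_ge0 => l; exact: normc_ge0.
  have mB := (L1B (ic n) (L1Z (2 * pi)%:C iv)).1.
  rewrite -ge0_intZ//; [|exact: measurable_normc mB|by move=> l; exact: normc_ge0].
  apply: ae_ge0_le_int.
  - exact: (measurable_normc (L1B (iHc n) iHv).1).
  - by apply: measurable_funM => //; exact: measurable_normc mB.
  - by move=> l; exact: normc_ge0.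
  - by move=> l; apply: mulr_ge0 => //; exact: normc_ge0.
  - apply: (ae_imp bH) => l hl; rewrite -mulrBr normcM ler_wpM2r//; exact: normc_ge0.
have l0 := CI_le_cvg iHv iHc cv.
have /eqP : CI (fun l => H l * ((2 * pi)%:C * v l)) = 0.
  apply: (CI_unique l0); rewrite (_ : (fun n => _) = fun=> 0); first exact: cvg_cst.
  by apply/funext => n; rewrite Z subr0 normc0.
have iHv' : L1 (fun l => H l * v l).
  by rewrite mul_swap; exact: L1_bounded iv mH bH.
rewrite (_ : (fun l => _) = (fun l => (2 * pi)%:C * (H l * v l))); last first.
  by apply/funext => l; rewrite mulrCA.
rewrite CIZ// mulf_eq0 real_complex_eq0 gt_eqF ?mulr_gt0 ?pi_gt0//= => /eqP.
by [].
Qed.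

End Spectral.

(** * Inverse transforms away from the support *)

Section FourierVanish.
Context {R : realType}.
Local Notation mu := (@lebesgue_measure R).
Local Notation L1 := (@in_L1 R setT).
Local Notation L2 := (@in_L2 R setT).
Local Notation CI := (@cint R setT).

Lemma L2_poisson e (a : R) : 0 < e -> L2 (fun u => (poisson e (u - a))%:C).
Proof.
move=> e0; have ip := integrable_poisson a e0.
apply: (L2_le _ (integrableZ_fun (2 / e) ip)).
  by apply: cmeas_real; exact: intg_meas ip.
apply: ae_all => u; rewrite normc_real (ger0_norm (poisson_ge0 _ e0)) expr2.
by rewrite ler_wpM2r ?poisson_ge0// poisson_le.
Qed.

(** Damped by Abel's factor, the inversion integral at [t0] is the Poisson mean of [x] at [t0],
    which is of order [e] because [x] lives at distance at least [d]. Integrability of the transform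
    lets the damping be removed. *)
Lemma fourier_vanish (T : set R) x (t0 d : R) : measurable T -> 0 < d ->
  (forall u, T u -> d <= `|u - t0|) -> in_L2 T x -> L1 (fourier 1 T x) ->
  CI (fun l => fourier 1 T x l * expi (- t0 * l)) = 0.
Proof.
move=> mT d0 Td ix; set F := fourier 1 T x => iF.
have en (n : nat) : 0 < n.+1%:R^-1 :> R by [].
pose k (n : nat) (l : R) := (abel n.+1%:R^-1 l)%:C * expi (- t0 * l).
have mt : measurable_fun setT (fun l : R => - t0 * l) by exact: measurable_funM.
have ik n : L1 (k n) by apply: L1_expi => //; exact: L1_abel.
have nk n l : normc (k n l) = abel n.+1%:R^-1 l.
  by rewrite normcM normc_expi mulr1 normc_real ger0_norm// abel_ge0.
have ik2 n : L2 (k n).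
  apply: (L2_le (ik n).1 (integrable_abel (en n))).
  apply: ae_all => l; rewrite nk expr2 -[leRHS]mul1r.
  by rewrite ler_wpM2r ?abel_ge0// abel_le1.
have FTk n u : FT 1 (k n) u = (poisson n.+1%:R^-1 (u - t0))%:C.
  rewrite -CI_abel_expi// /FT; congr CI; apply/funext => l.
  by rewrite /k -mulrA -expiD; congr (_ * expi _); ring.
pose y := abold T x; have iy : L2 y by exact/(in_L2_abold _ mT).
have iyp e : 0 < e -> L1 (fun u => y u * (poisson e (u - t0))%:C).
  by move=> e0; exact: L2M iy (L2_poisson t0 e0).
have FTkE n : FT 1 (k n) = fun u => (poisson n.+1%:R^-1 (u - t0))%:C.
  by apply/funext => u; rewrite FTk.
have E n : CI (fun l => F l * k n l) = CI (fun u => y u * (poisson n.+1%:R^-1 (u - t0))%:C).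
  have := @fourier_mult R 1 T x (k n) mT (expr1n _ _) ix (ik n) (ik2 n).
  by rewrite FTkE; apply; exact: iyp.
have c1 : (fun n => normc (CI (fun l => F l * k n l) - CI (fun l => F l * expi (- t0 * l))))
    @ \oo --> (0 : R).
  apply: (CI_dct (g := fun l => normc (F l))).
  - by move=> n; exact: cmeasM iF.1 (ik n).1.
  - by apply: cmeasM; [exact: iF.1|exact: cmeas_expi].
  - exact: L1_normc.
  - apply: ae_all => l n; rewrite normcM nk -[leRHS]mulr1 ler_wpM2l ?normc_ge0//.
    exact: abel_le1.
  - apply: ae_all => l.
    rewrite (_ : (fun n => _) = (fun n => normc (F l) * `|abel n.+1%:R^-1 l - 1|)); last first.
      apply/funext => n; rewrite /k -mulrBr normcM -[X in _ * normc (_ - X)]mul1r -mulrBl.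
      rewrite normcM normc_expi mulr1 -normc_real; congr (_ * normc _).
      by rewrite rmorphB.
    rewrite -(mulr0 (normc (F l))); apply: cvgM; first exact: cvg_cst.
    rewrite -(@normr0 _ R) -(subrr 1); apply: cvg_norm.
    by apply: cvgB; [exact: cvg_abel|exact: cvg_cst].
apply: (CI_unique c1).
pose I1 := (\int[mu]_u (normc (y u * (poisson 1 (u - t0))%:C))%:E)%E.
have I1f : (I1 \is a fin_num)%E.
  exact: (integrable_fin_num measurableT (L1_normc (iyp _ ltr01))).
pose K := 2 * (1 + (d ^+ 2)^-1) * fine I1.
have cK : (fun n : nat => K * n.+1%:R^-1) @ \oo --> (0 : R).
  by rewrite -[X in _ --> X](mulr0 K); apply: cvgM; [exact: cvg_cst|exact: cvg_harmonic].
apply: (squeeze_cvgr _ (cvg_cst 0) cK); apply: nearW => n; rewrite subr0.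
apply/andP; split; first exact: normc_ge0.
rewrite E -lee_fin; apply: le_trans (CI_norm (iyp _ (en n))) _.
have dd : 0 <= 1 + (d ^+ 2)^-1 by rewrite addr_ge0// invr_ge0 sqr_ge0.
have me := measurable_normc (iyp _ (en n)).1.
have m1 := measurable_normc (iyp _ (@ltr01 R)).1.
apply: (@le_trans _ _ (2%:E * ((n.+1%:R^-1 * (1 + (d ^+ 2)^-1))%:E * I1))%E).
  rewrite lee_wpmul2l// -ge0_intZ//; first last.
  - by move=> u; exact: normc_ge0.
  - by rewrite mulr_ge0// ltW.
  apply: ge0_le_int => //.
  - exact: measurable_funM.
  - by move=> u; exact: normc_ge0.
  - move=> u; rewrite !normcM !normc_real !ger0_norm ?poisson_ge0//.
    rewrite [leRHS]mulrCA; have [uT|uT] := pselect (T u).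
      rewrite ler_wpM2l ?normc_ge0//; apply: poisson_tail => //; exact: Td.
    by rewrite /y /abold memNset// normc0 !mul0r.
rewrite -[I1]fineK// -!EFinM lee_fin /K le_eqVlt; apply/orP; left; apply/eqP; ring.
Qed.

End FourierVanish.

(** * Zeros of entire functions on the real line *)

Section EntireZeros.
Context {R : realType}.
Local Notation mu := (@lebesgue_measure R).
Implicit Types (a u : nat -> R) (p q : R -> R) (x r N : R).

Definition psum a x (n : nat) : R := \sum_(k < n) a k * x ^+ k.

Definition psum_abs a r (n : nat) : R := \sum_(k < n) `|a k| * r ^+ k.

(** The bound [N] of the absolute series at radius [r] is part of the data, since its growth has to
    be followed through repeated divisions by [x - x0]. *)
Definition power_series_on r N p a :=
  (forall x, `|x| <= r -> psum a x @ \oo --> p x) /\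
  (forall n, psum_abs a r n <= N).

Lemma abs_cvg u N : (forall n : nat, \sum_(k < n) `|u k| <= N) ->
  cvgn (fun n : nat => \sum_(k < n) u k) /\
  `|limn (fun n : nat => \sum_(k < n) u k)| <= N.
Proof.
move=> uN; have c : cvgn (fun n : nat => \sum_(k < n) u k).
  have : cvgn (series u).
    apply: normed_cvg; apply: nondecreasing_is_cvgn.
      by apply: nondecreasing_series => n _ _; exact: normr_ge0.
    exists N => _ [n _ <-]; have := uN n.
    by rewrite -(big_mkord xpredT (fun k => `|u k|)).
  by rewrite seriesEord.
split => //; rewrite -lim_norm//; apply: limr_le; first exact: is_cvg_norm.
by apply: nearW => n; apply: le_trans (uN n); exact: ler_norm_sum.
Qed.

Lemma psum_abs_le a x r n : `|x| <= r -> \sum_(k < n) `|a k * x ^+ k| <= psum_abs a r n.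
Proof.
move=> xr; apply: ler_sum => k _; rewrite normrM normrX ler_wpM2l//.
by rewrite lerXn2r ?nnegrE// (le_trans _ xr).
Qed.

Lemma power_series_le r N p a x : power_series_on r N p a -> `|x| <= r -> `|p x| <= N.
Proof.
move=> [cp bp] xr; have [_] := @abs_cvg (fun k => a k * x ^+ k) N
  (fun n => le_trans (psum_abs_le a n xr) (bp n)).
by rewrite (cvg_lim _ (cp x xr)).
Qed.

(* Coefficients of the quotient by [x - x0] are the tails [beta k]; they obey *)
(* [beta k = a k + x0 * beta k.+1], which also yields their size.             *)
Lemma power_series_div r N p a x0 : 0 < r -> 2 * `|x0| <= r ->
  power_series_on r N p a -> exists q b,
    power_series_on r (3 * N / r) q b /\
    forall x, `|x| <= r -> p x - p x0 = (x - x0) * q x.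
Proof.
move=> r0 xr [cp bp].
have N0 : 0 <= N by have := bp 0%N; rewrite /psum_abs big_ord0.
have x0r : `|x0| <= r by have := normr_ge0 x0; lra.
have tailN n J : \sum_(i < J) `|a (n + i)%N * x0 ^+ i| <= N / r ^+ n.
  rewrite ler_pdivlMr ?exprn_gt0// mulr_suml; apply: le_trans (bp (n + J)%N).
  rewrite /psum_abs big_split_ord /= -[leLHS]add0r lerD//.
    by apply: sumr_ge0 => i _; rewrite mulr_ge0// exprn_ge0// ltW.
  apply: ler_sum => i _; rewrite normrM -mulrA ler_wpM2l// exprD normrX [leLHS]mulrC.
  have h : `|x0| ^+ i <= r ^+ i by apply: lerXn2r; rewrite ?nnegrE// ltW.
  by apply: ler_wpM2l h; apply: exprn_ge0; exact: ltW.
pose tl n (J : nat) := \sum_(i < J) a (n + i)%N * x0 ^+ i.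
pose beta n := limn (tl n).
have cb n : tl n @ \oo --> beta n.
  by have [] := @abs_cvg (fun i => a (n + i)%N * x0 ^+ i) _ (tailN n).
have bb n : `|beta n| <= N / r ^+ n.
  by have [_] := @abs_cvg (fun i => a (n + i)%N * x0 ^+ i) _ (tailN n).
have rec n : beta n = a n + x0 * beta n.+1.
  have h : (fun J => tl n J.+1) @ \oo --> beta n by rewrite cvg_shiftS.
  have h' : (fun J => a n + x0 * tl n.+1 J) @ \oo --> a n + x0 * beta n.+1.
    by apply: cvgD; [exact: cvg_cst|apply: cvgM => //; exact: cvg_cst].
  have e : (fun J => tl n J.+1) = (fun J => a n + x0 * tl n.+1 J).
    apply/funext => J; rewrite /tl big_ord_recl /= addn0 expr0 mulr1 mulr_sumr.
    congr (_ + _); apply: eq_bigr => i _.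
    by rewrite /bump /= add1n addSnnS exprS; ring.
  rewrite e in h; exact: (cvg_unique _ h h').
have b0 : beta 0%N = p x0.
  have := cp x0 x0r; rewrite (_ : psum a x0 = tl 0%N); first exact: cvg_unique (cb 0%N).
  by apply/funext.
pose b k := beta k.+1.
(* Since [|x0| <= r / 2], the recursion gives S <= N / r + (S + N / r) / 2 for the partial sum S,
   whence S <= 3 N / r. *)
have bsum n : psum_abs b r n <= 3 * N / r.
  have rn k : `|b k| * r ^+ k <= `|a k.+1| * r ^+ k + 2^-1 * (`|b k.+1| * r ^+ k.+1).
    rewrite (_ : _ + _ = (`|a k.+1| + 2^-1 * `|b k.+1| * r) * r ^+ k); last first.
      by rewrite exprS; ring.
    have rk : 0 <= r ^+ k by apply: exprn_ge0; exact: ltW.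
    rewrite /b (rec k.+1); apply: (ler_wpM2r rk).
    apply: le_trans (ler_normD _ _) _; rewrite lerD2l normrM.
    by have := normr_ge0 (beta k.+2); nra.
  have s1 : psum_abs b r n <= \sum_(k < n) (`|a k.+1| * r ^+ k) +
      2^-1 * \sum_(k < n) (`|b k.+1| * r ^+ k.+1).
    by rewrite mulr_sumr -big_split /=; apply: ler_sum => k _; exact: rn.
  have s2 : \sum_(k < n) (`|a k.+1| * r ^+ k) <= N / r.
    rewrite ler_pdivlMr// mulr_suml; apply: le_trans (bp n.+1).
    rewrite /psum_abs big_ord_recl /= -[leLHS]add0r lerD ?mulr_ge0 ?expr0//.
    by apply: ler_sum => k _; rewrite -mulrA -exprSr.
  have s3 : \sum_(k < n) (`|b k.+1| * r ^+ k.+1) <= psum_abs b r n + N / r.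
    have -> : \sum_(k < n) (`|b k.+1| * r ^+ k.+1) = psum_abs b r n.+1 - `|b 0%N|.
      by rewrite /psum_abs big_ord_recl /= expr0 mulr1 addrC addKr.
    have : `|b n| * r ^+ n <= N / r.
      have := bb n.+1; rewrite exprS invfM mulrA -/(b n) => h.
      by rewrite -ler_pdivlMr// exprn_gt0.
    by rewrite {1}/psum_abs big_ord_recr /= -/(psum_abs b r n); have := normr_ge0 (b 0%N); lra.
  have -> : 3 * N / r = 3 * (N / r) by rewrite mulrA.
  by move: s1 s2 s3; move: (psum_abs _ _ _) (\sum_(k < n) _) (\sum_(k < n) _) (N / r) => s t v w; lra.
have cq x : `|x| <= r -> cvgn (psum b x).
  move=> xr'; have [] := @abs_cvg (fun k => b k * x ^+ k) _
    (fun n => le_trans (psum_abs_le b n xr') (bsum n)); by [].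
exists (fun x => limn (psum b x)), b; split; first by split => [x /cq|].
move=> x xr'.
have tele n : (x - x0) * psum b x n = psum a x n + beta n * x ^+ n - beta 0%N.
  elim: n => [|n IH].
    by rewrite /psum !big_ord0 mulr0 expr0 mulr1 add0r subrr.
  rewrite /psum !big_ord_recr /= -!/(psum _ _ _) mulrDr IH (rec n) /b exprS; ring.
have z : (fun n => beta n * x ^+ n) @ \oo --> (0 : R).
  have : psum b x @ \oo --> limn (psum b x) by exact: cq.
  move=> h.
  have h1 : (fun n => psum b x n.+1) @ \oo --> limn (psum b x) by rewrite cvg_shiftS.
  have h2 := cvgB h1 h; rewrite subrr in h2.
  have h3 : (fun n => beta n.+1 * x ^+ n.+1) @ \oo --> (0 : R).
    rewrite (_ : (fun n => _) = (fun n => x * (psum b x n.+1 - psum b x n))).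
      by rewrite -[X in _ --> X](mulr0 x); apply: cvgM; [exact: cvg_cst|exact: h2].
    by apply/funext => n; rewrite /psum big_ord_recr /= addrAC subrr add0r /b exprS; ring.
  by move: h3; rewrite (cvg_shiftS (fun n => beta n * x ^+ n)).
have l1 : (fun n => (x - x0) * psum b x n) @ \oo --> (x - x0) * limn (psum b x).
  by apply: cvgM; [exact: cvg_cst|exact: cq].
have l2 : (fun n => psum a x n + beta n * x ^+ n - beta 0%N) @ \oo --> p x + 0 - p x0.
  rewrite b0; apply: cvgB; last exact: cvg_cst.
  by apply: cvgD => //; exact: cp.
have e : (fun n => (x - x0) * psum b x n) = (fun n => psum a x n + beta n * x ^+ n - beta 0%N).
  by apply/funext.
by rewrite e in l1; rewrite (cvg_unique _ l1 l2) ?addr0.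
Qed.

(** The zeros of [p] other than [x0] are zeros of each quotient, so by continuity the quotient
    vanishes at [x0] as well and can be divided again. Each division multiplies the bound by
    [3 / r]. *)
Lemma power_series_zero_order r N p a x0 : 0 < r -> 4 * `|x0| <= r ->
  power_series_on r N p a -> limit_point [set x | p x = 0] x0 ->
  forall n, exists q b, power_series_on r (N * (3 / r) ^+ n) q b /\
    forall x, `|x| <= r -> p x = (x - x0) ^+ n * q x.
Proof.
move=> r0 xr pa acc; elim=> [|n [q [b [qb pq]]]].
  exists p, a; split; first by rewrite expr0 mulr1.
  by move=> x _; rewrite expr0 mul1r.
have x2 : 2 * `|x0| <= r by have := normr_ge0 x0; lra.
have [q' [b' [qb' qq]]] := power_series_div r0 x2 qb.
have q0 : q x0 = 0.
  apply/eqP; rewrite -normr_le0; apply/ler_addgt0Pl => e e0; rewrite addr0.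
  set K := 3 * (N * (3 / r) ^+ n) / r in qb'.
  have h0 : `|0 : R| <= r by rewrite normr0 ltW.
  have K0 : 0 <= K := le_trans (normr_ge0 _) (power_series_le qb' h0).
  (* The first bound keeps a zero [y] near [x0] inside radius [r]; the second makes
     [|q x0| = |y - x0| * |q' y|] at most [e]. *)
  pose d := Num.min (r / 2) (e / (K + 1)).
  have d0 : 0 < d by rewrite lt_min !divr_gt0//; lra.
  have [y [yx py yd]] := acc _ (nbhsx_ballx x0 d d0).
  rewrite /ball /= distrC lt_min in yd; move/andP: yd => [yd1 yd2].
  have yr : `|y| <= r.
    rewrite -(subrK x0 y); apply: le_trans (ler_normD _ _) _; lra.
  have qy : q y = 0.
    move: py; rewrite /= (pq y yr) => /eqP; rewrite mulf_eq0 expf_eq0 subr_eq0 (negbTE yx) andbF /=.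
    by move/eqP.
  have := qq y yr; rewrite qy sub0r => h.
  rewrite -normrN h normrM.
  apply: (@le_trans _ _ (e / (K + 1) * K)).
    by apply: ler_pM => //; [exact: ltW|exact: power_series_le qb' yr].
  rewrite mulrAC ler_pdivrMr; nra.
exists q', b'; split.
  rewrite (_ : N * (3 / r) ^+ n.+1 = 3 * (N * (3 / r) ^+ n) / r)//.
  by rewrite exprS; ring.
move=> x xr'; rewrite (pq x xr') exprSr -mulrA -qq//.
by rewrite q0 subr0.
Qed.

(** Convergence at [2 * r] bounds the terms there by some [B], so at radius [r] they are at most
    [B / 2 ^+ k]. *)
Lemma entire_abs_bound a r : 0 < r -> (forall x, cvgn (psum a x)) ->
  exists N, forall n, psum_abs a r n <= N.
Proof.
move=> r0 ca.
have h1 : (fun n => psum a (2 * r) n.+1 - psum a (2 * r) n) @ \oo --> (0 : R).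
  rewrite -(subrr (limn (psum a (2 * r)))); apply: cvgB; last exact: ca.
  by rewrite cvg_shiftS; exact: ca.
have [B HB] : exists B, forall k, `|a k| * (2 * r) ^+ k <= B.
  have /cvg_seq_bounded/bounded_fun_has_ubound[B HB] :
      cvgn (fun n => `|psum a (2 * r) n.+1 - psum a (2 * r) n|).
    by apply/cvg_ex; exists `|0 : R|; exact: cvg_norm h1.
  exists B => k; apply: HB; exists k => //.
  by rewrite /psum big_ord_recr /= addrAC subrr add0r normrM normrX [X in _ * X ^+ _]ger0_norm// mulr_ge0// ltW.
have B0 : 0 <= B by apply: le_trans (HB 0%N); rewrite mulr_ge0// exprn_ge0// mulr_ge0// ltW.
exists (2 * B) => n.
have : psum_abs a r n <= B * (2 - 2 / 2 ^+ n).
  elim: n => [|n IH].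
    by rewrite /psum_abs big_ord0 expr0 divr1 subrr mulr0.
  rewrite /psum_abs big_ord_recr /= -/(psum_abs a r n).
  have : `|a n| * r ^+ n <= B / 2 ^+ n.
    by rewrite ler_pdivlMr ?exprn_gt0// -mulrA -exprMn [r * 2]mulrC.
  rewrite exprS invfM; lra.
move/le_trans; apply; rewrite mulrC ler_wpM2r// gerBl.
by rewrite divr_ge0// exprn_ge0.
Qed.

(** The identity theorem by real means: for every [n], [p x] is [(x - x0) ^+ n] times a quotient of
    size at most [N * (3 / r) ^+ n]. With [r] at least 6 |x - x0| this gives |p x| <= N / 2^n. *)
Lemma entire_limit_zeros a p x0 : (forall x, psum a x @ \oo --> p x) ->
  limit_point [set x | p x = 0] x0 -> forall x, p x = 0.
Proof.
move=> cp acc x.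
pose r := 4 * `|x0| + `|x| + 6 * `|x - x0| + 1.
have := normr_ge0 x0; have := normr_ge0 x; have := normr_ge0 (x - x0) => n1 n2 n3.
have r0 : 0 < r by rewrite /r; lra.
have [N HN] := entire_abs_bound r0 (fun x => cvgP _ (cp x)).
have N0 : 0 <= N by have := HN 0%N; rewrite /psum_abs big_ord0.
have pa : power_series_on r N p a by split => // y _.
have xr : 4 * `|x0| <= r by rewrite /r; lra.
have H := power_series_zero_order r0 xr pa acc.
have pn n : `|p x| <= N * 2^-1 ^+ n.
  have [q [b [qb pq]]] := H n.
  have xr' : `|x| <= r by rewrite /r; lra.
  rewrite (pq x xr') normrM normrX.
  apply: (@le_trans _ _ (`|x - x0| ^+ n * (N * (3 / r) ^+ n))).
    by rewrite ler_wpM2l ?exprn_ge0//; exact: power_series_le qb xr'.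
  have h1 : `|x - x0| * (3 / r) <= 2^-1 by rewrite mulrA ler_pdivrMr// /r; lra.
  have h2 : 0 <= `|x - x0| * (3 / r) by rewrite mulr_ge0// divr_ge0// ltW.
  by rewrite mulrCA -exprMn ler_wpM2l// lerXn2r// nnegrE.
apply/eqP; rewrite -normr_le0.
have c0 : (fun n => N * 2^-1 ^+ n) @ \oo --> (0 : R).
  rewrite -[X in _ --> X](mulr0 N); apply: cvgM; first exact: cvg_cst.
  by apply: cvg_expr; rewrite ger0_norm// invf_lt1// ltr1n.
rewrite -(cvg_lim _ c0)//; apply: limr_ge; first exact: cvgP c0.
by apply: nearW.
Qed.

Lemma limit_pointT x : limit_point [set y : R | y != 0] x.
Proof.
move=> U /nbhs_ballP[e /= e0 eU].
have [z z0] : exists z, [/\ z != x, z != 0 & ball x e z]; last by exists z; case: z0 => *; split => //; exact: eU.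
have [E|E] := eqVneq (x + e / 2) 0.
  exists (x + e / 3); split.
  - by rewrite -subr_eq0 addrAC subrr add0r gt_eqF// divr_gt0.
  - by rewrite lt_eqF//; lra.
  - by rewrite /ball /= opprD addrA subrr sub0r normrN gtr0_norm ?divr_gt0//; lra.
exists (x + e / 2); split => //.
- by rewrite -subr_eq0 addrAC subrr add0r gt_eqF// divr_gt0.
- by rewrite /ball /= opprD addrA subrr sub0r normrN gtr0_norm ?divr_gt0//; lra.
Qed.

Lemma psum_at0 a n : psum a 0 n.+1 = a 0%N.
Proof.
rewrite /psum big_ord_recl /= expr0 mulr1 big1 ?addr0// => i _.
by rewrite /bump /= exprS mul0r mulr0.
Qed.

(** The value at 0 is the first coefficient. The shifted series vanishes off 0, hence everywhere by
    [entire_limit_zeros], and induction applies to it. *)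
Lemma entire_coef0 a : (forall x, psum a x @ \oo --> (0 : R)) -> forall n, a n = 0.
Proof.
have at0 a' : psum a' 0 @ \oo --> (0 : R) -> a' 0%N = 0.
  rewrite -cvg_shiftS; under eq_fun do rewrite psum_at0; move=> h.
  by apply/esym; exact: (cvg_unique _ h (cvg_cst _)).
move=> ca n; elim: n a ca => [|n IH] a ca; first exact: at0 (ca 0).
have a0 := at0 _ (ca 0).
pose b k := a k.+1.
have ab x m : psum a x m.+1 = x * psum b x m.
  rewrite /psum big_ord_recl a0 mul0r add0r mulr_sumr; apply: eq_bigr => i _.
  by rewrite /= /bump leq0n add1n exprS /b; ring.
have cb x : x != 0 -> psum b x @ \oo --> (0 : R).
  move=> x0; have := ca x; rewrite -cvg_shiftS => h.
  rewrite (_ : psum b x = fun m => x^-1 * psum a x m.+1); last first.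
    by apply/funext => m; rewrite ab mulrA mulVf// mul1r.
  by rewrite -[X in _ --> X](mulr0 x^-1); apply: cvgM => //; exact: cvg_cst.
have cb0 : cvgn (psum b 0).
  apply/cvg_ex; exists (b 0%N); rewrite -cvg_shiftS.
  by under eq_fun do rewrite psum_at0; exact: cvg_cst.
pose p x := limn (psum b x).
have cp x : psum b x @ \oo --> p x.
  have [->|x0] := eqVneq x 0; first exact: cb0.
  by have := cvgP _ (cb x x0).
have acc : limit_point [set x | p x = 0] 0.
  move=> U /(limit_pointT) [y [y0 y1 Uy]]; exists y; split => //=.
  exact: (cvg_lim _ (cb y y1)).
have p0 := entire_limit_zeros cp acc.
by have := IH b; apply => x; rewrite -(p0 x).
Qed.

Lemma Re_psum (c : nat -> R[i]) (x : R) n :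
  complex.Re (\sum_(k < n) c k * x%:C ^+ k) = psum (fun k => complex.Re (c k)) x n.
Proof.
elim: n => [|n IH]; first by rewrite /psum !big_ord0.
rewrite /psum !big_ord_recr /= -/(psum _ _ _) cReD IH; congr (_ + _).
by rewrite -rmorphXn cReM /= mulr0 subr0.
Qed.

Lemma Im_psum (c : nat -> R[i]) (x : R) n :
  complex.Im (\sum_(k < n) c k * x%:C ^+ k) = psum (fun k => complex.Im (c k)) x n.
Proof.
elim: n => [|n IH]; first by rewrite /psum !big_ord0.
rewrite /psum !big_ord_recr /= -/(psum _ _ _) cImD IH; congr (_ + _).
by rewrite -rmorphXn cImM /= mulr0 add0r mulrC.
Qed.

Lemma normc_cvg_part (proj : R[i] -> R) (z_ : nat -> R[i]) (z : R[i]) :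
  (forall z, `|proj z| <= normc z) -> (forall y z, proj (y - z) = proj y - proj z) ->
  (fun n => normc (z_ n - z)) @ \oo --> (0 : R) -> proj (z_ n) @[n --> \oo] --> proj z.
Proof.
move=> pn pB cv; apply/cvgrPdist_le => e e0.
move/cvgrPdist_le : cv => /(_ e e0); apply: filterS => n; rewrite sub0r normrN.
rewrite ger0_norm ?normc_ge0// => h; apply: le_trans h.
by rewrite distrC -pB.
Qed.

(** If real zeros accumulated at a real point, the real and imaginary parts would vanish on the
    line, all coefficients would be 0 and [G] would vanish everywhere. So each bounded interval
    holds finitely many zeros, and the real zeros are countable. *)
Lemma entire_zeros_null (G : R[i] -> R[i]) : exponential_type G ->
  (exists z, G z <> 0) -> {ae mu, forall l, G l%:C <> 0}.
Proof.
move=> [[c cG] _] [z0 Gz0].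
have cr x : psum (fun k => complex.Re (c k)) x @ \oo --> complex.Re (G x%:C).
  have := @normc_cvg_part (@complex.Re R) _ _ (@normc_Re R) _ (cG x%:C).
  have h y z : complex.Re (y - z) = complex.Re y - complex.Re z :> R by rewrite cReD cReN.
  by move=> /(_ h); under eq_fun do rewrite Re_psum.
have ci x : psum (fun k => complex.Im (c k)) x @ \oo --> complex.Im (G x%:C).
  have := @normc_cvg_part (@complex.Im R) _ _ (@normc_Im R) _ (cG x%:C).
  have h y z : complex.Im (y - z) = complex.Im y - complex.Im z :> R by rewrite cImD cImN.
  by move=> /(_ h); under eq_fun do rewrite Im_psum.
pose Z := [set l : R | G l%:C = 0].
have nolim x0 : ~ limit_point Z x0.
  move=> acc.
  have Ar : limit_point [set x | complex.Re (G x%:C) = 0] x0.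
    by move=> U /acc[y [y1 y2 y3]]; exists y; split => //=; rewrite y2.
  have Ai : limit_point [set x | complex.Im (G x%:C) = 0] x0.
    by move=> U /acc[y [y1 y2 y3]]; exists y; split => //=; rewrite y2.
  have r0 := entire_limit_zeros cr Ar.
  have i0 := entire_limit_zeros ci Ai.
  have cr0 x : psum (fun k => complex.Re (c k)) x @ \oo --> (0 : R) by rewrite -(r0 x).
  have ci0 x : psum (fun k => complex.Im (c k)) x @ \oo --> (0 : R) by rewrite -(i0 x).
  apply: Gz0; have := cG z0; rewrite (_ : (fun n => _) = fun=> normc (- G z0)).
    move=> h; have h2 : 0 = normc (- G z0) := cvg_unique _ h (cvg_cst _).
    by apply: eq0_normc; rewrite -normcN -h2.
  apply/funext => n; rewrite big1 ?sub0r// => k _.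
  rewrite (_ : c k = 0) ?mul0r//; apply: eqcP => /=.
    exact: entire_coef0 cr0 k.
  exact: entire_coef0 ci0 k.
have fin (m : nat) : finite_set (Z `&` `[- m%:R, m%:R]%classic).
  apply: contrapT => inf.
  have bd : bounded_set (Z `&` `[- m%:R, m%:R]%classic).
    exists m%:R; split; first exact: num_real.
    move=> y my x [_] /=; rewrite in_itv /= -ler_norml => /le_trans; apply; exact: ltW.
  have [x0 Hx0] := infinite_bounded_limit_point_nonempty inf bd.
  by apply: (nolim x0) => U /Hx0[y [y1 [y2 _] y3]]; exists y.
have cntZ : countable Z.
  have -> : Z = \bigcup_m (Z `&` `[- m%:R, m%:R]%classic).
    apply/seteqP; split => [x Zx|x [m _ []]//].
    exists (Num.bound `|x|) => //; split => //=; rewrite in_itv /= -ler_norml.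
    by apply: ltW; exact: archi_boundP.
  by apply: bigcup_countable => // m _; exact: finite_set_countable.
exists Z; split.
- exact: countable_measurable.
- exact: countable_lebesgue_measure0.
- by move=> l /= /contrapT.
Qed.

End EntireZeros.

(** * Projection in L_2(f + g) *)

Section WeightedProjection.
Context {R : realType}.
Local Notation mu := (@lebesgue_measure R).
Local Notation L1 := (@in_L1 R setT).
Local Notation CI := (@cint R setT).
Variables (O : set R) (f g : R -> R).
Hypotheses (sf : spectral_density f) (sg : spectral_density g).
Implicit Types (x y h m p u b : R -> R[i]) (t : R) (c : R[i]).

Local Notation w := (fun l => f l + g l).

Definition wnorm2 h : \bar R := (\int[mu]_l (normc (h l) ^+ 2 * (f l + g l))%:E)%E.

Definition in_L2w h := cmeas h /\ (wnorm2 h < +oo)%E.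

(** Only the real part of the inner product of L_2(f + g), which governs norms; testing against a
    multiple by ['i] recovers the imaginary part. *)
Definition wip x y : R := (\int[mu]_l (complex.Re (x l * (y l)^*) * (f l + g l)))%R.

Lemma weight_ge0 l : 0 <= w l.
Proof. by case: sf sg => _ f0 _ [_ g0 _]; exact: addr_ge0. Qed.

Lemma measurable_weight : measurable_fun setT w.
Proof. by case: sf sg => mf _ _ [mg _ _]; exact: measurable_funD. Qed.

Lemma integrable_weight : mu.-integrable setT (EFin \o w).
Proof.
by apply: integrableD_fun; [case: sf|case: sg] => m n i; exact: integrable_ge0.
Qed.

Let mw2 h : cmeas h -> measurable_fun setT (fun l => normc (h l) ^+ 2 * w l).
Proof.
by move=> mh; exact: (measurable_funM (measurable_normc2 mh) measurable_weight).
Qed.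

Let w2_ge0 h l : 0 <= normc (h l) ^+ 2 * w l.
Proof. by apply: mulr_ge0; [exact: sqr_ge0|exact: weight_ge0]. Qed.

Lemma wnorm2_ge0 h : (0 <= wnorm2 h)%E.
Proof. by apply: int_ge0 => l; exact: w2_ge0. Qed.

Lemma integrable_w2 h : in_L2w h ->
  mu.-integrable setT (EFin \o (fun l => normc (h l) ^+ 2 * w l)).
Proof. by move=> [mh ih]; apply: integrable_ge0 => //; exact: mw2. Qed.

Lemma wnorm2_fin h : in_L2w h -> (wnorm2 h \is a fin_num)%E.
Proof. by move=> ih; exact: (integrable_fin_num measurableT (integrable_w2 ih)). Qed.

Lemma wnorm2_le h (r : R) : in_L2w h -> fine (wnorm2 h) <= r -> (wnorm2 h <= r%:E)%E.
Proof. by move=> ih hr; rewrite -(fineK (wnorm2_fin ih)) lee_fin. Qed.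

Lemma L2w_le h (q : R -> R) : cmeas h -> mu.-integrable setT (EFin \o q) ->
  (forall l, normc (h l) ^+ 2 * w l <= q l) -> in_L2w h.
Proof.
move=> mh iq hq; split => //; apply: le_lt_trans (integrable_ltoo (integrable_abse iq) _); last first.
  by move=> l; exact: normr_ge0.
apply: ge0_le_int.
- exact: mw2.
- exact: intg_meas (integrable_abse iq).
- exact: w2_ge0.
- by move=> l; apply: le_trans (hq l) (ler_norm _).
Qed.

Lemma L2wD x y : in_L2w x -> in_L2w y -> in_L2w (fun l => x l + y l).
Proof.
move=> ix iy; apply: (@L2w_le _ (fun l => 2 * (normc (x l) ^+ 2 * w l + normc (y l) ^+ 2 * w l))).
- exact: cmeasD ix.1 iy.1.
- by apply: integrableZ_fun; apply: integrableD_fun; exact: integrable_w2.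
- move=> l; rewrite -mulrDl mulrA; apply: ler_wpM2r; first exact: weight_ge0.
  exact: normc2_addle.
Qed.

Lemma L2wZ c x : in_L2w x -> in_L2w (fun l => c * x l).
Proof.
move=> ix; apply: (@L2w_le _ (fun l => normc c ^+ 2 * (normc (x l) ^+ 2 * w l))).
- exact: cmeasM (cmeas_cst c) ix.1.
- by apply: integrableZ_fun; exact: integrable_w2.
- by move=> l; rewrite normcM exprMn mulrA.
Qed.

Lemma L2wB x y : in_L2w x -> in_L2w y -> in_L2w (fun l => x l - y l).
Proof.
move=> ix iy; have := L2wD ix (L2wZ (-1) iy).
by congr in_L2w; apply/funext => l; rewrite mulN1r.
Qed.

Lemma L2w_bounded x (C : R) : cmeas x -> {ae mu, forall l, normc (x l) <= C} -> in_L2w x.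
Proof.
move=> mx xC; split => //.
have iw := integrableZ_fun (C ^+ 2) integrable_weight.
have C2 l : 0 <= C ^+ 2 * w l by apply: mulr_ge0; [exact: sqr_ge0|exact: weight_ge0].
apply: le_lt_trans (integrable_ltoo iw C2); apply: ae_ge0_le_int => //.
- exact: mw2.
- exact: intg_meas iw.
- apply: (ae_imp xC) => l hl; apply: ler_wpM2r; first exact: weight_ge0.
  by rewrite ler_pXn2r// nnegrE ?normc_ge0// (le_trans (normc_ge0 _) hl).
Qed.

Lemma wnorm2_addle x y : in_L2w x -> in_L2w y ->
  (wnorm2 (fun l => x l + y l)%R <= 2%:E * (wnorm2 x + wnorm2 y))%E.
Proof.
move=> ix iy; have mx := mw2 ix.1; have my := mw2 iy.1.
rewrite /wnorm2 -(ge0_intD mx my (w2_ge0 x) (w2_ge0 y)).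
rewrite -(ge0_intZ (measurable_funD mx my)) //; last first.
  by move=> l; apply: addr_ge0; exact: w2_ge0.
apply: ge0_le_int.
- exact: mw2 (cmeasD ix.1 iy.1).
- exact: (measurable_funM (measurable_cst _) (measurable_funD mx my)).
- exact: (w2_ge0 (fun l => x l + y l)).
- move=> l; rewrite /= -mulrDl mulrA; apply: ler_wpM2r; first exact: weight_ge0.
  exact: normc2_addle.
Qed.

Lemma wnorm2B x y : wnorm2 (fun l => x l - y l) = wnorm2 (fun l => y l - x l).
Proof. by apply: eq_integral => l _; rewrite normcB. Qed.

Lemma L1_wip x y : in_L2w x -> in_L2w y -> L1 (fun l => x l * (y l)^* * (w l)%:C).
Proof.
move=> ix iy.
apply: (@L1_le _ _ (fun l => normc (x l) ^+ 2 * w l + normc (y l) ^+ 2 * w l)).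
- apply: cmeasM (cmeas_real measurable_weight).
  exact: cmeasM ix.1 (cmeasJ iy.1).
- by apply: integrableD_fun; exact: integrable_w2.
- apply: ae_all => l; rewrite !normcM normc_conj normc_real (ger0_norm (weight_ge0 l)).
  rewrite -mulrDl; apply: ler_wpM2r; first exact: weight_ge0.
  have := normc_ge0 (x l); have := normc_ge0 (y l).
  by move: (normc _) (normc _) => a b'; nra.
Qed.

Lemma wipE x y : wip x y = complex.Re (CI (fun l => x l * (y l)^* * (w l)%:C)).
Proof.
rewrite /wip /=; apply: eq_Rintegral => l _.
by rewrite [in RHS]cReM /= mulr0 subr0.
Qed.

Lemma integrable_wip x y : in_L2w x -> in_L2w y ->
  mu.-integrable setT (EFin \o (fun l => complex.Re (x l * (y l)^*) * w l)).
Proof.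
move=> ix iy; have := L1_Re (L1_wip ix iy).
by congr (mu.-integrable _ (EFin \o _)); apply/funext => l; rewrite [LHS]cReM /= mulr0 subr0.
Qed.

Lemma fine_wnorm2D x y (t : R) : in_L2w x -> in_L2w y ->
  fine (wnorm2 (fun l => x l + t%:C * y l)) =
  fine (wnorm2 x) + 2 * t * wip x y + t ^+ 2 * fine (wnorm2 y).
Proof.
move=> ix iy; have i1 := integrable_w2 ix; have i2 := integrable_w2 iy.
have i3 := integrable_wip ix iy.
rewrite /wnorm2 -/(Rintegral _ _ _) -/(Rintegral _ _ _) -/(Rintegral _ _ _) /wip.
rewrite -(RintegralZl _ measurableT i3) -(RintegralZl _ measurableT i2).
have j3 := integrableZ_fun (2 * t) i3; have j2 := integrableZ_fun (t ^+ 2) i2.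
rewrite -(RintegralD measurableT i1 j3) -(RintegralD measurableT (integrableD_fun i1 j3) j2).
apply: eq_Rintegral => l _; rewrite !normc2E !ReImE /=; ring.
Qed.

(** Weighted AM-GM inequality; the free weight [d] does the work of Cauchy-Schwarz. *)
Lemma wip_le x y (d : R) : 0 < d -> in_L2w x -> in_L2w y ->
  `|wip x y| <= d * fine (wnorm2 x) + d^-1 * fine (wnorm2 y).
Proof.
move=> d0 ix iy; have i3 := integrable_wip ix iy.
have i1 := integrable_w2 ix; have i2 := integrable_w2 iy.
have di : 0 < d^-1 by rewrite invr_gt0.
apply: le_trans (le_normr_Rintegral measurableT i3) _.
rewrite /wnorm2 -/(Rintegral _ _ _) -/(Rintegral _ _ _).
rewrite -(RintegralZl _ measurableT i1) -(RintegralZl _ measurableT i2).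
have j1 := integrableZ_fun d i1; have j2 := integrableZ_fun (d^-1) i2.
rewrite -(RintegralD measurableT j1 j2); apply: le_Rintegral => //.
- exact: integrable_abse i3.
- exact: integrableD_fun j1 j2.
- move=> l _; rewrite normrM (ger0_norm (weight_ge0 l)) (mulrA d) (mulrA d^-1) -mulrDl.
  apply: ler_wpM2r; first exact: weight_ge0.
  apply: le_trans (normc_Re _) _; rewrite normcM normc_conj.
  have := normc_ge0 (x l); have := normc_ge0 (y l).
  move: (normc (x l)) (normc (y l)) => a b' a0 b0.
  rewrite -(ler_pM2l d0).
  have -> : d * (d * a ^+ 2 + d^-1 * b' ^+ 2) = (d * a) ^+ 2 + b' ^+ 2.
    by field; rewrite gt_eqF.
  have := sqr_ge0 (d * a - b'); have : 0 <= d * a * b' by rewrite !mulr_ge0// ltW.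
  nra.
Qed.

Lemma fine_wnorm2D_le x y (t : R) : 0 < t -> in_L2w x -> in_L2w y ->
  fine (wnorm2 (fun l => x l + y l)) <=
  (1 + 2 * t) * fine (wnorm2 x) + (1 + 2 * t^-1) * fine (wnorm2 y).
Proof.
move=> t0 ix iy; have := fine_wnorm2D 1 ix iy.
have -> : (fun l => x l + 1%:C * y l) = (fun l => x l + y l).
  by apply/funext => l; rewrite mul1r.
move=> ->; have := wip_le t0 ix iy; have := ler_norm (wip x y).
by rewrite expr1n mulr1 mul1r; lra.
Qed.

Lemma trig_polyD p q : trig_poly O p -> trig_poly O q -> trig_poly O (fun l => p l + q l).
Proof.
move=> [n [c [s [Os ps]]]] [n' [c' [s' [Os' ps']]]].
exists (n + n')%N, (fun i : 'I_(n + n') => match fintype.split i with inl j => c j | inr j => c' j end),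
  (fun i : 'I_(n + n') => match fintype.split i with inl j => s j | inr j => s' j end); split.
  by move=> k; case: (fintype.split k).
move=> l; rewrite ps ps' big_split_ord /=; congr (_ + _); apply: eq_bigr => i _.
  by case: splitP => [j /= ij|k /= ik]; [rewrite (_ : j = i)//; exact: val_inj|have := ltn_ord i; rewrite ik ltnNge leq_addr].
case: splitP => [j /= ij|k /= /addnI ik]; last by rewrite (_ : k = i)//; exact: val_inj.
by have := ltn_ord j; rewrite -ij ltnNge leq_addr.
Qed.

Lemma trig_polyZ c p : trig_poly O p -> trig_poly O (fun l => c * p l).
Proof.
move=> [n [c' [s [Os ps]]]]; exists n, (fun k => c * c' k), s; split => // l.
by rewrite ps mulr_sumr; apply: eq_bigr => i _; rewrite mulrA.
Qed.

Lemma trig_poly_expi t : O t -> trig_poly O (fun l => expi (t * l)).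
Proof.
move=> Ot; exists 1%N, (fun=> 1), (fun=> t); split => // l.
by rewrite big_ord1 mul1r.
Qed.

Lemma cmeas_trig_poly p : trig_poly O p -> cmeas p.
Proof.
move=> [n [c [s [_ ps]]]]; rewrite (_ : p = fun l => \sum_(k < n) c k * expi (s k * l)).
  apply: cmeas_sum => k; apply: cmeasM; first exact: cmeas_cst.
  by apply: cmeas_expi; exact: measurable_funM.
by apply/funext.
Qed.

Lemma L2w_trig_poly p : trig_poly O p -> in_L2w p.
Proof.
move=> tp; have [n [c [s [_ ps]]]] := tp.
apply: (@L2w_bounded _ (\sum_(k < n) normc (c k))); first exact: cmeas_trig_poly.
apply: ae_all => l; rewrite ps.
elim: n c s {ps} => [|n IH] c s; first by rewrite !big_ord0 normc0.
rewrite !big_ord_recr /=; apply: le_trans (normc_triangle _ _) _.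
by rewrite normcM normc_expi mulr1; apply: lerD.
Qed.

Local Notation M := (L2s O f g).

Lemma L2s_L2w h : M h -> in_L2w h.
Proof. by move=> [mh ih _]; split. Qed.

Lemma L2s_trig_poly p : trig_poly O p -> M p.
Proof.
move=> tp; have [mp ip] := L2w_trig_poly tp; split => // e e0; exists p => //.
under eq_integral do rewrite subrr normc0 expr0n /= mul0r.
by rewrite integral0 lte_fin.
Qed.

Lemma L2s_closed h : in_L2w h ->
  (forall e : R, 0 < e -> exists2 m, M m & (wnorm2 (fun l => h l - m l)%R <= e%:E)%E) -> M h.
Proof.
move=> [mh ih] ap; split => // e e0.
have e5 : 0 < e / 5 by rewrite divr_gt0.
have [m Mm hm] := ap _ e5.
have [_ _ /(_ _ e5)[p tp mp]] := Mm.
exists p => //.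
have i1 := L2wB (conj mh ih) (L2s_L2w Mm).
have i2 := L2wB (L2s_L2w Mm) (L2w_trig_poly tp).
have -> : (fun l => (normc (h l - p l) ^+ 2 * (f l + g l))%:E) =
    (fun l => (normc ((h l - m l) + (m l - p l)) ^+ 2 * (f l + g l))%:E).
  by apply/funext => l; rewrite subrKA.
apply: le_lt_trans (wnorm2_addle i1 i2) _.
apply: (@le_lt_trans _ _ (2%:E * ((e / 5)%:E + (e / 5)%:E))%E).
  by apply: lee_wpmul2l => //; apply: leeD => //; exact: ltW.
rewrite -EFinD -EFinM lte_fin; lra.
Qed.

Lemma L2sD x y : M x -> M y -> M (fun l => x l + y l).
Proof.
move=> Mx My; apply: L2s_closed; first by apply: L2wD; exact: L2s_L2w.
move=> e e0; have e4 : 0 < e / 4 by rewrite divr_gt0.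
have [_ _ /(_ _ e4)[p tp xp]] := Mx; have [_ _ /(_ _ e4)[q tq yq]] := My.
exists (fun l => p l + q l); first exact/L2s_trig_poly/trig_polyD.
have i1 := L2wB (L2s_L2w Mx) (L2w_trig_poly tp).
have i2 := L2wB (L2s_L2w My) (L2w_trig_poly tq).
rewrite (_ : (fun l => _) = (fun l => (x l - p l) + (y l - q l))); last first.
  by apply/funext => l; ring.
apply: le_trans (wnorm2_addle i1 i2) _.
apply: (@le_trans _ _ (2%:E * ((e / 4)%:E + (e / 4)%:E))%E).
  by apply: lee_wpmul2l => //; apply: leeD; exact: ltW.
rewrite -EFinD -EFinM lee_fin; lra.
Qed.

Lemma wnorm2Z c x : in_L2w x -> wnorm2 (fun l => c * x l) = ((normc c ^+ 2)%:E * wnorm2 x)%E.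
Proof.
move=> ix; rewrite /wnorm2 -(ge0_intZ (mw2 ix.1)) ?sqr_ge0//.
by apply: eq_integral => l _; rewrite normcM exprMn -mulrA.
Qed.

Lemma L2sZ c x : M x -> M (fun l => c * x l).
Proof.
move=> Mx; apply: L2s_closed; first by apply: L2wZ; exact: L2s_L2w.
move=> e e0; have c0 := sqr_ge0 (normc c).
have e1 : 0 < e / (normc c ^+ 2 + 1) by rewrite divr_gt0//; lra.
have [_ _ /(_ _ e1)[p tp xp]] := Mx.
exists (fun l => c * p l); first exact/L2s_trig_poly/trig_polyZ.
have i1 := L2wB (L2s_L2w Mx) (L2w_trig_poly tp).
rewrite (_ : (fun l => _) = (fun l => c * (x l - p l))); last first.
  by apply/funext => l; ring.
rewrite wnorm2Z//; apply: (@le_trans _ _ ((normc c ^+ 2)%:E * (e / (normc c ^+ 2 + 1))%:E)%E).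
  by apply: lee_wpmul2l; [rewrite lee_fin|exact: ltW].
rewrite -EFinM lee_fin mulrA ler_pdivrMr; nra.
Qed.

Lemma L2s0 : M (fun=> 0).
Proof.
apply: L2s_trig_poly; exists 0%N, (fun=> 0), (fun=> 0).
by split => [[]//|l]; rewrite big_ord0.
Qed.

Lemma L2sB x y : M x -> M y -> M (fun l => x l - y l).
Proof.
move=> Mx My; have := L2sD Mx (L2sZ (-1) My).
by congr M; apply/funext => l; rewrite mulN1r.
Qed.

(** The projection theorem: a minimizing sequence is Cauchy by the parallelogram law, and its limit
    stays in the closed subspace. *)
Lemma L2s_projection b : in_L2w b -> exists2 p, M p &
  forall m, M m -> (wnorm2 (fun l => b l - p l)%R <= wnorm2 (fun l => b l - m l)%R)%E.
Proof.
move=> ib.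
pose D := [set fine (wnorm2 (fun l => b l - m l)%R) | m in M].
have Dlb : has_lbound D.
  by exists 0 => _ [m _ <-]; apply/fine_ge0/wnorm2_ge0.
have D0 : D !=set0 by exists (fine (wnorm2 (fun l => b l - 0)%R)), (fun=> 0) => //; exact: L2s0.
pose d := inf D.
have iB m : M m -> in_L2w (fun l => b l - m l) by move=> /L2s_L2w; exact: L2wB.
have dle m : M m -> d <= fine (wnorm2 (fun l => b l - m l)%R).
  by move=> Mm; apply: ge_inf => //; exists m.
have /choice[m_ Hm] n : exists m, M m /\
    fine (wnorm2 (fun l => b l - m l)%R) <= d + n.+1%:R^-1.
  have n0 : 0 < n.+1%:R^-1 :> R by [].
  have [_ [m Mm <-] lt] := inf_adherent n0 (conj D0 Dlb).
  by exists m; split => //; exact: ltW.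
have Mm n := (Hm n).1; have le n := (Hm n).2.
have cau n k : (n <= k)%N ->
    (wnorm2 (fun l => m_ n l - m_ k l)%R <= (4 * n.+1%:R^-1)%:E)%E.
  move=> nk.
  have in_ := iB _ (Mm n); have ik := iB _ (Mm k).
  have i1 : in_L2w (fun l => m_ n l - m_ k l) by apply: L2s_L2w; exact: L2sB.
  (* The midpoint is again a competitor, so its squared distance to [b] is at least [d]; the
     parallelogram law then bounds the distance of [m_ n] and [m_ k]. *)
  pose a l := 2^-1%:C * (m_ n l + m_ k l).
  have Ma : M a by apply: L2sZ; exact: L2sD.
  have ia := iB _ Ma.
  have E : fine (wnorm2 (fun l => m_ n l - m_ k l)) =
      2 * fine (wnorm2 (fun l => b l - m_ n l)) + 2 * fine (wnorm2 (fun l => b l - m_ k l)) -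
      4 * fine (wnorm2 (fun l => b l - a l)).
    have j1 := integrable_w2 in_; have j2 := integrable_w2 ik; have j3 := integrable_w2 ia.
    rewrite /wnorm2 -!/(Rintegral _ _ _).
    rewrite -(RintegralZl _ measurableT j1) -(RintegralZl _ measurableT j2) -(RintegralZl _ measurableT j3).
    have z1 := integrableZ_fun 2 j1; have z2 := integrableZ_fun 2 j2; have z3 := integrableZ_fun 4 j3.
    rewrite -(RintegralD measurableT z1 z2) -(RintegralB measurableT (integrableD_fun z1 z2) z3).
    apply: eq_Rintegral => l _; rewrite !normc2E !ReImE /=.
    move: (m_ n l) (m_ k l) (b l) => [p1 p2] [q1 q2] [b1 b2] /=; by field.
  apply: (wnorm2_le i1); rewrite E.
  have := le n; have := le k; have := dle _ Ma.
  have : k.+1%:R^-1 <= n.+1%:R^-1 :> R by rewrite lef_pV2 ?posrE// ler_nat.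
  move: (k.+1%:R^-1 : R) (n.+1%:R^-1 : R) => rk rn.
  move: (fine (wnorm2 (fun l => b l - m_ n l))) (fine (wnorm2 (fun l => b l - m_ k l))) => p1 p2.
  lra.
have c0 : (fun n : nat => 4 * n.+1%:R^-1) @ \oo --> (0 : R).
  by rewrite -[X in _ --> X](mulr0 4); apply: cvgM; [exact: cvg_cst|exact: cvg_harmonic].
have [h mh hc] := L2w_complete measurable_weight weight_ge0 (fun n => (L2s_L2w (Mm n)).1) cau c0.
have ih : in_L2w h.
  have i0 : in_L2w (fun l => m_ 0%N l - h l).
    split; first exact: cmeasB (L2s_L2w (Mm 0%N)).1 mh.
    by apply: le_lt_trans (hc 0%N) _; rewrite ltry.
  have := L2wB (L2s_L2w (Mm 0%N)) i0.
  by congr in_L2w; apply/funext => l; rewrite opprB addrC subrK.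
have Mh : M h.
  apply: L2s_closed => // e e0.
  move/cvgrPdist_le : c0 => /(_ _ e0)[n _ /(_ n (leqnn n))]; rewrite /= sub0r normrN => ne.
  exists (m_ n) => //; rewrite wnorm2B; apply: le_trans (hc n) _.
  by rewrite lee_fin; exact: le_trans (ler_norm _) ne.
exists h => // m Mm'.
have d0 : 0 <= d by apply: lb_le_inf => // _ [k _ <-]; apply/fine_ge0/wnorm2_ge0.
apply: (@le_trans _ _ (fine (wnorm2 (fun l => b l - m l)))%:E); last first.
  by rewrite fineK//; exact: wnorm2_fin (iB _ Mm').
apply: wnorm2_le (iB _ Mh) _; apply: le_trans (dle _ Mm').
(* The weight [t] in [fine_wnorm2D_le] stays fixed while [n] tends to infinity; afterwards [t] is
   made small. *)
have key (t : R) : 0 < t -> fine (wnorm2 (fun l => b l - h l)) <= (1 + 2 * t) * d.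
  move=> t0; pose B (n : nat) := (1 + 2 * t) * (d + n.+1%:R^-1) + (1 + 2 * t^-1) * (4 * n.+1%:R^-1).
  have cB : B @ \oo --> (1 + 2 * t) * d.
    have -> : (1 + 2 * t) * d = (1 + 2 * t) * (d + 0) + (1 + 2 * t^-1) * (4 * 0) by ring.
    by apply: cvgD; apply: cvgM; (try exact: cvg_cst);
      [apply: cvgD; [exact: cvg_cst|exact: cvg_harmonic]|
       apply: cvgM; [exact: cvg_cst|exact: cvg_harmonic]].
  rewrite -(cvg_lim _ cB)//; apply: limr_ge; first exact: cvgP cB.
  apply: nearW => n.
  have i1 := iB _ (Mm n); have i2 := L2wB (L2s_L2w (Mm n)) ih.
  have -> : (fun l => b l - h l) = (fun l => (b l - m_ n l) + (m_ n l - h l)).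
    by apply/funext => l; rewrite subrKA.
  apply: le_trans (fine_wnorm2D_le t0 i1 i2) _.
  have ti : 0 < t^-1 by rewrite invr_gt0.
  have hn : fine (wnorm2 (fun l => m_ n l - h l)) <= 4 * n.+1%:R^-1.
    by rewrite -lee_fin fineK; [exact: hc|exact: wnorm2_fin].
  by apply: lerD; (apply: ler_wpM2l; first lra).
apply/ler_addgt0Pl => e e0.
have t0 : 0 < e / (2 * (d + 1)) by apply: divr_gt0 => //; lra.
apply: le_trans (key _ t0) _; set s := e / _.
have : 2 * s * d <= e.
  have -> : 2 * s * d = e * d / (d + 1) by rewrite /s; field; rewrite gt_eqF//; lra.
  by rewrite ler_pdivrMr; nra.
lra.
Qed.

Lemma wip_orthogonal u m : in_L2w u -> in_L2w m ->
  (forall t : R, (wnorm2 u <= wnorm2 (fun l => u l + t%:C * m l)%R)%E) -> wip u m = 0.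
Proof.
move=> iu im min.
have q (t : R) : 0 <= 2 * t * wip u m + t ^+ 2 * fine (wnorm2 m).
  have itm : in_L2w (fun l => u l + t%:C * m l) by apply: L2wD => //; exact: L2wZ.
  have := min t; rewrite -(fineK (wnorm2_fin iu)) -(fineK (wnorm2_fin itm)) lee_fin.
  by rewrite fine_wnorm2D//; lra.
set W := wip u m in q *; set N := fine _ in q.
have N0 : 0 <= N by apply/fine_ge0/wnorm2_ge0.
apply/eqP/negPn/negP => W0.
have W2 : 0 < W ^+ 2 by rewrite exprn_even_gt0.
have N1 : 0 < N + 1 by lra.
(* A value of [t] at which the quadratic is negative unless [W = 0]; the [+ 1] covers [N = 0]. *)
have := q (- W / (N + 1)).
have -> : 2 * (- W / (N + 1)) * W + (- W / (N + 1)) ^+ 2 * N = - W ^+ 2 * (N + 2) / (N + 1) ^+ 2.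
  by field; rewrite gt_eqF.
apply/negP; rewrite -ltNge ltr_pdivrMr ?exprn_gt0// mul0r; nra.
Qed.

Lemma L2s_orthogonal b p m : in_L2w b -> M p ->
  (forall m, M m -> (wnorm2 (fun l => b l - p l)%R <= wnorm2 (fun l => b l - m l)%R)%E) ->
  M m -> CI (fun l => (b l - p l) * (m l)^* * (w l)%:C) = 0.
Proof.
move=> ib Mp min Mm; have iu := L2wB ib (L2s_L2w Mp).
have orth m' : M m' -> wip (fun l => b l - p l) m' = 0.
  move=> Mm'; apply: wip_orthogonal => // [|t]; first exact: L2s_L2w.
  have := min _ (L2sB Mp (L2sZ t%:C Mm')).
  congr (_ <= _)%E; congr wnorm2; apply/funext => l; ring.
apply: eqcP; rewrite -?wipE; first exact: orth.
(* Orthogonality to ['i * m] is the vanishing of the imaginary part. *)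
have := orth _ (L2sZ 'i%C Mm); rewrite /wip /= => <-; apply: eq_Rintegral => l _.
by move: (b l) (p l) (m l) => [? ?] [? ?] [? ?] /=; ring.
Qed.

(** Orthogonality to the exponentials extends to trigonometric polynomials by linearity and to their
    closure by [wip_le]. *)
Lemma wip_L2s0 u : in_L2w u ->
  (forall t, O t -> CI (fun l => u l * expi (- t * l) * (w l)%:C) = 0) ->
  forall m, M m -> wip u m = 0.
Proof.
move=> iu orth m Mm.
have tp0 p : trig_poly O p -> wip u p = 0.
  move=> tp; have [n [c [s [Os ps]]]] := tp.
  rewrite wipE (_ : CI _ = 0)//.
  have {tp}-> : p = fun l => \sum_(k < n) c k * expi (s k * l) by apply/funext.
  elim: n c s Os {ps} => [|n IH] c s Os.
    rewrite (_ : (fun l => _) = fun=> 0 * 0); last first.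
      by apply/funext => l; rewrite big_ord0 rmorph0 !(mulr0, mul0r).
    rewrite CIZ ?mul0r//; apply: L1_real.
    by have := integrable0 mu setT.
  have i1 : in_L2w (fun l => \sum_(k < n) c (widen_ord (leqnSn n) k) * expi (s (widen_ord (leqnSn n) k) * l)).
    apply: L2w_trig_poly; exists n, (c \o widen_ord (leqnSn n)), (s \o widen_ord (leqnSn n)).
    by split => [k|//]; exact: Os.
  have i2 : in_L2w (fun l => expi (s ord_max * l)).
    by apply: L2w_trig_poly; exact: trig_poly_expi.
  have j1 := L1_wip iu i1; have j2 := L1_wip iu i2.
  rewrite (_ : (fun l => _) = fun l =>
     u l * (\sum_(k < n) c (widen_ord (leqnSn n) k) * expi (s (widen_ord (leqnSn n) k) * l))^* * (w l)%:C
     + (c ord_max)^* * (u l * (expi (s ord_max * l))^* * (w l)%:C)); last first.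
    apply/funext => l; rewrite big_ord_recr /= rmorphD rmorphM; ring.
  rewrite CID//; last exact: L1Z.
  rewrite CIZ// IH// add0r.
  rewrite (_ : (fun l => _) = (fun l => u l * expi (- s ord_max * l) * (w l)%:C)).
    by rewrite orth ?mulr0.
  by apply/funext => l; rewrite mulNr expiN.
have im := L2s_L2w Mm.
apply/eqP; rewrite -normr_le0; apply/ler_addgt0Pl => e e0; rewrite addr0.
pose S := fine (wnorm2 u).
have S0 : 0 <= S by apply/fine_ge0/wnorm2_ge0.
pose d := e / (2 * (S + 1)).
have d0 : 0 < d by apply: divr_gt0 => //; lra.
have [_ _ /(_ (d * e / 2))] := Mm; have de : 0 < d * e / 2 by nra.
move=> /(_ de)[p tp mp].
have ip := L2w_trig_poly tp; have imp := L2wB im ip.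
have -> : wip u m = wip u (fun l => m l - p l).
  rewrite -[LHS]subr0 -(tp0 _ tp) /wip -RintegralB//; try exact: integrable_wip.
  by apply: eq_Rintegral => l _; rewrite !ReImE; ring.
apply: le_trans (wip_le d0 iu imp) _.
have h1 : d * S <= e / 2.
  rewrite /d mulrAC ler_pdivrMr; last lra.
  nra.
have h2 : d^-1 * fine (wnorm2 (fun l => m l - p l)) <= e / 2.
  rewrite mulrC ler_pdivrMr//; have : fine (wnorm2 (fun l => m l - p l)) <= d * e / 2.
    by rewrite -lee_fin fineK; [exact: ltW|exact: wnorm2_fin].
  lra.
by rewrite -/S; lra.
Qed.

(** Pythagoras' theorem: the residual [b - h] is orthogonal to [h - m]. *)
Lemma L2s_minimal b h : in_L2w b -> M h ->
  (forall t, O t -> CI (fun l => (b l - h l) * expi (- t * l) * (w l)%:C) = 0) ->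
  forall m, M m -> (wnorm2 (fun l => b l - h l)%R <= wnorm2 (fun l => b l - m l)%R)%E.
Proof.
move=> ib Mh orth m Mm; have iu := L2wB ib (L2s_L2w Mh).
have iv := L2s_L2w (L2sB Mh Mm).
have im := L2wB ib (L2s_L2w Mm).
apply: (@le_trans _ _ (fine (wnorm2 (fun l => b l - m l)))%:E); last first.
  by rewrite fineK//; exact: wnorm2_fin.
apply: wnorm2_le => //.
have -> : (fun l => b l - m l) = (fun l => (b l - h l) + 1%:C * (h l - m l)).
  by apply/funext => l; rewrite mul1r subrKA.
rewrite (fine_wnorm2D 1 iu iv) (wip_L2s0 iu orth (L2sB Mh Mm)) mulr0 addr0 expr1n mul1r lerDl.
exact/fine_ge0/wnorm2_ge0.
Qed.

End WeightedProjection.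

(** * Positivity of f + g *)

Section ObservationSets.
Context {R : realType}.
Variables (s : nat) (N K : nat -> R).

Lemma Oset_setC : Oset s N K = ~` Tset s N K.
Proof.
by rewrite /Tset setCU setIC; congr (_ `&` _); rewrite setCitvr.
Qed.

Lemma closed_Tset : closed (Tset s N K).
Proof.
apply: closedU; last exact: interval_closed.
apply: closed_bigcup => [|l _]; last exact: interval_closed.
by apply: (@sub_finite_set _ _ `I_s.+1) => // l /andP[].
Qed.

Lemma Oset_dist t : Oset s N K t ->
  exists2 d : R, 0 < d & forall u, Tset s N K u -> d <= `|u - t|.
Proof.
rewrite Oset_setC => Ot.
have /(_ t Ot) : open (~` Tset s N K) by rewrite openC; exact: closed_Tset.
rewrite -nbhs_ballE => -[d /= d0 sub]; exists d => // u Tu; rewrite leNgt; apply/negP => ut.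
by apply: (sub u) => //; rewrite /ball /= distrC.
Qed.

Lemma Rset_Tset : Rset s N K `<=` Tset s N K.
Proof. by move=> t [t0 _]; right. Qed.

End ObservationSets.

Section Positivity.
Context {R : realType}.
Local Notation mu := (@lebesgue_measure R).

Lemma measurable_inv (u : R -> R) : measurable_fun setT u ->
  measurable_fun setT (fun l => (u l)^-1).
Proof.
move=> mu_.
(* Reduces inversion to a real power of a nonnegative function; at 0 both sides are 0. *)
have -> : (fun l => (u l)^-1) = (fun l => u l * (u l ^+ 2) `^ (- 1)).
  apply/funext => l; rewrite powR_inv1 ?sqr_ge0//.
  by have [->|u0] := eqVneq (u l) 0; [rewrite invr0 mul0r|field].
apply: measurable_funM => //.
exact: (measurableT_comp (measurable_powR (- 1)) (measurable_funX 2 mu_)).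
Qed.

Lemma measurable_ediv (u v : R -> R) : measurable_fun setT u -> measurable_fun setT v ->
  measurable_fun setT (fun l => (u l)%:E / (v l)%:E)%E.
Proof.
move=> mu_ mv; apply: emeasurable_funM; first exact/measurable_EFinP.
under eq_fun do rewrite inver.
apply: measurable_fun_ifT; last first.
- by apply/measurable_EFinP; exact: measurable_inv.
- exact: measurable_cst.
- by apply: measurable_fun_eqr.
Qed.

Lemma ediv_fin (x y : R) : y != 0 -> (x%:E / y%:E)%E = (x / y)%:E.
Proof. by move=> y0; rewrite inver (negbTE y0) EFinM. Qed.

Lemma ediv_ge0 (x y : R) : 0 <= x -> 0 <= y -> (0 <= x%:E / y%:E)%E.
Proof. by move=> x0 y0; apply: mule_ge0; rewrite ?inve_ge0 lee_fin. Qed.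

Lemma cmeas_exponential_type (G : R[i] -> R[i]) : exponential_type G ->
  cmeas (fun l : R => G l%:C).
Proof.
move=> [[c cG] _].
have mp n : cmeas (fun l : R => \sum_(k < n) c k * l%:C ^+ k).
  apply: cmeas_sum => k; apply: cmeasM; first exact: cmeas_cst.
  elim: (k : nat) => [|m IH]; first exact: cmeas_cst.
  by under eq_fun do rewrite exprS; apply: cmeasM => //; apply: cmeas_real.
split.
- apply: (measurable_fun_cvg (fun n => (mp n).1)) => l _ /=.
  exact: (normc_cvg_part (@normc_Re R) (fun y z => etrans (cReD _ _) (congr1 _ (cReN _)))).
- apply: (measurable_fun_cvg (fun n => (mp n).2)) => l _ /=.
  exact: (normc_cvg_part (@normc_Im R) (fun y z => etrans (cImD _ _) (congr1 _ (cImN _)))).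
Qed.

(* The extended quotient in [minimality] is [+oo] where [f + g] vanishes and  *)
(* the entire function does not.                                              *)
Lemma minimality_gt0 (f g : R -> R) : spectral_density f -> spectral_density g ->
  minimality f g -> {ae mu, forall l, 0 < f l + g l}.
Proof.
move=> sf sg [al [gam [_ _ eg g0 ig]]].
have w0 := weight_ge0 sf sg.
have mq := measurable_ediv (measurable_normc2 (cmeas_exponential_type eg)) (measurable_weight sf sg).
have iq : mu.-integrable setT (fun l => (normc (gam l%:C) ^+ 2)%:E / (f l + g l)%:E)%E.
  apply/integrableP; split => //.
  under eq_integral do rewrite gee0_abs ?ediv_ge0 ?sqr_ge0//.
  exact: ig.
have aeq := integrable_ae measurableT iq.
apply: (ae_imp2 aeq (entire_zeros_null eg g0)) => l /(_ I) fq gl.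
rewrite lt0r w0 andbT; apply/negP => /eqP wl; move: fq; rewrite wl inver eqxx.
rewrite muleC gt0_mulye// lte_fin exprn_gt0// lt0r normc_ge0 andbT.
by apply/negP => /eqP /eq0_normc.
Qed.

(** Where [f + g] is positive, hence almost everywhere, the extended quotient in [domB] is the
    ordinary one. *)
Lemma domB_L2 (T : set R) (f g : R -> R) x : measurable T ->
  spectral_density f -> spectral_density g ->
  {ae mu, forall l, 0 < f l + g l} -> domB T f g x ->
  in_L2 setT (fun l => ((f l + g l)^-1)%:C * fourier 1 T x l).
Proof.
move=> mT sf sg wpos [xL2 ix].
have mw := measurable_weight sf sg.
have mF : cmeas (fourier 1 T x) by case: (L2_fourier mT (expr1n _ 2) xL2).
have mi : cmeas (fun l => ((f l + g l)^-1)%:C * fourier 1 T x l).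
  by apply: cmeasM => //; apply: cmeas_real; exact: measurable_inv mw.
split => //; apply: le_lt_trans ix; rewrite le_eqVlt; apply/orP; left; apply/eqP.
apply: (ae_eq_integral _ _ measurableT).
- by apply/measurable_EFinP; exact: measurable_normc2.
- apply: measurable_ediv; first exact: measurable_normc2.
  exact: (measurable_funX 2 mw).
- apply: (ae_imp wpos) => l wl _.
  rewrite ediv_fin ?expf_neq0 ?gt_eqF// normcM exprMn normc_real.
  by rewrite real_normK ?num_real// exprVn mulrC.
Qed.

End Positivity.

(** * Mean-square errors *)

Section Prediction.
Context {R : realType}.
Local Notation mu := (@lebesgue_measure R).
Local Notation L1 := (@in_L1 R setT).
Local Notation L2 := (@in_L2 R setT).
Local Notation CI := (@cint R setT).
Variables (f g : R -> R).
Hypotheses (sf : spectral_density f) (sg : spectral_density g).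
Implicit Types (T O : set R) (h m : R -> R[i]).

Local Notation w := (fun l => f l + g l).

Lemma wip_wnorm2 u : wip f g u u = fine (wnorm2 f g u).
Proof.
rewrite /wip /wnorm2 -/(Rintegral _ _ _); apply: eq_Rintegral => l _.
by rewrite normc2E !ReImE; ring.
Qed.

(** Let [p] be the projection of [h = G2 - G1] and v = conj(h - p)(f + g). Orthogonality of [h - p]
    to the exponentials off [T] says that the moments of [v] vanish there, so [h] annihilates [v] by
    [spectral_orthogonal]; so does [p], as an element of the subspace. The difference of the two
    pairings is the squared norm of [h - p]. *)
Lemma L2s_fourier T G1 G2 (C : R) : 0 <= C -> L2 G1 -> L2 G2 ->
  {ae mu, forall l, normc (G1 l) <= C} -> {ae mu, forall l, normc (G2 l) <= C} ->
  ae_eq_on T (fourier (-1) setT G1) (fourier (-1) setT G2) ->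
  L2s (~` T) f g (fun l => G2 l - G1 l).
Proof.
move=> C0 L1' L2' b1 b2 eqT; set h := (fun l => _).
have mh : cmeas h by apply: cmeasB; [exact: L2'.1|exact: L1'.1].
have ih : in_L2w f g h.
  apply: (L2w_bounded sf sg (C := C + C)) => //.
  apply: (ae_imp2 b1 b2) => l h1 h2; apply: le_trans (normc_triangle _ _) _.
  by rewrite normcN lerD.
have [p Mp minp] := L2s_projection (~` T) sf sg ih.
have ip := L2s_L2w Mp; have iu := L2wB sf sg ih ip.
(* Pairing the constant 1 with [h - p] shows that [v] is integrable. *)
have i1 : in_L2w f g (fun=> 1).
  by apply: (L2w_bounded sf sg (C := 1)); [exact: cmeas_cst|apply: ae_all => l; rewrite normc1].
have orth m : L2s (~` T) f g m -> CI (fun l => (h l - p l) * (m l)^* * (w l)%:C) = 0.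
  exact: L2s_orthogonal.
pose v l := (h l - p l)^* * (w l)%:C.
have Lv : L1 v.
  have := L1_wip sf sg i1 iu; congr L1.
  by apply/funext => l; rewrite mul1r.
have vorth t : ~ T t -> CI (fun l => v l * expi (t * l)) = 0.
  move=> Tt; have tp := trig_poly_expi (O := ~` T) Tt.
  have := orth _ (L2s_trig_poly sf sg tp) => /(congr1 conjc).
  rewrite CIJ; last by apply: (L1_wip sf sg iu); exact: L2w_trig_poly tp.
  rewrite rmorph0 => <-; congr cint; apply/funext => l.
  by rewrite /v; apply: eqcP; rewrite !ReImE /=; ring.
have Chv := spectral_orthogonal C0 L1' L2' b1 b2 eqT Lv vorth.
have Cpv : CI (fun l => p l * v l) = 0.
  have := orth _ Mp => /(congr1 conjc).
  rewrite CIJ; last exact: (L1_wip sf sg iu).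
  rewrite rmorph0 => <-; congr cint; apply/funext => l.
  by rewrite /v; apply: eqcP; rewrite !ReImE /=; ring.
have Lhv : L1 (fun l => h l * v l).
  by have := L1_wip sf sg ih iu; congr L1; apply/funext => l; rewrite mulrA.
have Lpv : L1 (fun l => p l * v l).
  by have := L1_wip sf sg ip iu; congr L1; apply/funext => l; rewrite mulrA.
have u0 : fine (wnorm2 f g (fun l => h l - p l)) = 0.
  rewrite -wip_wnorm2 wipE (_ : CI _ = 0)//.
  have := CIB Lhv Lpv; rewrite Chv Cpv subr0 => <-; congr cint; apply/funext => l.
  by rewrite /v mulrBl mulrBl !mulrA.
apply: (L2s_closed sf sg ih) => e e0; exists p => //.
by apply: wnorm2_le => //; rewrite u0 ltW.
Qed.

Variables (Rs : set R) (a : R -> R[i]).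
Local Notation A := (Achar Rs a).
Variable CA : R.
Hypotheses (mA : cmeas A) (A_le : forall l, normc (A l) <= CA).

Local Notation b := (fun l => (f l / (f l + g l))%:C * A l).

(** Where [f + g] vanishes so do [f] and [g], and the quotient is 0 by convention; the identities
    thus hold at every point. *)
Lemma ratio_spec l : exists r : R,
  [/\ f l / (f l + g l) = r, 0 <= r <= 1, f l = r * (f l + g l) & g l = (1 - r) * (f l + g l)].
Proof.
have f0 : 0 <= f l by case: sf.
have g0 : 0 <= g l by case: sg.
exists (f l / (f l + g l)); have [w0|w0] := eqVneq (f l + g l) 0.
  have fl : f l = 0 by lra.
  have gl : g l = 0 by lra.
  by rewrite w0 fl gl !mul0r mulr0; split => //; rewrite lexx ler01.
have wp : 0 < f l + g l by rewrite lt0r w0 addr_ge0.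
split => //; last 2 first.
- by rewrite divfK.
- by rewrite mulrBl mul1r divfK// addrC addKr.
by rewrite divr_ge0 ?addr_ge0//= ler_pdivrMr// mul1r lerDl.
Qed.

Lemma ratio_le1 l : `|f l / (f l + g l)| <= 1.
Proof. by have [r [-> /andP[r0 r1] _ _]] := ratio_spec l; rewrite ger0_norm. Qed.

Lemma measurable_ratio : measurable_fun setT (fun l => f l / (f l + g l)).
Proof.
apply: measurable_funM; first by case: sf.
exact: measurable_inv (measurable_weight sf sg).
Qed.

Lemma in_L2w_target : in_L2w f g b.
Proof.
apply: (L2w_bounded sf sg (C := CA)).
  by apply: cmeasM => //; apply: cmeas_real; exact: measurable_ratio.
apply: ae_all => l; rewrite normcM normc_real; apply: le_trans (A_le l).
by rewrite ler_piMl ?normc_ge0// ratio_le1.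
Qed.

Definition Delta_rest : \bar R :=
  (\int[mu]_l (normc (A l) ^+ 2 * ((f l / (f l + g l)) * g l))%:E)%E.

(** Completing the square pointwise: |A - h|^2 f + |h|^2 g = |b - h|^2 (f + g) + |A|^2 f g / (f +
    g). Minimizing the error becomes a projection problem for [b]. *)
Lemma Delta_wnorm2 h : cmeas h ->
  Delta Rs a h f g =
  (((2 * pi)^-1)%:E * (wnorm2 f g (fun l => b l - h l)%R + Delta_rest))%E.
Proof.
move=> mh; have c0 : 0 <= (2 * pi)^-1 :> R by rewrite invr_ge0 mulr_ge0// pi_ge0.
have f0 l : 0 <= f l by case: sf.
have g0 l : 0 <= g l by case: sg.
have mf : measurable_fun setT f by case: sf.
have mg : measurable_fun setT g by case: sg.
have m1 : measurable_fun setT (fun l => normc (A l - h l) ^+ 2 * f l).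
  by apply: measurable_funM => //; apply: measurable_normc2; exact: cmeasB.
have m2 : measurable_fun setT (fun l => normc (h l) ^+ 2 * g l).
  by apply: measurable_funM => //; exact: measurable_normc2.
have m3 : measurable_fun setT (fun l => normc (b l - h l) ^+ 2 * (f l + g l)).
  apply: measurable_funM; last exact: measurable_funD.
  by apply: measurable_normc2; apply: cmeasB => //; case: in_L2w_target.
have m4 : measurable_fun setT (fun l => normc (A l) ^+ 2 * ((f l / (f l + g l)) * g l)).
  apply: measurable_funM; first exact: measurable_normc2.
  by apply: measurable_funM => //; exact: measurable_ratio.
have p1 l : 0 <= normc (A l - h l) ^+ 2 * f l by rewrite mulr_ge0 ?sqr_ge0.
have p2 l : 0 <= normc (h l) ^+ 2 * g l by rewrite mulr_ge0 ?sqr_ge0.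
have p3 l : 0 <= normc (b l - h l) ^+ 2 * (f l + g l) by rewrite mulr_ge0 ?sqr_ge0 ?addr_ge0.
have p4 l : 0 <= normc (A l) ^+ 2 * ((f l / (f l + g l)) * g l).
  by rewrite mulr_ge0 ?sqr_ge0// mulr_ge0// divr_ge0// addr_ge0.
rewrite /Delta -ge0_muleDr; [|exact: int_ge0|exact: int_ge0].
rewrite /wnorm2 /Delta_rest -(ge0_intD m1 m2 p1 p2) -(ge0_intD m3 m4 p3 p4).
congr (_ * _)%E; apply: eq_integral => l _; congr EFin.
have [r [-> _ fr gr]] := ratio_spec l.
rewrite [X in _ * X + _ = _]fr [X in _ + _ * X = _]gr [X in _ = _ + _ * (_ * X)]gr.
rewrite !normc2E !ReImE /=.
by move: (f l + g l) (A l) (h l) => W [x1 x2] [y1 y2] /=; ring.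
Qed.

Lemma optimal_char_min O h : L2s O f g h ->
  (forall m, L2s O f g m ->
     wnorm2 f g (fun l => b l - h l)%R <= wnorm2 f g (fun l => b l - m l)%R)%E ->
  optimal_char O Rs a f g h.
Proof.
move=> Mh min; split => // m Mm.
rewrite !Delta_wnorm2; [|by case: Mm|by case: Mh].
apply: lee_wpmul2l; first by rewrite lee_fin invr_ge0 mulr_ge0// pi_ge0.
by apply: leeD => //; exact: min.
Qed.

(** The projection of [b] is an optimal characteristic, so the choice in [mse] never falls back on
    its default. *)
Lemma mse_le O h : L2s O f g h -> (mse O Rs a f g <= Delta Rs a h f g)%E.
Proof.
move=> Mh; rewrite /mse; case: xgetP => [h' _ [_]|no]; first exact.
have [p Mp minp] := L2s_projection O sf sg in_L2w_target.
by case: (no p); exact: optimal_char_min.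
Qed.

Lemma mse_optimal O h : optimal_char O Rs a f g h ->
  mse O Rs a f g = Delta Rs a h f g.
Proof.
move=> oh; apply/eqP; rewrite eq_le mse_le; last by case: oh.
rewrite /mse; case: xgetP => [h' _ [Mh' _]|no]; last by case: (no h).
by case: oh => _ ->.
Qed.

Lemma optimal_char_orthogonal O h C : L2s O f g h ->
  cmeas C -> {ae mu, forall l, (b l - h l) * (f l + g l)%:C = C l} ->
  (forall t, O t -> CI (fun l => C l * expi (- t * l)) = 0) ->
  optimal_char O Rs a f g h.
Proof.
move=> Mh mC eC orth; apply: optimal_char_min => //.
apply: L2s_minimal => //; first exact: in_L2w_target.
move=> t Ot; rewrite -(orth _ Ot).
have me : cmeas (fun l : R => expi (- t * l)) by apply: cmeas_expi; exact: measurable_funM.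
apply: CI_ae.
- apply: cmeasM; last by apply: cmeas_real; exact: measurable_weight.
  apply: cmeasM => //; apply: cmeasB; first by case: in_L2w_target.
  by case: Mh.
- exact: cmeasM.
- by apply: (ae_imp eC) => l <-; ring.
Qed.

End Prediction.

(** * Lagrange conditions for the L_1 and L_2 balls *)

Section Saddle.
Context {R : realType}.
Local Notation mu := (@lebesgue_measure R).

(** Integrates a pointwise inequality and cancels the penalty terms; finiteness of the integral of
    [e1] allows this even when those of [p1] and [p2] are infinite. *)
Lemma int_le_cancel (p1 p2 e1 e2 : R -> R) :
  measurable_fun setT p1 -> measurable_fun setT p2 ->
  measurable_fun setT e1 -> measurable_fun setT e2 ->
  (forall l, 0 <= p1 l) -> (forall l, 0 <= p2 l) ->
  (forall l, 0 <= e1 l) -> (forall l, 0 <= e2 l) ->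
  {ae mu, forall l, p1 l + e1 l <= p2 l + e2 l} ->
  (\int[mu]_l (e2 l)%:E <= \int[mu]_l (e1 l)%:E)%E ->
  (\int[mu]_l (e1 l)%:E < +oo)%E ->
  (\int[mu]_l (p1 l)%:E <= \int[mu]_l (p2 l)%:E)%E.
Proof.
move=> m1 m2 n1 n2 p10 p20 e10 e20 le12 lee fin.
have fe1 : (\int[mu]_l (e1 l)%:E)%E \is a fin_num by rewrite ge0_fin_numE//; exact: int_ge0.
rewrite -(leeD2rE _ _ fe1) -(ge0_intD m1 n1)//.
apply: (@le_trans _ _ (\int[mu]_l (p2 l + e2 l)%:E)%E).
  apply: ae_ge0_le_int => //.
  - exact: measurable_funD.
  - exact: measurable_funD.
  - by move=> l; exact: addr_ge0.
  - by move=> l; exact: addr_ge0.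
by rewrite (ge0_intD m2 n2)//; exact: leeD2l.
Qed.

(** Always q <= c^2, and where f0 differs from f1 the sign condition gives f0 > f1 and q = c^2,
    unless c = 0. Hence q (f - f0) <= c^2 (|f - f1| - |f0 - f1|) pointwise. *)
Lemma int_le_L1_ball (q Psi f f0 f1 : R -> R) (c : R) :
  measurable_fun setT q -> (forall l, 0 <= q l) ->
  spectral_density f -> spectral_density f0 -> spectral_density f1 -> 0 <= c ->
  {ae mu, forall l, `|Psi l| <= 1} ->
  {ae mu, forall l, f0 l <> f1 l -> Psi l = Num.sg (f0 l - f1 l)} ->
  {ae mu, forall l, 0 <= Psi l * c /\ q l = (Psi l * c) ^+ 2} ->
  (\int[mu]_l `|f l - f1 l|%:E <= \int[mu]_l `|f0 l - f1 l|%:E)%E ->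
  (\int[mu]_l `|f0 l - f1 l|%:E < +oo)%E ->
  (\int[mu]_l (q l * f l)%:E <= \int[mu]_l (q l * f0 l)%:E)%E.
Proof.
move=> mq q0 [mf pf _] [mf0 pf0 _] [mf1 pf1 _] c0 P1 P2 P3 lee fin.
have c2 : 0 <= c ^+ 2 by exact: sqr_ge0.
have md1 : measurable_fun setT (fun l => `|f l - f1 l|).
  by apply: measurableT_comp => //; exact: measurable_funB.
have md0 : measurable_fun setT (fun l => `|f0 l - f1 l|).
  by apply: measurableT_comp => //; exact: measurable_funB.
apply: (@int_le_cancel _ _ (fun l => c ^+ 2 * `|f0 l - f1 l|) (fun l => c ^+ 2 * `|f l - f1 l|)).
- exact: measurable_funM.
- exact: measurable_funM.
- exact: measurable_funM.
- exact: measurable_funM.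
- by move=> l; exact: mulr_ge0.
- by move=> l; exact: mulr_ge0.
- by move=> l; exact: mulr_ge0.
- by move=> l; exact: mulr_ge0.
- apply: (ae_imp2 P1 (ae_imp2 P2 P3 (fun l x y => conj x y))) => l h1 [h2 [h3 ->]].
  have E0 : (Psi l * c) ^+ 2 * (f0 l - f1 l) = c ^+ 2 * `|f0 l - f1 l|.
    (* Where [f0] and [f1] differ, [0 <= Psi * c] forces [f1 < f0] or [c = 0]. *)
    have [->|/eqP ne] := eqVneq (f0 l) (f1 l); first by rewrite subrr normr0 !mulr0.
    have [->|cn] := eqVneq c 0; first by rewrite mulr0 expr0n /= !mul0r.
    have cp : 0 < c by rewrite lt0r cn.
    move: h3; rewrite (h2 ne) (pmulr_lge0 _ cp) sgr_ge0 => d0.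
    rewrite (ger0_norm d0) gtr0_sg ?mul1r// lt0r d0 andbT subr_eq0.
    exact/eqP.
  have E1 : (Psi l * c) ^+ 2 * (f l - f1 l) <= c ^+ 2 * `|f l - f1 l|.
    apply: (@le_trans _ _ ((Psi l * c) ^+ 2 * `|f l - f1 l|)).
      by apply: ler_wpM2l; [exact: sqr_ge0|exact: ler_norm].
    apply: ler_wpM2r => //; rewrite exprMn; apply: ler_piMl => //.
    by rewrite -real_normK ?num_real// expr_le1.
  have -> : (Psi l * c) ^+ 2 * f l = (Psi l * c) ^+ 2 * (f l - f1 l) + (Psi l * c) ^+ 2 * f1 l by ring.
  have -> : (Psi l * c) ^+ 2 * f0 l = (Psi l * c) ^+ 2 * (f0 l - f1 l) + (Psi l * c) ^+ 2 * f1 l by ring.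
  lra.
- by rewrite !ge0_intZ//; apply: lee_wpmul2l.
- by rewrite ge0_intZ//; apply: lte_mul_pinfty.
Qed.

(** With q = c (g0 - g1), one has q (g - g0) = (c / 2) ((g - g1)^2 - (g0 - g1)^2 - (g - g0)^2),
    which explains the multiplier [c / 2]. *)
Lemma int_le_L2_ball (q g g0 g1 : R -> R) (c : R) :
  measurable_fun setT q -> (forall l, 0 <= q l) ->
  spectral_density g -> spectral_density g0 -> spectral_density g1 -> 0 <= c ->
  {ae mu, forall l, q l = (g0 l - g1 l) * c} ->
  (\int[mu]_l (`|g l - g1 l| ^+ 2)%:E <= \int[mu]_l (`|g0 l - g1 l| ^+ 2)%:E)%E ->
  (\int[mu]_l (`|g0 l - g1 l| ^+ 2)%:E < +oo)%E ->
  (\int[mu]_l (q l * g l)%:E <= \int[mu]_l (q l * g0 l)%:E)%E.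
Proof.
move=> mq q0 [mg pg _] [mg0 pg0 _] [mg1 pg1 _] c0 P lee fin.
have c2 : 0 <= c / 2 by exact: divr_ge0.
have md1 : measurable_fun setT (fun l => `|g l - g1 l| ^+ 2).
  by apply: measurable_funX; apply: measurableT_comp => //; exact: measurable_funB.
have md0 : measurable_fun setT (fun l => `|g0 l - g1 l| ^+ 2).
  by apply: measurable_funX; apply: measurableT_comp => //; exact: measurable_funB.
apply: (@int_le_cancel _ _ (fun l => c / 2 * `|g0 l - g1 l| ^+ 2) (fun l => c / 2 * `|g l - g1 l| ^+ 2)).
- exact: measurable_funM.
- exact: measurable_funM.
- exact: measurable_funM.
- exact: measurable_funM.
- by move=> l; exact: mulr_ge0.
- by move=> l; exact: mulr_ge0.
- by move=> l; apply: mulr_ge0 => //; exact: sqr_ge0.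
- by move=> l; apply: mulr_ge0 => //; exact: sqr_ge0.
- apply: (ae_imp P) => l ->; rewrite !real_normK ?num_real//.
  rewrite -subr_ge0; have := mulr_ge0 c2 (sqr_ge0 (g l - g0 l)).
  by congr (_ <= _); field.
- have s1 l : 0 <= `|g l - g1 l| ^+ 2 by exact: sqr_ge0.
  have s0 l : 0 <= `|g0 l - g1 l| ^+ 2 by exact: sqr_ge0.
  by rewrite (ge0_intZ md1 c2 s1) (ge0_intZ md0 c2 s0); apply: lee_wpmul2l.
- have s0 l : 0 <= `|g0 l - g1 l| ^+ 2 by exact: sqr_ge0.
  by rewrite (ge0_intZ md0 c2 s0); apply: lte_mul_pinfty.
Qed.

End Saddle.

(** * The saddle point *)

Section Functional.
Context {R : realType}.
Local Notation mu := (@lebesgue_measure R).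
Local Notation L1 := (@in_L1 R setT).
Local Notation L2 := (@in_L2 R setT).
Variables (Rs T : set R) (a : R -> R[i]).
Hypotheses (mRs : measurable Rs) (mT : measurable T) (RsT : Rs `<=` T).
Hypotheses (a1 : in_L1 Rs a) (a2 : in_L2 T (abold Rs a)).

Lemma Achar_FT : Achar Rs a = FT (-1) (abold Rs a).
Proof.
apply/funext => l; rewrite /Achar cint_abold abold_mul /FT; congr cint.
by apply/funext => u; rewrite mulN1r.
Qed.

Lemma abold_Tset : abold T (abold Rs a) = abold Rs a.
Proof. by rewrite abold_abold setIidr. Qed.

Lemma L1_functional : L1 (abold Rs a).
Proof. exact: ((in_L1_abold _ mRs).1 a1). Qed.

Lemma fourier_Achar : fourier (-1) T (abold Rs a) = Achar Rs a.
Proof.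
rewrite fourier_L1//; first by rewrite abold_Tset Achar_FT.
by apply/in_L1_abold => //; rewrite abold_Tset; exact: L1_functional.
Qed.

Lemma L2_Achar : L2 (Achar Rs a).
Proof.
rewrite Achar_FT; apply: L2_FT; first by rewrite sqrrN expr1n.
  exact: L1_functional.
by move/(in_L2_abold _ mT): a2; rewrite abold_Tset.
Qed.

Lemma Achar_le : exists C, forall l, normc (Achar Rs a l) <= C.
Proof. by rewrite Achar_FT; eexists => l; exact: FT_le L1_functional. Qed.

End Functional.

Lemma two_piV_gt0 (R : realType) : 0 < (2 * pi)^-1 :> R.
Proof. by rewrite invr_gt0 mulr_gt0// pi_gt0. Qed.

Lemma opB_opR_fourier (R : realType) (T : set R) (f g : R -> R) x y :
  ae_eq_on T (opB T f g x) (opR T f g y) ->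
  ae_eq_on T (fourier (-1) setT (fun l => ((f l + g l)^-1)%:C * fourier 1 T x l))
    (fourier (-1) setT (fun l => (f l / (f l + g l))%:C * fourier (-1) T y l)).
Proof.
have c0 : ((2 * pi)^-1)%:C != 0 :> R[i].
  by rewrite real_complex_eq0 gt_eqF// two_piV_gt0.
by move=> H; apply: (ae_imp H) => t Ht /Ht; exact: mulfI.
Qed.

Theorem theorem4p1 (R : realType) (s : nat) (N K : nat -> R)
  (a : R -> R[i]) (f1 g1 f0 g0 : R -> R) (eps1 eps2 : R)
  (alpha1 alpha2 : R) (Psi : R -> R)
  (mu := @lebesgue_measure R)
  (T := Tset s N K) (Ob := Oset s N K) (Rs := Rset s N K)
  (av := abold Rs a) (A := Achar Rs a)
  (C0 := Cchar T f0 g0 av)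
  (D := D1 f1 eps1 `*` D2 g1 eps2)
  (h0 := fun l => (A l * (f0 l)%:C - C0 l) / (f0 l + g0 l)%:C) :
  (1 <= s)%N ->
  N 0%N = 0 -> K 0%N = 0 ->
  (forall l, (1 <= l <= s)%N -> 0 <= N l /\ 0 <= K l) ->
  in_L1 Rs a ->
  in_L2 T av ->
  (\int[mu]_(t in Rs) (t * normc (a t) ^+ 2)%:E < +oo)%E ->
  spectral_density f1 -> spectral_density g1 ->
  (exists C, forall l, f1 l <= C) -> (exists C, forall l, g1 l <= C) ->
  D1 f1 eps1 f0 -> D2 g1 eps2 g0 ->
  minimality f0 g0 ->
  B_invertible_at T f0 g0 (opR T f0 g0 av) ->
  ae_bounded (fun l => normc (A l * (g0 l)%:C + C0 l) ^+ 2
                         / (f0 l + g0 l) ^+ 2) ->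
  ae_bounded (fun l => normc (A l * (f0 l)%:C - C0 l) ^+ 2
                         / (f0 l + g0 l) ^+ 2) ->
  0 <= alpha1 -> 0 <= alpha2 ->
  {ae mu, forall l, `|Psi l| <= 1} ->
  {ae mu, forall l, f0 l <> f1 l -> Psi l = Num.sg (f0 l - f1 l)} ->
  {ae mu, forall l, normc (A l * (g0 l)%:C + C0 l)
                      = (f0 l + g0 l) * Psi l * alpha1} ->
  {ae mu, forall l, normc (A l * (f0 l)%:C - C0 l) ^+ 2
                      = (f0 l + g0 l) ^+ 2 * (g0 l - g1 l) * alpha2} ->
  (((2 * pi)^-1)%:E * \int[mu]_l `|f0 l - f1 l|%:E = eps1%:E)%E ->
  (((2 * pi)^-1)%:E * \int[mu]_l (`|g0 l - g1 l| ^+ 2)%:E = eps2%:E)%E ->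
  (forall f g, D (f, g) -> B_invertible_at T f g (opR T f g av) ->
     objective T f g av <= objective T f0 g0 av) ->
  [/\ least_favorable Ob Rs a D f0 g0,
      optimal_char Ob Rs a f0 g0 h0 &
      minimax_robust Ob Rs a D h0].
Proof.
move=> _ _ _ _ a1 a2 _ sf1 sg1 _ _ D1f0 D2g0 mini Binv _ [Ch bh] al1 al2 Psi1 Psis eA eH ep1 ep2 _.
have [sf0 le1] := D1f0; have [sg0 le2] := D2g0.
have c0 := two_piV_gt0 R.
have mRs : measurable Rs.
  apply: measurableD; first exact: measurable_itv.
  by apply: bigcup_measurable => l _; exact: measurable_itv.
have mT : measurable T by apply: closed_measurable; exact: closed_Tset.
have RsT : Rs `<=` T by exact: Rset_Tset.
have A2 := L2_Achar mRs mT RsT a1 a2; rewrite -/A in A2.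
have mA : cmeas A by case: A2.
have [CA A_le] := Achar_le mRs a1; rewrite -/A in A_le.
have wpos := minimality_gt0 sf0 sg0 mini.
(* Invertibility at R a provides a preimage, so [x] is a genuine solution of B x = R a on [T]. *)
pose x := invB T f0 g0 (opR T f0 g0 av).
have [domx eqx] : domB T f0 g0 x /\ ae_eq_on T (opB T f0 g0 x) (opR T f0 g0 av).
  by rewrite /x /invB; case: Binv => _ [y dy ey]; case: xgetP => [z -> //|/(_ y)[]].
(* The two terms of [h0]; B x = R a says that their transforms agree on [T]. *)
pose G1 l := ((f0 l + g0 l)^-1)%:C * C0 l.
pose G2 l := (f0 l / (f0 l + g0 l))%:C * A l.
have LG1 : in_L2 setT G1 by exact: domB_L2 domx.
have mr : cmeas (fun l => (f0 l / (f0 l + g0 l))%:C).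
  by apply: cmeas_real; exact: measurable_ratio.
have r1 l : normc (f0 l / (f0 l + g0 l))%:C <= 1 by rewrite normc_real; exact: ratio_le1.
have LG2 : in_L2 setT G2 by apply: (L2_bounded (C := 1) A2 mr); apply: ae_all.
have eG : ae_eq_on T (fourier (-1) setT G1) (fourier (-1) setT G2).
  have := opB_opR_fourier eqx; rewrite (_ : fourier (-1) T av = A)//.
  exact: fourier_Achar.
have h0E : h0 = fun l => G2 l - G1 l.
  apply/funext => l; rewrite /h0 /G1 /G2 -RealM_C RealV_C; ring.
have mh0 : cmeas h0 by rewrite h0E; apply: cmeasB; [case: LG2|case: LG1].
have mC0 : cmeas C0 by case: (L2_fourier mT (expr1n _ 2) domx.1).
have nh0 l : normc (h0 l) ^+ 2 = normc (A l * (f0 l)%:C - C0 l) ^+ 2 / (f0 l + g0 l) ^+ 2.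
  rewrite /h0 RealV_C normcM normc_real exprMn real_normK ?num_real//.
  by rewrite exprVn.
(* A bound for [|h0|] free of square roots: t <= t^2 + 1/4, t^2 <= Ch and Ch <= Ch^2 + 1/4. *)
pose B := 1 + Ch ^+ 2.
have B0 : 0 <= B by rewrite addr_ge0// sqr_ge0.
have h0B : {ae mu, forall l, normc (h0 l) <= B}.
  apply: (ae_imp bh) => l hl; have := le_trans (ler_norm _) hl.
  rewrite -nh0 /B.
  have := sqr_ge0 (normc (h0 l) - 2^-1); have := sqr_ge0 (Ch - 2^-1); lra.
have G2B l : normc (G2 l) <= CA.
  rewrite /G2 normcM; apply: le_trans (A_le l).
  by rewrite ler_piMl ?normc_ge0// r1.
have CA0 : 0 <= CA := le_trans (normc_ge0 _) (A_le 0).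
have G1B : {ae mu, forall l, normc (G1 l) <= CA + B}.
  apply: (ae_imp h0B) => l hl.
  have -> : G1 l = G2 l - h0 l by rewrite h0E opprB addrCA subrr addr0.
  by apply: le_trans (normc_triangle _ _) _; rewrite normcN lerD.
have G2B' : {ae mu, forall l, normc (G2 l) <= CA + B}.
  by apply: ae_all => l; apply: le_trans (G2B l) _; rewrite lerDl.
have h0L2s f g : spectral_density f -> spectral_density g -> L2s Ob f g h0.
  move=> sf sg; rewrite h0E /Ob Oset_setC.
  exact: (L2s_fourier sf sg (addr_ge0 CA0 B0) LG1 LG2 G1B G2B' eG).
(* [C0] is the bounded function [G1] times the integrable weight. *)
have C0L1 : in_L1 setT C0.
  have i0 : mu.-integrable setT (EFin \o (fun l => (CA + B) * (f0 l + g0 l))).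
    exact: integrableZ_fun (integrable_weight sf0 sg0).
  apply: (L1_le mC0 i0); apply: (ae_imp2 wpos G1B) => l wl; rewrite /G1 normcM normc_real.
  rewrite ger0_norm; last by rewrite invr_ge0 ltW.
  by rewrite mulrC ler_pdivrMr.
have orth t : Ob t -> cint setT (fun l => C0 l * expi (- t * l)) = 0.
  move=> Ot; have [d d0 dist] := Oset_dist Ot.
  exact: fourier_vanish dist domx.1 C0L1.
have opt : optimal_char Ob Rs a f0 g0 h0.
  apply: (optimal_char_orthogonal sf0 sg0 mA A_le (h0L2s _ _ sf0 sg0) mC0 _ orth).
  apply: (ae_imp wpos) => l wl; rewrite h0E /G2 /G1 opprB addrCA subrr addr0.
  by rewrite mulrAC RealM_C mulVf ?mul1r// gt_eqF.
have saddle f g : D (f, g) -> (Delta Rs a h0 f g <= Delta Rs a h0 f0 g0)%E.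
  move=> [[/= sf d1] [/= sg d2]]; rewrite /Delta.
  have P1 : {ae mu, forall l, 0 <= Psi l * alpha1 /\
      normc (A l - h0 l) ^+ 2 = (Psi l * alpha1) ^+ 2}.
    apply: (ae_imp2 wpos eA) => l wl el.
    have -> : normc (A l - h0 l) = Psi l * alpha1.
      have wn : (f0 l + g0 l)%:C != 0 by rewrite real_complex_eq0 gt_eqF.
      have -> : A l - h0 l = (A l * (g0 l)%:C + C0 l) / (f0 l + g0 l)%:C.
        apply: (mulIf wn); rewrite mulrBl !divfK// rmorphD; ring.
      rewrite normcM RealV_C normc_real ger0_norm; last by rewrite invr_ge0 ltW.
      by rewrite el; field; rewrite gt_eqF.
    split => //; rewrite -(pmulr_rge0 _ wl) mulrA -el; exact: normc_ge0.
  have P2 : {ae mu, forall l, normc (h0 l) ^+ 2 = (g0 l - g1 l) * alpha2}.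
    apply: (ae_imp2 wpos eH) => l wl el; rewrite nh0 el; field.
    by rewrite gt_eqF.
  have fin (i : \bar R) (e : R) : (0 <= i)%E -> (((2 * pi)^-1)%:E * i = e%:E)%E -> (i < +oo)%E.
    by move: i => [r|//|//]; rewrite ?ltry// => _; rewrite gt0_muley.
  apply: leeD; apply: lee_wpmul2l; rewrite ?lee_fin ?(ltW c0)//.
  - apply: (int_le_L1_ball (Psi := Psi) (f1 := f1) (c := alpha1)) => //.
    + by apply: measurable_normc2; exact: cmeasB.
    + by move=> l; exact: sqr_ge0.
    + by rewrite -(lee_pmul2l _ (x := ((2 * pi)^-1)%:E))// ep1.
    + by apply: fin ep1; apply: int_ge0.
  - apply: (int_le_L2_ball (g1 := g1) (c := alpha2)) => //.
    + exact: measurable_normc2.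
    + by move=> l; exact: sqr_ge0.
    + by rewrite -(lee_pmul2l _ (x := ((2 * pi)^-1)%:E))// ep2.
    + by apply: fin ep2; apply: int_ge0 => l; exact: sqr_ge0.
have D0 : D (f0, g0) by split.
have worst : worst_error Rs a D h0 = Delta Rs a h0 f0 g0.
  apply/eqP; rewrite eq_le; apply/andP; split.
    by apply: ge_ereal_sup => _ [[f g] Dfg <-]; exact: saddle.
  by apply: ereal_sup_ubound; exists (f0, g0).
split => //.
(* Delta(f, g) <= Delta(h0; f, g) <= Delta(h0; f0, g0) = Delta(f0, g0). *)
- split => // f g Dfg; rewrite (mse_optimal sf0 sg0 mA A_le opt).
  have [[/= sf _] [/= sg _]] := Dfg.
  apply: le_trans (saddle _ _ Dfg); apply: (mse_le sf sg mA A_le); exact: h0L2s.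
- split.
  + by move=> f g [[/= sf _] [/= sg _]]; exact: h0L2s.
  + by exists (f0, g0).
  (* The worst error of [h] is at least its error at (f0, g0), where [h0] is optimal. *)
  + move=> h hD; rewrite worst; apply: (@le_trans _ _ (Delta Rs a h f0 g0)).
      by case: opt => _; apply; exact: hD.
    by apply: ereal_sup_ubound; exists (f0, g0).
Qed.
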